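(* Consider the multi-class reusable-resource system with irregular valuation distributions, and let $\Omega^M_{irreg}(C)$ be the set of all instances $(C,\Lambda_1,\dots,\Lambda_M,F_1,\dots,F_M,G_1,\dots,G_M)$ with $\Lambda_j>0$, $F_j$ irregular (i.e. not regular), and $G_j$ a service-time distribution on $[0,\infty)$ with finite mean, $j=1,\dots,M$. Let $G(C)=1-\frac{(C-1)^C/C!}{\sum_{i=0}^C(C-1)^i/i!}$ (with $0^0=1$). (a) If randomized static policies are allowed, then $$\inf_{C,M\in\mathbb N}\ \inf_{\Omega^M_{irreg}(C)}\frac{\bar{\mathcal R}^{sta*}}{\bar{\mathcal R}^*}=\inf_{C\in\mathbb N}G(C)\ge\frac{15}{19}.$$ (b) If pricing must be deterministic and static, then $$\inf_{C,M\in\mathbb N}\ \inf_{\Omega^M_{irreg}(C)}\frac{\mathcal R^{sta*}}{\bar{\mathcal R}^*}=\inf_{C\in\mathbb N}\frac{C}{2C-1}\ge\frac12.$$ Here $\bar{\mathcal R}^*$ and $\bar{\mathcal R}^{sta*}$ are the optimal fully dynamic and static revenue rates when each revenue rate function is replaced by its concave envelope, and $\mathcal R^{sta*}$ is the optimal static revenue rate with the original revenue rate functions (see context).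
   Context: Model. A provider has $C\ge1$ units of one reusable resource shared by $M\ge 1$ customer classes. Class $j$ customers arrive by independent Poisson processes with rate $\Lambda_j>0$ and have i.i.d. valuations with CDF $F_j$ and density $f_j$; $F_j$ has interval support $[\underline v_j,\bar v_j]\subseteq\mathbb R_+$ ($\bar v_j$ may be $\infty$) and is continuously differentiable with $f_j>0$ on $(\underline v_j,\bar v_j)$. If at least one unit is free, an arriving class $j$ customer buys iff the valuation exceeds the currently offered class $j$ price; if no unit is free the customer is lost. A buyer occupies one unit for a service time with distribution $G_j$ of mean $1/\mu^j\in(0,\infty)$; service times are independent of each other and of valuations. Price $p$ corresponds to effective arrival rate $\Lambda_j(1-F_j(p))\in[0,\Lambda_j]$, with inverse $p^j(\lambda)$ ($p^j(\Lambda_j)=\underline v_j$, $p^j(0)=\bar v_j$). The revenue rate function is $r^j(\lambda)=\lambda p^j(\lambda)$ on $[0,\Lambda_j]$; if $\bar v_j=\infty$, $r^j(0)$ is the limit of $r^j(\lambda)$ as $\lambda\to0$, presupposed to exist and be finite. $F_j$ is regular if $x-\frac{1-F_j(x)}{f_j(x)}$ is non-decreasing (equivalently $r^j$ is concave) and irregular otherwise. $\bar r^j$ denotes the concave envelope of $r^j$ on $[0,\Lambda_j]$; the point $(\lambda,\bar r^j(\lambda))$ is implementable by randomizing between two prices, independently of the state. States and policies. A state is $\bm s=(\bm x,\bm y_1,\dots,\bm y_M)$, where $\bm x=(x_1,\dots,x_M)$, $x_j\in\{0,1,\dots\}$ is the number of class $j$ customers in service, $\sum_jx_j\le C$, and $\bm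 y_j\in\mathbb R_+^{x_j}$ lists the service times already elapsed. $\mathcal S_{\bm x}$ is the set of states with counts $\bm x$. A fully dynamic policy $\bm\lambda=\{\lambda^j_{\bm s}\}$ chooses $\lambda^j_{\bm s}\in[0,\Lambda_j]$ for each state and class (nothing is accepted when $\sum_jx_j=C$); $\Pi^{\bm\lambda}$ is its stationary probability measure on states. A static policy uses one constant $\lambda^j$ per class. Existence of stationary measures and of the optimal values is taken as part of the model. Define $$\bar{\mathcal R}^{\bm\lambda}=\sum_{i=0}^{C-1}\sum_{x_1+\cdots+x_M=i}\int_{\mathcal S_{\bm x}}\sum_{j=1}^M\bar r^j(\lambda^j_{\bm s})\,\Pi^{\bm\lambda}(d\bm s),$$ and $\bar{\mathcal R}^*=\sup_{\bm\lambda}\bar{\mathcal R}^{\bm\lambda}$ over fully dynamic policies. For static rates, by the known insensitivity property, $$\bar{\mathcal R}(\lambda^1,\dots,\lambda^M)=\Big(\sum_{j}\bar r^j(\lambda^j)\Big)\frac{\sum_{i=0}^{C-1}\rho^i/i!}{\sum_{i=0}^{C}\rho^i/i!},\qquad \rho=\sum_j\frac{\lambda^j}{\mu^j};$$ $\bar{\mathcal R}^{sta*}$ is its maximum over $\lambda^j\in[0,\Lambda_j]$ (best randomized static policy), and $\mathcal R^{sta*}$ is the maximum of the same expression with $r^j$ in place of $\bar r^j$ (best deterministic static policy). *)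

(* Defs.v *)
From HB Require Import structures.
From mathcomp Require Import all_boot all_order all_algebra.
From mathcomp Require Import all_classical all_reals all_analysis.
Set Implicit Arguments.
Unset Strict Implicit.
Unset Printing Implicit Defensive.
Import Order.TTheory GRing.Theory Num.Theory.
Import numFieldNormedType.Exports.

Local Open Scope classical_set_scope.
Local Open Scope ring_scope.

Definition law_cdf (R : realType) (P : probability R R) (x : R) : R :=
  fine (P [set` `]-oo, x]]).

(* The density is fixed on ]val_lo, val_hi[ as the continuous derivative of the
   CDF; elsewhere it is only determined almost everywhere. *)
Record valuation (R : realType) := Valuation {
  val_law : probability R R;
  val_dens : R -> R;
  val_lo : R;
  val_hi : \bar R;
  val_lo_ge0 : 0 <= val_lo;
  val_lo_hi : (val_lo%:E < val_hi)%E;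
  val_support : val_law [set x | (val_lo%:E <= x%:E <= val_hi)%E] = 1%E;
  val_dens_meas : measurable_fun [set: R] val_dens;
  val_dens_ge0 : forall x, 0 <= val_dens x;
  val_densE : forall A : set R, measurable A ->
    val_law A = (\int[lebesgue_measure]_(x in A) (val_dens x)%:E)%E;
  val_smooth : forall x : R, (val_lo%:E < x%:E < val_hi)%E ->
    [/\ is_derive x 1 (law_cdf val_law) (val_dens x),
        {for x, continuous val_dens} & 0 < val_dens x] }.

Section Pricing.
Variable R : realType.
Implicit Types (V : valuation R) (L lam : R).

Definition val_cdf V : R -> R := law_cdf (val_law V).

Definition virtual_value V (x : R) : R := x - (1 - val_cdf V x) / val_dens V x.

Definition regular V : Prop :=
  forall x y : R, val_lo V < x -> x <= y -> (y%:E < val_hi V)%E ->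
    virtual_value V x <= virtual_value V y.

Definition irregular V : Prop := ~ regular V.

(* The price in the support that induces the effective rate lam; it is unique
   for lam in [0, L], except that none exists when lam = 0 and val_hi = +oo. *)
Definition price V L lam : R :=
  xget (val_lo V) [set x | ((val_lo V)%:E <= x%:E <= val_hi V)%E /\
                           L * (1 - val_cdf V x) = lam].

Definition revenue V L lam : R :=
  if (lam == 0) && (val_hi V == +oo%E)
  then lim (l * price V L l @[l --> 0^'+])
  else lam * price V L lam.

Definition concave_on L (h : R -> R) : Prop :=
  convex_function (E := R^o) [set` `[0, L]] (fun x => - h x).

Definition concave_envelope L (g : R -> R) lam : R :=
  inf [set h lam | h in [set h : R -> R |
         concave_on L h /\ forall x, x \in `[0, L] -> g x <= h x]].

End Pricing.

Definition service_mean (R : realType) (G : probability R R) : \bar R :=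
  (\int[G]_x x%:E)%E.

Record customer_class (R : realType) := CustomerClass {
  cl_rate : R;
  cl_val : valuation R;
  cl_serv : probability R R;
  cl_rate_gt0 : 0 < cl_rate;
  (* finiteness of the revenue rate at 0 when valuations are unbounded *)
  cl_rev0 : val_hi cl_val = +oo%E ->
    cvg (l * price cl_val cl_rate l @[l --> 0^'+]);
  cl_serv_ge0 : cl_serv [set` `[0, +oo[] = 1%E;
  cl_serv_mean : (0 < service_mean cl_serv < +oo)%E }.

Section System.
Variables (R : realType) (C M : nat) (I : 'I_M -> customer_class R).

Definition rev (j : 'I_M) : R -> R := revenue (cl_val (I j)) (cl_rate (I j)).

Definition revbar (j : 'I_M) : R -> R :=
  concave_envelope (cl_rate (I j)) (rev j).

(* mean service time, i.e. the inverse of the service rate *)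
Definition mean_service (j : 'I_M) : R := fine (service_mean (cl_serv (I j))).

Definition static_rates : set ('I_M -> R) :=
  [set lam | forall j, 0 <= lam j <= cl_rate (I j)].

(* Insensitivity: the blocking probability depends on the service laws only
   through the offered load rho (Erlang's loss formula). *)
Definition static_revenue (q : 'I_M -> R -> R) (lam : 'I_M -> R) : R :=
  let rho := \sum_(j < M) lam j * mean_service j in
  (\sum_(j < M) q j (lam j)) *
  ((\sum_(0 <= i < C) rho ^+ i / i`!%:R) /
   (\sum_(0 <= i < C.+1) rho ^+ i / i`!%:R)).

Definition static_opt (q : 'I_M -> R -> R) : \bar R :=
  ereal_sup [set (static_revenue q lam)%:E | lam in static_rates].

End System.

(* s j lists the elapsed service times of the class j customers in service, in
   order of arrival. The type is larger than the state space: the capacity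
   constraint and the signs of the ages are imposed by state_space below. *)
Definition raw_state (R : realType) (M : nat) := {ffun 'I_M -> seq R}.

HB.instance Definition _ (R : realType) (M : nat) :=
  Choice.on (raw_state R M).
HB.instance Definition _ (R : realType) (M : nat) :=
  isPointed.Build (raw_state R M) [ffun=> [::]].

(* These sets generate the sigma-algebra of the disjoint union, over all
   vectors of counts, of the corresponding Euclidean spaces. *)
Definition state_gen (R : realType) (M : nat) : set (set (raw_state R M)) :=
  [set A | (exists (j : 'I_M) (n : nat), A = [set s : raw_state R M | size (s j) = n]) \/
           (exists (j : 'I_M) (k : nat) (B : set R), measurable B /\
              A = [set s : raw_state R M | B (nth 0 (s j) k)])].

Definition state (R : realType) (M : nat) :=
  g_sigma_algebraType (@state_gen R M).

Section Dynamics.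
Variables (R : realType) (C M : nat) (I : 'I_M -> customer_class R).
Implicit Types (s : state R M) (j : 'I_M) (t u : R).

Definition states_with (x : 'I_M -> nat) : set (state R M) :=
  [set s | forall j, size (s j) = x j /\ all (fun a => 0 <= a) (s j)].

Definition in_service s : nat := (\sum_(j < M) size (s j))%N.

Definition state_space : set (state R M) :=
  [set s | (in_service s <= C)%N /\
           states_with (fun j => size (s j)) s].

Definition survival (G : probability R R) t : R := fine (G [set` `]t, +oo[]).

(* P(S > a + u | S > a); the convention x / 0 = 0 makes a customer whose age
   cannot be reached depart at once. *)
Definition residual (G : probability R R) (a u : R) : R :=
  survival G (a + u) / survival G a.

(* Customers in service are indexed by (class, position in the list). *)
Definition present s : {set 'I_M * 'I_C} :=
  [set k : 'I_M * 'I_C | (k.2 < size (s k.1))%N]%SET.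

Definition stay_prob s (k : 'I_M * 'I_C) u : R :=
  residual (cl_serv (I k.1)) (nth 0 (s k.1) k.2) u.

Definition aged s (K : {set 'I_M * 'I_C}) u : state R M :=
  [ffun j => [seq nth 0 (s j) k + u | k : 'I_C <- enum 'I_C & (j, k) \in K]].

(* Expectation of f at the state reached from s after a time u during which
   nobody joins; K ranges over the possible sets of remaining customers. *)
Definition age_op u (f : state R M -> \bar R) s : \bar R :=
  (\sum_(K in powerset (present s))
     (\prod_(k in present s)
        (if k \in K then stay_prob s k u else 1 - stay_prob s k u))%R%:E
     * f (aged s K u))%E.

Definition add_customer j s : state R M :=
  [ffun i => if i == j then rcons (s i) 0 else s i].

Definition policy := state R M -> 'I_M -> R.

Definition admissible (pol : policy) : Prop :=
  (forall j, measurable_fun [set: state R M] (fun s => pol s j)) /\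
  (forall s j, 0 <= pol s j <= cl_rate (I j)).

(* Arrivals of class j (rate cl_rate) buy with probability pol s j / cl_rate.
   A buyer whose service time is 0 leaves the state unchanged; otherwise it
   enters with age 0. The result is the arrival rate times the expectation of f
   just after the arrival. *)
Definition arrival_op (pol : policy) (f : state R M -> \bar R) s : \bar R :=
  (\sum_(j < M)
     if (in_service s < C)%N then
       let a := (pol s j * survival (cl_serv (I j)) 0)%R in
       a%:E * f (add_customer j s) + (cl_rate (I j) - a)%R%:E * f s
     else (cl_rate (I j))%:E * f s)%E.

Definition total_rate : R := \sum_(j < M) cl_rate (I j).

(* Probability, starting from s, that exactly n customers (buying or not)
   arrive during [0, t] and that the state at time t is in B; the recursion
   conditions on the time u of the first arrival. *)
Fixpoint transition_n (pol : policy) (n : nat) t (B : set (state R M)) s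
    : \bar R :=
  if n is n'.+1 then
    (\int[lebesgue_measure]_(u in `[0%R, t])
       ((expR (- total_rate * u))%:E *
        age_op u (arrival_op pol (transition_n pol n' (t - u) B)) s))%E
  else ((expR (- total_rate * t))%:E *
        age_op t (fun s' => (\1_B s')%:E) s)%E.

Definition transition (pol : policy) t (B : set (state R M)) s : \bar R :=
  (\sum_(0 <= n <oo) transition_n pol n t B s)%E.

Definition stationary (pol : policy) (Pi : probability (state R M) R) : Prop :=
  Pi state_space = 1%E /\
  forall (t : R) (B : set (state R M)), 0 <= t -> measurable B ->
    (\int[Pi]_s transition pol t B s = Pi B)%E.

Definition dynamic_revenue (pol : policy) (Pi : probability (state R M) R)
    : \bar R :=
  (\sum_(i < C) \sum_(x : {ffun 'I_M -> 'I_C.+1} |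
                       (\sum_(j < M) x j)%N == i)
     \int[Pi]_(s in states_with (fun j => x j))
       (\sum_(j < M) revbar I j (pol s j))%R%:E)%E.

(* Ranging over pairs (policy, stationary law) amounts to ranging over policies:
   every policy has a single stationary law, because the system empties. *)
Definition dynamic_opt : \bar R :=
  ereal_sup [set v | exists (pol : policy) (Pi : probability (state R M) R),
    [/\ admissible pol, stationary pol Pi & v = dynamic_revenue pol Pi]].

Definition static_opt_randomized : \bar R := static_opt C I (revbar I).

Definition static_opt_deterministic : \bar R := static_opt C I (rev I).

End Dynamics.

Definition Omega_irreg (R : realType) (M : nat)
    : set ('I_M -> customer_class R) :=
  [set I | forall j, irregular (cl_val (I j))].

Definition Gratio (R : realType) (C : nat) : R :=
  1 - (C.-1%:R ^+ C / C`!%:R) / (\sum_(0 <= i < C.+1) C.-1%:R ^+ i / i`!%:R).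

Definition inf_irreg (R : realType)
    (ratio : forall C M : nat, ('I_M -> customer_class R) -> \bar R) : \bar R :=
  ereal_inf [set ereal_inf [set ratio CM.1 CM.2 I | I in @Omega_irreg R CM.2] |
    CM in [set CM : nat * nat | (0 < CM.1)%N /\ (0 < CM.2)%N]].

(* Main.v *)
(** Lower bounds: by Little's law the mean number in service of a stationary
    policy equals its offered throughput, so if [p] is its probability of not
    being full and [rho] the load of its mean rates given not full, then
    [p * rho + p <= C].  Jensen's inequality for the concave envelopes compares
    it with the static policy at these mean rates, and the Erlang loss formula
    is worst at [p = 1], [rho = C - 1].  For deterministic prices a supporting
    line of the envelope is compared with the original revenue function.

    Tightness: take one class with unit service times and valuations of tail
    [w / x + (1 - w) / x ^ (m + 1)].  For small [w] and large [m] the revenue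
    rate is nearly the constant [A * w] except at full demand [A], where it
    jumps to [A], and its envelope is nearly the chord.  The dynamic policy
    that admits everyone with fewer than [C - 1] units busy and nobody
    otherwise is never full, so it earns the intercept at all times and a
    throughput tending to [C - 1] as [A] grows.  Its stationary law is
    constructed explicitly by regeneration. *)
From HB Require Import structures.
Require Import Defs.
From mathcomp Require Import all_boot all_order all_algebra.
From mathcomp Require Import all_classical all_reals all_analysis.
From mathcomp Require Import measurable_realfun.
From mathcomp Require Import ring lra.
Set Implicit Arguments.
Unset Strict Implicit.
Unset Printing Implicit Defensive.
Import Order.TTheory GRing.Theory Num.Theory.
Import numFieldNormedType.Exports.
Local Open Scope classical_set_scope.
Local Open Scope ring_scope.

(** Nothing is known about an arbitrary dynamic policy beyond the invariance of its law on sets, and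
    service times may be unbounded. Little's law is therefore extracted by testing invariance over
    one short step [e] against a bounded function, the residual work truncated at a fixed horizon:
    histories with two or more arrivals are discarded because work is nonnegative, the other errors
    vanish with [e], and the horizon is removed last. Conversely, checking that a law is stationary
    would mean summing histories with any number of arrivals; decomposing at the last arrival leaves
    an identity with a single arrival, which Fubini's theorem turns into full invariance. The
    explicit law rests on unit service times: a gap of at least 1 between arrivals empties the
    system, so the chain seen at arrivals restarts from one fresh customer with probability
    [exp (- L)] each time. Part (a) needs only [C = 3], where [G] attains its infimum 15/19; part
    (b) needs a family for each [C >= 2]. *)

(** * Layer sums, and linear functionals as integrals *)

(** Up to level [m e], the staircase of step [e] lies between [y] and [y + e]. It serves both to
    approximate measurable functions and to compare survival sums with truncated means. *)
Lemma layer_ge (R : realType) (e y : R) m : 0 <= e -> 0 <= y ->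
  Num.min y (m%:R * e) <= \sum_(k < m) e * (k%:R * e < y)%R%:R.
Proof.
move=> e0 y0; elim: m => [|m IH].
  by rewrite big_ord0 mul0r ge_min lexx orbT.
rewrite big_ord_recr/=.
have [my|my] := ltP (m%:R * e) y.
  rewrite ge_min; apply/orP; right; rewrite mulr1 -natr1 mulrDl mul1r lerD2r.
  by apply: le_trans IH; rewrite le_min (ltW my) lexx.
rewrite mulr0 addr0; apply: le_trans IH.
by rewrite le_min !ge_min lexx my.
Qed.

Lemma layer_le (R : realType) (e y : R) m : 0 <= e -> 0 <= y ->
  \sum_(k < m) e * (k%:R * e < y)%R%:R <= y + e.
Proof.
move=> e0 y0; elim: m => [|m IH]; first by rewrite big_ord0 addr_ge0.
rewrite big_ord_recr/=; have [my|my] := ltP (m%:R * e) y; last first.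
  by rewrite mulr0 addr0.
rewrite mulr1 lerD2r (le_trans _ (ltW my))//.
rewrite (le_trans (y := \sum_(k < m) e))//.
  by apply: ler_sum => k _; case: ltP => _; rewrite ?mulr1 ?mulr0.
by rewrite sumr_const card_ord mulr_natl.
Qed.

Section integral_complements.
Local Open Scope ereal_scope.
Context d (T : measurableType d) (R : realType).
Variable mu : {measure set T -> \bar R}.

(** The integral of a nonnegative function is a supremum over the simple functions below it, and
    that family grows with the function; this also covers integrands not yet known to be
    measurable. *)
Lemma le_integral_ge0 (D : set T) (f g : T -> \bar R) :
  (forall x, D x -> 0 <= f x) -> (forall x, D x -> f x <= g x) ->
  \int[mu]_(x in D) f x <= \int[mu]_(x in D) g x.
Proof.
move=> f0 fg.
have g0 x : D x -> 0 <= g x by move=> Dx; exact: le_trans (f0 _ Dx) (fg _ Dx).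
rewrite !ge0_integralE//; apply: le_ereal_sup => _ [h hf <-]; exists h => // x.
by apply: le_trans (hf x) _; rewrite /patch; case: ifPn => //; rewrite inE; exact: fg.
Qed.

Definition nnm (f : T -> \bar R) := measurable_fun [set: T] f /\ forall x, 0 <= f x.

Lemma eq_nnm g f : f =1 g -> nnm g -> nnm f.
Proof. by move=> /funext ->. Qed.

Lemma nnmD f g : nnm f -> nnm g -> nnm (fun x => f x + g x).
Proof.
move=> [mf f0] [mg g0]; split; first exact: emeasurable_funD.
by move=> x; rewrite adde_ge0.
Qed.

Lemma nnmZ (c : R) f : (0 <= c)%R -> nnm f -> nnm (fun x => c%:E * f x).
Proof.
move=> c0 [mf f0]; split; first exact: measurable_funeM.
by move=> x; rewrite mule_ge0.
Qed.

Lemma nnm_cst (c : R) : (0 <= c)%R -> nnm (fun=> c%:E).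
Proof. by move=> c0; split. Qed.

Lemma nnm_indic A : measurable A -> nnm (fun x => (\1_A x)%:E).
Proof.
move=> mA; split; last by move=> x; rewrite lee_fin.
by apply/measurable_EFinP; exact: measurable_indic.
Qed.

Lemma nnm_sum I (s : seq I) (P : pred I) (F : I -> T -> \bar R) :
  (forall i, P i -> nnm (F i)) -> nnm (fun x => \sum_(i <- s | P i) F i x).
Proof.
move=> F0; elim: s => [|i s IH].
  by apply: (@eq_nnm (cst 0)) => [x|]; [rewrite big_nil|exact: nnm_cst].
apply: (@eq_nnm (fun x => if P i then F i x + \sum_(j <- s | P j) F j x
                         else \sum_(j <- s | P j) F j x)) => [x|].
  by rewrite /= big_cons.
by case: (boolP (P i)) => // Pi; apply: nnmD => //; exact: F0.
Qed.

(* A bounded f lies within c / m of the step function with levels c * k / m. *)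
Lemma functional_integral (Phi : (T -> \bar R) -> \bar R) (f : T -> \bar R) (c : R) :
  mu setT = 1 ->
  (forall f g, nnm f -> nnm g -> Phi (fun x => f x + g x) = Phi f + Phi g) ->
  (forall (a : R) f, (0 <= a)%R -> nnm f ->
     Phi (fun x => a%:E * f x) = a%:E * Phi f) ->
  (forall f g, nnm f -> nnm g -> (forall x, f x <= g x) -> Phi f <= Phi g) ->
  (forall A, measurable A -> Phi (fun x => (\1_A x)%:E) = mu A) ->
  nnm f -> (forall x, f x <= c%:E) ->
  Phi f = \int[mu]_x f x.
Proof.
move=> mu1 PhiD PhiZ Phi_le Phi1 [mf f0] fc.
have Phi_one : Phi (fun=> 1) = 1.
  rewrite -[RHS]mu1 -(Phi1 _ measurableT).
  by congr Phi; apply/funext => x; rewrite indicT.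
have Phi_cst (a : R) : (0 <= a)%R -> Phi (fun=> a%:E) = a%:E.
  move=> a0; have := PhiZ a (fun=> 1) a0 (nnm_cst ler01).
  by rewrite Phi_one; rewrite (_ : a%:E * 1 = a%:E)// mule1.
have [[x0 _]|x0] := pselect (exists x : T, True); last first.
  have T0 : setT = set0 :> set T by rewrite -subset0 => x _; apply: x0; exists x.
  by move: mu1; rewrite T0 measure0 => /esym/eqP; rewrite onee_eq0.
have c0 : (0 <= c)%R.
  by rewrite -lee_fin; exact: le_trans (f0 x0) (fc x0).
have ffin x : f x \is a fin_num.
  by rewrite ge0_fin_numE//; exact: le_lt_trans (fc x) (ltry _).
have fin0 : 0 <= \int[mu]_x f x by exact: integral_ge0.
have intfin : \int[mu]_x f x \is a fin_num.
  rewrite ge0_fin_numE//; apply: (@le_lt_trans _ _ (\int[mu]_x (cst c%:E) x)).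
    by apply: le_integral_ge0.
  by rewrite integral_cst// mu1 mule1 ltry.
have layers (e : R) (m : nat) : (0 <= e)%R -> (m%:R * e = c)%R ->
    Phi f <= \int[mu]_x f x + e%:E /\ \int[mu]_x f x <= Phi f + e%:E.
  move=> e0 mec.
  pose B k := [set x | (k%:R * e)%:E < f x].
  have mB k : measurable (B k).
    rewrite -[B k]setTI; exact: emeasurable_fun_o_infty.
  pose phi (n : nat) x := \sum_(k < n) e%:E * (\1_(B k) x)%:E.
  have phiE n x : phi n x = (\sum_(k < n) e * ((k%:R * e < fine (f x))%R%:R))%:E.
    rewrite /phi -sumEFin; apply: eq_bigr => k _; rewrite -EFinM; congr (_ * _)%:E.
    rewrite indicE; congr (_%:R); congr nat_of_bool.
    apply/idP/idP; first by rewrite inE /B/= -{1}[f x](fineK (ffin x)) lte_fin.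
    by move=> h; rewrite inE /B/= -[f x](fineK (ffin x)) lte_fin.
  have phin n : nnm (phi n).
    by apply: nnm_sum => k _; apply: nnmZ => //; exact: nnm_indic.
  have Phiphi n : Phi (phi n) = \int[mu]_x phi n x.
    elim: n => [|n IH].
      rewrite (_ : phi 0%N = fun=> 0); last by apply/funext => x; rewrite /phi big_ord0.
      by rewrite integral0 (Phi_cst 0)%R.
    have recr : phi n.+1 = fun x => phi n x + e%:E * (\1_(B n) x)%:E.
      by apply/funext => x; rewrite /phi big_ord_recr.
    have nB : nnm (fun x => (\1_(B n) x)%:E) by exact: nnm_indic.
    have neB := nnmZ e0 nB.
    rewrite recr PhiD// IH ge0_integralD//; [congr (_ + _)|by move=> ? _; apply: (phin _).2|exact: (phin _).1|by move=> ? _; apply: neB.2|exact: neB.1].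
    rewrite PhiZ// Phi1// ge0_integralZl//; last exact: nB.1.
    by rewrite integral_indic// setIT.
  have fphi x : f x <= phi m x.
    rewrite phiE -[leLHS](fineK (ffin x)) lee_fin.
    have := @layer_ge R e (fine (f x)) m e0 (fine_ge0 (f0 x)).
    rewrite mec min_l// -lee_fin fineK//.
  have phif x : phi m x <= f x + e%:E.
    rewrite phiE -{2}[f x](fineK (ffin x)) -EFinD lee_fin.
    by apply: layer_le => //; exact: fine_ge0.
  have nf : nnm f by [].
  split.
    apply: le_trans (Phi_le _ _ nf (phin m) fphi) _; rewrite Phiphi.
    rewrite (le_trans (le_integral_ge0 _ (fun x _ => phif x)))//.
      by move=> x _; apply: (phin _).2.
    rewrite ge0_integralD//.
    by rewrite (integral_cst mu measurableT) mu1 mule1.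
  rewrite (le_trans (le_integral_ge0 _ (fun x _ => fphi x)))// -Phiphi.
  have := Phi_le _ _ (phin m) (nnmD nf (nnm_cst e0)) phif.
  by rewrite PhiD ?Phi_cst//; exact: nnm_cst.
have key (e : R) : (0 < e)%R -> Phi f <= \int[mu]_x f x + e%:E /\ \int[mu]_x f x <= Phi f + e%:E.
  move=> e0.
  pose m := (Num.truncn (c / e)).+1.
  have m0 : (0 < m%:R :> R)%R by rewrite ltr0n.
  have cm : (c / m%:R <= e)%R.
    rewrite ler_pdivrMr// mulrC -ler_pdivrMr//.
    by apply/ltW; apply: truncnS_gt.
  have cm0 : (0 <= c / m%:R)%R by rewrite divr_ge0// ltW.
  have [|A B] := layers (c / m%:R)%R m cm0; first by rewrite mulrC divfK// gt_eqF.
  split; first by apply: le_trans A _; rewrite leeD2l// lee_fin.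
  by apply: le_trans B _; rewrite leeD2l// lee_fin.
apply/eqP; rewrite eq_le; apply/andP; split.
  by apply/lee_addgt0Pr => e e0; exact: (key e e0).1.
by apply/lee_addgt0Pr => e e0; exact: (key e e0).2.
Qed.

End integral_complements.

(** * Measurability on the state space *)

Section state_measurability.
Context (R : realType) (M : nat).
Notation st := (state R M).

Lemma measurable_size_eq (j : 'I_M) n : measurable [set s : st | size (s j) = n].
Proof. by apply: sub_sigma_algebra; left; exists j, n. Qed.

Lemma measurable_size (j : 'I_M) : measurable_fun [set: st] (fun s : st => size (s j)).
Proof.
move=> _ B _; rewrite setTI.
rewrite (_ : _ @^-1` B = \bigcup_(n in B) [set s : st | size (s j) = n]).
  by apply: bigcup_measurable => n _; exact: measurable_size_eq.
by apply/seteqP; split => [s Bs|s [n Bn sn]]; [exists (size (s j))|rewrite /= (sn : size _ = _)].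
Qed.

Lemma measurable_age (j : 'I_M) k :
  measurable_fun [set: st] (fun s : st => nth 0 (s j) k : R).
Proof.
move=> _ B mB; rewrite setTI.
by apply: sub_sigma_algebra; right; exists j, k, B.
Qed.

Lemma measurable_to_state d (T : measurableType d) (f : T -> st) :
  (forall j, measurable_fun [set: T] (fun x => size (f x j))) ->
  (forall j k, measurable_fun [set: T] (fun x => nth 0 (f x j) k : R)) ->
  measurable_fun [set: T] f.
Proof.
move=> fsize fage; apply: (@measurability _ _ T st setT f (@state_gen R M)) => //.
move=> _ [_ [[j [n ->]]|[j [k [B [mB ->]]]]] <-].
  rewrite (_ : _ @^-1` _ = (fun x => size (f x j)) @^-1` [set n])//.
  exact: fsize.
rewrite (_ : _ @^-1` _ = (fun x => nth 0 (f x j) k : R) @^-1` B)//.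
exact: fage.
Qed.

Lemma measurable_forall d (T : measurableType d) (J : finType) (b : J -> T -> bool) :
  (forall k, measurable_fun [set: T] (b k)) ->
  measurable_fun [set: T] (fun x => [forall k, b k x]).
Proof.
move=> mb; apply: (measurable_fun_bool true); rewrite setTI.
rewrite (_ : _ @^-1` _ = \big[setI/setT]_(k : J) (b k @^-1` [set true])).
  by apply: bigsetI_measurable => k _; rewrite -[X in measurable X]setTI; exact: mb.
apply/seteqP; split => [x /= /forallP bx|x].
  by rewrite -bigcap_seq => k _; exact: bx.
by rewrite -bigcap_seq => bx /=; apply/forallP => k; apply: bx; rewrite /= mem_index_enum.
Qed.

Lemma measurable_addn d (T : measurableType d) (f g : T -> nat) :
  measurable_fun [set: T] f -> measurable_fun [set: T] g ->
  measurable_fun [set: T] (fun x => f x + g x)%N.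
Proof.
move=> mf mg _ B _; rewrite setTI.
rewrite (_ : _ @^-1` B = \bigcup_n (f @^-1` [set n] `&` g @^-1` [set m | B (n + m)%N])).
  apply: bigcup_measurable => n _; apply: measurableI.
    by rewrite -[X in measurable X]setTI; exact: mf.
  by rewrite -[X in measurable X]setTI; exact: mg.
apply/seteqP; split => [x Bx|x [n _ [/= fn]]]; first by exists (f x).
by rewrite /= fn.
Qed.

Lemma measurable_in_service : measurable_fun [set: st] (fun s : st => in_service s).
Proof.
rewrite /in_service.
suff: forall r : seq 'I_M, measurable_fun [set: st] (fun s : st => \sum_(j <- r) size (s j))%N.
  exact.
elim=> [|j r IH].
  by rewrite (_ : (fun s => _) = cst 0%N)//; apply/funext => s; rewrite big_nil.
rewrite (_ : (fun s => _) = fun s : st => size (s j) + \sum_(i <- r) size (s i))%N.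
  by apply: measurable_addn => //; exact: measurable_size.
by apply/funext => s; rewrite big_cons.
Qed.

End state_measurability.

Section operator_measurability.
Context (R : realType) (C M : nat) (I : 'I_M -> customer_class R).
Notation st := (state R M).

Lemma survival_ge0 (G : probability R R) t : 0 <= survival G t.
Proof. by rewrite fine_ge0. Qed.

Lemma survivalE (G : probability R R) t : (survival G t)%:E = G [set` `]t, +oo[].
Proof. by rewrite /survival fineK// fin_num_measure. Qed.

Lemma survival_nonincreasing (G : probability R R) : nonincreasing_fun (survival G).
Proof.
move=> s t st0; rewrite -lee_fin !survivalE le_measure ?inE//.
by apply: subset_itvr; rewrite bnd_simp.
Qed.

Lemma survival_le1 (G : probability R R) t : survival G t <= 1.
Proof. by rewrite -lee_fin survivalE probability_le1. Qed.

Lemma measurable_survival (G : probability R R) : measurable_fun [set: R] (survival G).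
Proof. by apply: nonincreasing_measurable => //; exact: survival_nonincreasing. Qed.

Lemma residual_ge0 (G : probability R R) a u : 0 <= residual G a u.
Proof. by rewrite divr_ge0// survival_ge0. Qed.

Lemma residual_le1 (G : probability R R) a u : 0 <= u -> residual G a u <= 1.
Proof.
move=> u0; rewrite /residual; have [->|S0] := eqVneq (survival G a) 0.
  by rewrite invr0 mulr0.
rewrite ler_pdivrMr ?lt0r ?S0 ?survival_ge0// mul1r.
by apply: survival_nonincreasing; rewrite lerDl.
Qed.

Lemma measurable_residual (G : probability R R) d (T : measurableType d) (a u : T -> R) :
  measurable_fun [set: T] a -> measurable_fun [set: T] u ->
  measurable_fun [set: T] (fun x => residual G (a x) (u x)).
Proof.
move=> ma mu; apply: measurable_funM.
  apply: (measurableT_comp (measurable_survival G)); exact: measurable_funD.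
(* On nonnegative numbers total inversion is the power of exponent -1, also at 0, and powers are
   measurable. *)
rewrite (_ : (fun x => _) = (fun y => y `^ (-1)) \o (survival G \o a)); last first.
  by apply/funext => x /=; rewrite powR_inv1// survival_ge0.
apply: measurableT_comp; first exact: measurable_powR.
by apply: measurableT_comp => //; exact: measurable_survival.
Qed.

Lemma measurable_stay_prob d (T : measurableType d) (sigma : T -> st) (u : T -> R)
    (k : 'I_M * 'I_C) :
  measurable_fun [set: T] sigma -> measurable_fun [set: T] u ->
  measurable_fun [set: T] (fun x => stay_prob I (sigma x) k (u x)).
Proof.
move=> ms mu; apply: measurable_residual => //.
exact: (measurableT_comp (measurable_age _ _)).
Qed.

Lemma measurable_present (k : 'I_M * 'I_C) :
  measurable_fun [set: st] (fun s : st => k \in present C s).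
Proof.
rewrite (_ : (fun s : st => _) = (fun n : nat => (k.2 < n)%N) \o (fun s : st => size (s k.1))).
  exact: measurableT_comp (measurable_size _).
by apply/funext => s /=; rewrite inE.
Qed.

Lemma measurable_aged d (T : measurableType d) (sigma : T -> st) (u : T -> R)
    (K : {set 'I_M * 'I_C}) :
  measurable_fun [set: T] sigma -> measurable_fun [set: T] u ->
  measurable_fun [set: T] (fun x => aged (sigma x) K (u x)).
Proof.
move=> ms mu; apply: measurable_to_state => j.
  rewrite (_ : (fun x => _) = cst (size [seq i <- enum 'I_C | (j, i) \in K]))//.
  by apply/funext => x; rewrite /aged ffunE size_map.
move=> k; set r := [seq i <- enum 'I_C | (j, i) \in K].
have [kr|kr] := ltnP k (size r).
  have [i0 _] : exists i, i \in r by case: r kr => [//|i r' _]; exists i; rewrite mem_head.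
  rewrite (_ : (fun x => _) = fun x => nth 0 (sigma x j) (nth i0 r k) + u x).
    by apply: measurable_funD => //; exact: (measurableT_comp (measurable_age _ _)).
  by apply/funext => x; rewrite /aged ffunE (nth_map i0).
rewrite (_ : (fun x => _) = cst 0)//.
by apply/funext => x; rewrite /aged ffunE nth_default// size_map.
Qed.

Lemma measurable_age_op d (T : measurableType d) (sigma : T -> st) (u : T -> R)
    (f : T -> st -> \bar R) :
  measurable_fun [set: T] sigma -> measurable_fun [set: T] u ->
  measurable_fun [set: T * st] (fun z => f z.1 z.2) ->
  measurable_fun [set: T] (fun x => age_op C I (u x) (f x) (sigma x)).
Proof.
move=> ms mu mf.
(* The index sets depend on the state; extending the sum to all [K] and the product to all [k]
   leaves fixed finite index sets with measurable conditions. *)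
rewrite (_ : (fun x => _) = fun x => (\sum_(K : {set 'I_M * 'I_C})
  if K \in powerset (present C (sigma x)) then
    (\prod_(k : 'I_M * 'I_C) if k \in present C (sigma x) then
       (if k \in K then stay_prob I (sigma x) k (u x)
        else 1 - stay_prob I (sigma x) k (u x)) else 1)%:E
    * f x (aged (sigma x) K (u x)) else 0)%E); last first.
  apply/funext => x; rewrite /age_op big_mkcond; apply: eq_bigr => K _.
  by case: ifPn => // _; rewrite [in LHS]big_mkcond.
apply: emeasurable_sum => K; apply: measurable_fun_ifT => //.
- rewrite (_ : (fun x => _) =
    fun x => [forall k, (k \in K) ==> (k \in present C (sigma x))]); last first.
    by apply/funext => x; rewrite powersetE; apply/fintype.subsetP/forall_inP.
  apply: measurable_forall => k; case: (k \in K) => //=.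
  exact: (measurableT_comp (measurable_present k)).
- apply: emeasurable_funM; last first.
    apply: (measurableT_comp (g := fun x => (x, aged (sigma x) K (u x))) mf).
    apply: measurable_fun_pair => //.
    exact: measurable_aged.
  apply/measurable_EFinP; apply: measurable_prod => k _.
  apply: measurable_fun_ifT => //.
    exact: (measurableT_comp (measurable_present k)).
  case: (k \in K); first exact: measurable_stay_prob.
  by apply: measurable_funB => //; exact: measurable_stay_prob.
Qed.
End operator_measurability.

(** * Ageing without arrivals *)

Section age_operator.
Context (R : realType) (C M : nat) (I : 'I_M -> customer_class R).
Notation st := (state R M).
Implicit Types (f g : st -> \bar R) (s : st).

Definition stay_weight s u (K : {set 'I_M * 'I_C}) : R :=
  \prod_(k in present C s)
    (if k \in K then stay_prob I s k u else 1 - stay_prob I s k u).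

Lemma stay_prob_itv s (k : 'I_M * 'I_C) u : 0 <= u -> 0 <= stay_prob I s k u <= 1.
Proof. by move=> u0; rewrite residual_ge0 residual_le1. Qed.

Lemma stay_weight_ge0 s u K : 0 <= u -> 0 <= stay_weight s u K.
Proof.
move=> u0; apply: prodr_ge0 => k _; have /andP[p0 p1] := stay_prob_itv s k u0.
by case: ifP => // _; rewrite subr_ge0.
Qed.

(** Expanding the product of the [p k + q k] picks [p] or [q] at each index; giving the indices
    outside [P] the weights 0 and 1 kills every subset not contained in [P]. *)
Lemma sum_prod_subset (J : finType) (P : {set J}) (p q : J -> R) :
  \sum_(K in powerset P) \prod_(k in P) (if k \in K then p k else q k)
  = \prod_(k in P) (p k + q k).
Proof.
pose p' k := if k \in P then p k else 0; pose q' k := if k \in P then q k else 1.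
rewrite [RHS](_ : _ = \prod_k (p' k + q' k)); last first.
  rewrite big_mkcond; apply: eq_bigr => k _; rewrite /p' /q'.
  by case: ifP => // _; rewrite add0r.
rewrite bigA_distr [LHS]big_mkcond; apply: eq_bigr => K _.
rewrite powersetE; case: ifPn => [/fintype.subsetP KP|/subsetPn[k kK kP]].
  rewrite big_mkcond; apply: eq_bigr => k _; rewrite /p' /q'.
  by case: (boolP (k \in P)) => // kP; case: ifP => // /KP; rewrite (negbTE kP).
by rewrite (bigD1 k)//= kK /p' (negbTE kP) mul0r.
Qed.

Lemma sum_stay_weight s u : \sum_(K in powerset (present C s)) stay_weight s u K = 1.
Proof.
rewrite sum_prod_subset; apply: big1 => k _.
by rewrite addrC subrK.
Qed.

(** The marginal law of one customer: replacing the leaving weight of [k] by 0 kills exactly the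
    subsets that omit [k], and the factors of the other customers sum to 1. *)
Lemma sum_stay_weight_in s u k : k \in present C s ->
  \sum_(K in powerset (present C s)) stay_weight s u K * (k \in K)%:R = stay_prob I s k u.
Proof.
move=> ks.
pose q i := if i == k then 0 else 1 - stay_prob I s i u.
rewrite (eq_bigr (fun K : {set 'I_M * 'I_C} => \prod_(i in present C s)
    (if i \in K then stay_prob I s i u else q i))); last first.
  move=> K _; have [kK|kK] := boolP (k \in K).
    rewrite mulr1; apply: eq_bigr => i _; case: ifPn => // iK.
    by rewrite /q ifN//; apply: contraNneq iK => ->.
  by rewrite mulr0 (bigD1 k)//= (negbTE kK) /q eqxx mul0r.
rewrite sum_prod_subset (bigD1 k)//= big1 ?mulr1 => [|i /andP[_ ik]].
  by rewrite /q eqxx addr0.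
by rewrite /q (negbTE ik) addrC subrK.
Qed.

Local Open Scope ereal_scope.

Lemma age_opE u f s : age_op C I u f s =
  \sum_(K in powerset (present C s)) (stay_weight s u K)%:E * f (aged s K u).
Proof. by []. Qed.

Lemma age_op_ge0 u f s : (0 <= u)%R -> (forall s, 0 <= f s) -> 0 <= age_op C I u f s.
Proof.
move=> u0 f0; rewrite age_opE; apply: sume_ge0 => K _.
by rewrite mule_ge0// lee_fin stay_weight_ge0.
Qed.

Lemma le_age_op u f g s : (0 <= u)%R -> (forall s, f s <= g s) ->
  age_op C I u f s <= age_op C I u g s.
Proof.
move=> u0 fg; rewrite !age_opE; apply: lee_sum => K _.
by rewrite lee_wpmul2l// lee_fin stay_weight_ge0.
Qed.

Lemma age_opD u f g s : (0 <= u)%R -> (forall s, 0 <= f s) -> (forall s, 0 <= g s) ->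
  age_op C I u (fun s => f s + g s) s = age_op C I u f s + age_op C I u g s.
Proof.
move=> u0 f0 g0; rewrite !age_opE -big_split; apply: eq_bigr => K _ /=.
by rewrite ge0_muleDr.
Qed.

Lemma age_opZ u (c : R) f s : (0 <= u)%R -> (0 <= c)%R -> (forall s, 0 <= f s) ->
  age_op C I u (fun s => c%:E * f s) s = c%:E * age_op C I u f s.
Proof.
move=> u0 c0 f0; rewrite !age_opE ge0_sume_distrr//.
  by apply: eq_bigr => K _; rewrite muleCA.
move=> K _; rewrite mule_ge0// lee_fin stay_weight_ge0//.
Qed.

Lemma age_op_fin u (f : st -> R) s :
  age_op C I u (fun s => (f s)%:E) s =
  (\sum_(K in powerset (present C s)) stay_weight s u K * f (aged s K u))%R%:E.
Proof. by rewrite age_opE -sumEFin. Qed.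

Lemma age_op_cst u (c : R) s : age_op C I u (fun=> c%:E) s = c%:E.
Proof. by rewrite age_op_fin -mulr_suml sum_stay_weight mul1r. Qed.

End age_operator.

(** * Evolution with a prescribed number of arrivals *)

Section evolution.
Context (R : realType) (C M : nat) (I : 'I_M -> customer_class R).
Variable pol : policy R M.
Hypothesis pol_adm : admissible I pol.
Notation st := (state R M).
Implicit Types (f g : st -> \bar R) (s : st) (t u : R).
Notation L := (total_rate I).
Local Open Scope ereal_scope.

Lemma entry_rate_itv s j :
  (0 <= pol s j * survival (cl_serv (I j)) 0 <= cl_rate (I j))%R.
Proof.
have /andP[p0 p1] := pol_adm.2 s j.
rewrite mulr_ge0 ?survival_ge0//=; apply: le_trans p1.
by rewrite ler_piMr// survival_le1.
Qed.

Lemma total_rate_ge0 : (0 <= L)%R.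
Proof. by apply: sumr_ge0 => j _; rewrite ltW// cl_rate_gt0. Qed.

Lemma arrival_op_ge0 f s : (forall s, 0 <= f s) -> 0 <= arrival_op C I pol f s.
Proof.
move=> f0; apply: sume_ge0 => j _; have /andP[a0 a1] := entry_rate_itv s j.
by case: ifP => _; rewrite ?adde_ge0// mule_ge0// lee_fin ?subr_ge0// ltW// cl_rate_gt0.
Qed.

Lemma le_arrival_op f g s : (forall s, f s <= g s) ->
  arrival_op C I pol f s <= arrival_op C I pol g s.
Proof.
move=> fg; apply: lee_sum => j _; have /andP[a0 a1] := entry_rate_itv s j.
case: ifP => _; last by rewrite lee_wpmul2l// lee_fin ltW// cl_rate_gt0.
by rewrite leeD// lee_wpmul2l// lee_fin ?subr_ge0.
Qed.

Lemma arrival_opD f g s : (forall s, 0 <= f s) -> (forall s, 0 <= g s) ->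
  arrival_op C I pol (fun s => f s + g s) s = arrival_op C I pol f s + arrival_op C I pol g s.
Proof.
move=> f0 g0; rewrite /arrival_op -big_split; apply: eq_bigr => j _ /=.
case: ifP => _; last by rewrite ge0_muleDr.
by rewrite !ge0_muleDr// addeACA.
Qed.

Lemma arrival_opZ (c : R) f s : (0 <= c)%R -> (forall s, 0 <= f s) ->
  arrival_op C I pol (fun s => c%:E * f s) s = c%:E * arrival_op C I pol f s.
Proof.
move=> c0 f0; have r0 j := ltW (cl_rate_gt0 (I j)).
have a0 j := (andP (entry_rate_itv s j)).
rewrite /arrival_op ge0_sume_distrr; last first.
  move=> j _; have [a00 a1] := a0 j.
  by case: ifP => _; rewrite ?adde_ge0// mule_ge0// lee_fin ?subr_ge0.
apply: eq_bigr => j _; have [a00 a1] := a0 j.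
case: ifP => _; last by rewrite muleCA.
by rewrite ge0_muleDr ?mule_ge0 ?lee_fin ?subr_ge0// !(muleCA c%:E).
Qed.

Lemma arrival_op_cst (c : R) s : arrival_op C I pol (fun=> c%:E) s = (L * c)%:E.
Proof.
rewrite /arrival_op /total_rate mulr_suml -sumEFin; apply: eq_bigr => j _.
by case: ifP => _; rewrite -?EFinM -?EFinD//; congr (_%:E); ring.
Qed.

Lemma measurable_arrival_op d (T : measurableType d) (sigma : T -> st)
    (f : T -> st -> \bar R) :
  measurable_fun [set: T] sigma ->
  measurable_fun [set: T * st] (fun z => f z.1 z.2) ->
  measurable_fun [set: T] (fun x => arrival_op C I pol (f x) (sigma x)).
Proof.
move=> ms mf; apply: emeasurable_sum => j.
have mfs (tau : T -> st) : measurable_fun [set: T] tau ->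
    measurable_fun [set: T] (fun x => f x (tau x)).
  move=> mtau; apply: (measurableT_comp (g := fun x => (x, tau x)) mf).
  exact: measurable_fun_pair.
have mpol := measurableT_comp (pol_adm.1 j) ms.
apply: measurable_fun_ifT.
- rewrite (_ : (fun x => _) = (fun n : nat => (n < C)%N) \o (fun s : st => in_service s) \o sigma)//.
  by apply: (measurableT_comp _ ms); apply: (measurableT_comp _ (@measurable_in_service _ _)).
- apply: emeasurable_funD; apply: emeasurable_funM.
  + apply/measurable_EFinP; exact: measurable_funM.
  + apply: mfs; apply: measurable_to_state => i; rewrite /add_customer.
      rewrite (_ : (fun x => _) = fun x => ((i == j) + size (sigma x i))%N).
        apply: measurable_addn => //.
        exact: (measurableT_comp (@measurable_size _ _ i) ms).
      by apply/funext => x; rewrite ffunE; case: eqP; rewrite ?size_rcons.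
    move=> k.
    rewrite (_ : (fun x => _) = fun x => nth 0%R (sigma x i) k); last first.
      apply/funext => x; rewrite ffunE; case: ifP => // _; rewrite nth_rcons.
      by case: ltngtP => // ks; rewrite nth_default// ?ks// ltnW.
    exact: (measurableT_comp (@measurable_age _ _ i k) ms).
  + apply/measurable_EFinP; apply: measurable_funB => //; exact: measurable_funM.
  + exact: mfs.
- by apply: emeasurable_funM => //; exact: mfs.
Qed.

(** [transition_n] with a test function in place of an indicator, so that linearity and monotonicity
    make sense. *)
Fixpoint evolve (n : nat) t f s : \bar R :=
  if n is n'.+1 then
    \int[lebesgue_measure]_(u in `[0%R, t])
       ((expR (- L * u))%:E *
        age_op C I u (arrival_op C I pol (evolve n' (t - u)%R f)) s)
  else (expR (- L * t))%:E * age_op C I t f s.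

Lemma transition_nE n t B s :
  transition_n C I pol n t B s = evolve n t (fun s => (\1_B s)%:E) s.
Proof.
elim: n t s => [//|n IH] t s /=; apply: eq_integral => u _; congr (_ * _).
by congr (age_op _ _ _ _ _); apply/funext => s'; congr (arrival_op _ _ _ _ _); apply/funext.
Qed.

Lemma evolve_ge0 n t f s : (0 <= t)%R -> (forall s, 0 <= f s) -> 0 <= evolve n t f s.
Proof.
elim: n t s => [|n IH] t s t0 f0 /=; first by rewrite mule_ge0 ?age_op_ge0 ?lee_fin ?expR_ge0.
apply: integral_ge0 => u /=; rewrite in_itv/= => /andP[u0 ut].
rewrite mule_ge0 ?age_op_ge0 ?lee_fin ?expR_ge0// => s'.
by apply: arrival_op_ge0 => s''; apply: IH => //; rewrite subr_ge0.
Qed.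

Lemma le_evolve n t f g s : (0 <= t)%R -> (forall s, 0 <= f s) -> (forall s, f s <= g s) ->
  evolve n t f s <= evolve n t g s.
Proof.
move=> + f0 fg; elim: n t s => [|n IH] t s t0 /=.
  by rewrite lee_wpmul2l ?lee_fin ?expR_ge0// le_age_op.
apply: le_integral_ge0 => u /=; rewrite in_itv/= => /andP[u0 ut].
  rewrite mule_ge0 ?age_op_ge0 ?lee_fin ?expR_ge0// => s'.
  by apply: arrival_op_ge0 => s''; apply: evolve_ge0 => //; rewrite subr_ge0.
rewrite lee_wpmul2l ?lee_fin ?expR_ge0// le_age_op// => s'.
by apply: le_arrival_op => s''; rewrite IH// subr_ge0.
Qed.

(* evolve is only used at nonnegative times; truncating the times at 0 makes
   the integrand nonnegative and jointly measurable on the whole product. *)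
Definition evolve_integrand n f (z : (R * st) * R) : \bar R :=
  (expR (- L * z.2))%:E * age_op C I (Num.max z.2 0)%R
    (arrival_op C I pol (evolve n (Num.max (Num.max z.1.1 0 - z.2) 0)%R f)) z.1.2.

Lemma evolveSE n t f s : (0 <= t)%R ->
  evolve n.+1 t f s =
  \int[lebesgue_measure]_u ((evolve_integrand n f ((t, s), u)) * (\1_`[0%R, t] u)%:E).
Proof.
move=> t0 /=; rewrite integral_mkcond; apply: eq_integral => u _.
rewrite patchE indicE; case: ifPn => [|_]; last by rewrite mule0.
rewrite inE/= in_itv/= => /andP[u0 ut]; rewrite mule1 /evolve_integrand/=.
by rewrite (max_l t0) (max_l u0) max_l// subr_ge0.
Qed.

Lemma evolve_integrand_ge0 n f z : (forall s, 0 <= f s) -> 0 <= evolve_integrand n f z.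
Proof.
move=> f0; rewrite mule_ge0 ?lee_fin ?expR_ge0// age_op_ge0 ?le_max ?lexx ?orbT// => s.
by apply: arrival_op_ge0 => s'; apply: evolve_ge0; rewrite ?le_max ?lexx ?orbT.
Qed.

Lemma measurable_evolve_integrand n f :
  measurable_fun [set: R * st] (fun z => evolve n (Num.max z.1 0)%R f z.2) ->
  measurable_fun [set: (R * st) * R] (evolve_integrand n f).
Proof.
move=> mn; apply: emeasurable_funM.
  apply/measurable_EFinP; apply: measurableT_comp => //; exact: measurable_funM.
apply: (@measurable_age_op _ C M I _ ((R * st) * R)%type (fun z => z.1.2)
  (fun z => Num.max z.2 0)%R (fun z => arrival_op C I pol
     (evolve n (Num.max (Num.max z.1.1 0 - z.2) 0)%R f))).
- exact: (measurableT_comp (@measurable_snd _ _ _ _) (@measurable_fst _ _ _ _)).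
- exact: measurable_maxr.
apply: (@measurable_arrival_op _ (((R * st) * R) * st)%type snd
  (fun z => evolve n (Num.max (Num.max z.1.1.1 0 - z.1.2) 0)%R f)) => //.
apply: (measurableT_comp (g := fun z : (((R * st) * R) * st) * st =>
  ((Num.max z.1.1.1.1 0 - z.1.1.2)%R, z.2)) mn).
apply: measurable_fun_pair => //.
have m1 : measurable_fun [set: (((R * st) * R) * st) * st] (fun z => z.1.1).
  exact: (measurableT_comp (@measurable_fst _ _ _ _) (@measurable_fst _ _ _ _)).
apply: measurable_funB; last exact: (measurableT_comp (@measurable_snd _ _ _ _) m1).
apply: measurable_maxr => //.
apply: (measurableT_comp (@measurable_fst _ _ _ _)).
exact: (measurableT_comp (@measurable_fst _ _ _ _) m1).
Qed.

Lemma measurable_indic_itv0 d (T : measurableType d) (a b : T -> R) :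
  measurable_fun [set: T] a -> measurable_fun [set: T] b ->
  measurable_fun [set: T] (fun z => (\1_`[0%R, a z] (b z))%:E : \bar R).
Proof.
move=> ma mb; apply/measurable_EFinP.
rewrite (_ : (fun z => _) = fun z => if (0 <= b z)%R && (b z <= a z)%R then 1%R else 0%R).
  apply: measurable_fun_ifT => //; apply: measurable_and; exact: measurable_fun_ler.
by apply/funext => z; rewrite indicE mem_setE in_itv/=; case: andb.
Qed.

Lemma measurable_evolve n f : nnm f ->
  measurable_fun [set: R * st] (fun z => evolve n (Num.max z.1 0)%R f z.2).
Proof.
move=> [mf f0]; elim: n => [|n IH] /=.
  apply: emeasurable_funM.
    apply/measurable_EFinP; apply: measurableT_comp => //; apply: measurable_funM => //.
    exact: measurable_maxr.
  apply: (@measurable_age_op _ C M I _ (R * st)%type snd (fun z => Num.max z.1 0)%R (fun=> f)) => //.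
    exact: measurable_maxr.
  exact: (measurableT_comp mf).
rewrite (_ : (fun z => _) = fun z => \int[lebesgue_measure]_u
  (evolve_integrand n f (z, u) * (\1_`[0%R, (Num.max z.1 0)%R] u)%:E)); last first.
  apply/funext => -[t s] /=; have t0 : (0 <= Num.max t 0)%R by rewrite le_max lexx orbT.
  rewrite -/(evolve n.+1 (Num.max t 0)%R f s) evolveSE//; apply: eq_integral => u _.
  by congr (_ * _); rewrite /evolve_integrand/= (max_l t0).
pose G (z : (R * st) * R) :=
  evolve_integrand n f z * (\1_`[0%R, (Num.max z.1.1 0)%R] z.2)%:E.
have mG : measurable_fun [set: (R * st) * R] G.
  apply: emeasurable_funM; first exact: measurable_evolve_integrand.
  apply: measurable_indic_itv0 => //; apply: measurable_maxr => //.
  exact: (measurableT_comp (@measurable_fst _ _ _ _) (@measurable_fst _ _ _ _)).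
have G0 z : 0 <= G z by rewrite mule_ge0 ?lee_fin// evolve_integrand_ge0.
exact: (measurable_fun_fubini_tonelli_F (m2 := lebesgue_measure) G mG G0).
Qed.

Lemma nnm_evolve n t f : (0 <= t)%R -> nnm f -> nnm (evolve n t f).
Proof.
move=> t0 nf; split; last by move=> s; apply: evolve_ge0 => //; exact: nf.2.
rewrite -[t in evolve n t f](max_l t0).
apply: (measurableT_comp (g := fun s : st => (t, s)) (measurable_evolve n nf)).
exact: measurable_fun_pair.
Qed.

Lemma nnm_evolve_integrand n t f s : nnm f ->
  nnm (fun u => evolve_integrand n f ((t, s), u)).
Proof.
move=> nf; split; last by move=> u; apply: evolve_integrand_ge0; exact: nf.2.
apply: (measurableT_comp (g := fun u : R => ((t, s), u))
  (measurable_evolve_integrand (measurable_evolve n nf))).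
exact: measurable_fun_pair.
Qed.

Lemma evolveS_itv n t f s : (0 <= t)%R ->
  evolve n.+1 t f s = \int[lebesgue_measure]_(u in `[0%R, t]) evolve_integrand n f ((t, s), u).
Proof.
move=> t0; apply: eq_integral => u; rewrite inE/= in_itv/= => /andP[u0 ut].
by rewrite /evolve_integrand/= (max_l t0) (max_l u0) max_l// subr_ge0.
Qed.

Lemma evolveD n t f g s : (0 <= t)%R -> nnm f -> nnm g ->
  evolve n t (fun s => f s + g s) s = evolve n t f s + evolve n t g s.
Proof.
move=> + nf ng; elim: n t s => [|n IH] t s t0.
  by rewrite /= age_opD//; [rewrite ge0_muleDr// age_op_ge0//; [exact: nf.2|exact: ng.2]|exact: nf.2|exact: ng.2].
have nfi := nnm_evolve_integrand n t s nf; have ngi := nnm_evolve_integrand n t s ng.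
rewrite !evolveS_itv// -ge0_integralD//; last 4 first.
- by move=> u _; exact: nfi.2.
- exact: measurable_funTS nfi.1.
- by move=> u _; exact: ngi.2.
- exact: measurable_funTS ngi.1.
apply: eq_integral => u _.
have max0 (x : R) : (0 <= Num.max x 0)%R by rewrite le_max lexx orbT.
have nf' v := (nnm_evolve n (max0 v) nf).2; have ng' v := (nnm_evolve n (max0 v) ng).2.
rewrite /evolve_integrand/= -ge0_muleDr ?age_op_ge0//; last 2 first.
- by move=> s'; exact: arrival_op_ge0.
- by move=> s'; exact: arrival_op_ge0.
congr (_ * _); rewrite -age_opD//; last 2 first.
- by move=> s'; exact: arrival_op_ge0.
- by move=> s'; exact: arrival_op_ge0.
congr age_op; apply/funext => s'; rewrite -arrival_opD//.
by congr arrival_op; apply/funext => s''; exact: IH.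
Qed.

Lemma evolveZ n t (c : R) f s : (0 <= t)%R -> (0 <= c)%R -> nnm f ->
  evolve n t (fun s => c%:E * f s) s = c%:E * evolve n t f s.
Proof.
move=> + c0 nf; elim: n t s => [|n IH] t s t0.
  by rewrite /= age_opZ//; [rewrite muleCA|exact: nf.2].
have nfi := nnm_evolve_integrand n t s nf.
rewrite !evolveS_itv// -ge0_integralZl//; last 2 first.
- exact: measurable_funTS nfi.1.
- by move=> u _; exact: nfi.2.
apply: eq_integral => u _.
have max0 (x : R) : (0 <= Num.max x 0)%R by rewrite le_max lexx orbT.
have nf' v := (nnm_evolve n (max0 v) nf).2.
rewrite /evolve_integrand/= [RHS]muleCA; congr (_ * _).
rewrite -age_opZ//; last by move=> s'; exact: arrival_op_ge0.
congr age_op; apply/funext => s'; rewrite -arrival_opZ//.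
by congr arrival_op; apply/funext => s''; exact: IH.
Qed.

Lemma evolve0_cst t (c : R) s : evolve 0 t (fun=> c%:E) s = (expR (- L * t) * c)%:E.
Proof. by rewrite /= age_op_cst EFinM. Qed.

End evolution.

Lemma integral_mul_indic d (T : measurableType d) (R : realType)
    (mu : {measure set T -> \bar R}) (D : set T) (f : T -> \bar R) :
  (\int[mu]_(x in D) f x = \int[mu]_x (f x * (\1_D x)%:E))%E.
Proof.
rewrite integral_mkcond; apply: eq_integral => x _.
by rewrite patchE indicE; case: (x \in D); rewrite ?mule1 ?mule0.
Qed.

Lemma integral_probability_cst d (T : measurableType d) (R : realType)
    (P : probability T R) (c : \bar R) : (\int[P]__ c = c)%E.
Proof.
rewrite -[RHS]mule1 -(@probability_setT _ _ _ P).
exact: (integral_cst P measurableT c).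
Qed.

(** * Stationary laws tested on bounded functions *)

Section stationary_integral.
Context (R : realType) (C M : nat) (I : 'I_M -> customer_class R).
Variable pol : policy R M.
Hypothesis pol_adm : admissible I pol.
Notation st := (state R M).
Implicit Types (f g : st -> \bar R) (s : st) (t u : R).
Notation L := (total_rate I).
Notation evolve := (evolve C I pol).
Local Open Scope ereal_scope.

Definition semigroup t f s : \bar R := \sum_(0 <= n <oo) evolve n t f s.

Lemma transitionE t B s : transition C I pol t B s = semigroup t (fun s => (\1_B s)%:E) s.
Proof. by apply: eq_eseriesr => n _; rewrite transition_nE. Qed.

Lemma nnm_series d (T : measurableType d) (F : nat -> T -> \bar R) :
  (forall n, nnm (F n)) -> nnm (fun x => \sum_(0 <= n <oo) F n x).
Proof.
move=> nF; split; last by move=> x; apply: nneseries_ge0 => n _ _; exact: (nF n).2.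
by apply: ge0_emeasurable_sum => [n x _ _|n _]; [exact: (nF n).2|exact: (nF n).1].
Qed.

Lemma nnm_semigroup t f : (0 <= t)%R -> nnm f -> nnm (semigroup t f).
Proof. by move=> t0 nf; apply: nnm_series => n; exact: nnm_evolve. Qed.

Lemma semigroupD t f g s : (0 <= t)%R -> nnm f -> nnm g ->
  semigroup t (fun s => f s + g s) s = semigroup t f s + semigroup t g s.
Proof.
move=> t0 nf ng; rewrite /semigroup -nneseriesD; last 2 first.
- by move=> n _ _; exact: (nnm_evolve C pol_adm n t0 nf).2.
- by move=> n _ _; exact: (nnm_evolve C pol_adm n t0 ng).2.
by apply: eq_eseriesr => n _; rewrite evolveD.
Qed.

Lemma semigroupZ t (c : R) f s : (0 <= t)%R -> (0 <= c)%R -> nnm f ->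
  semigroup t (fun s => c%:E * f s) s = c%:E * semigroup t f s.
Proof.
move=> t0 c0 nf; rewrite /semigroup -nneseriesZl; last first.
  by move=> n _; exact: (nnm_evolve C pol_adm n t0 nf).2.
by apply: eq_eseriesr => n _; rewrite evolveZ.
Qed.

Lemma le_semigroup t f g s : (0 <= t)%R -> (forall s, 0 <= f s) -> (forall s, f s <= g s) ->
  semigroup t f s <= semigroup t g s.
Proof.
move=> t0 f0 fg; apply: lee_nneseries => n _; last exact: le_evolve.
by move=> _; exact: evolve_ge0.
Qed.

(** Stationarity is given on sets only; linearity and monotonicity of the semigroup extend it to
    bounded functions through [functional_integral]. *)
Lemma stationary_integral (Pi : probability st R) t f (c : R) :
  stationary C I pol Pi -> (0 <= t)%R -> nnm f -> (forall s, f s <= c%:E) ->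
  \int[Pi]_s semigroup t f s = \int[Pi]_s f s.
Proof.
move=> [_ PiS] t0 nf fc.
pose Phi f := \int[Pi]_s semigroup t f s.
apply: (@functional_integral _ _ _ Pi Phi f c) => //.
- exact: probability_setT.
- move=> {nf fc}f g nf ng; rewrite /Phi -ge0_integralD//; last 4 first.
  + by move=> s _; exact: (nnm_semigroup t0 nf).2.
  + exact: (nnm_semigroup t0 nf).1.
  + by move=> s _; exact: (nnm_semigroup t0 ng).2.
  + exact: (nnm_semigroup t0 ng).1.
  by apply: eq_integral => s _; rewrite semigroupD.
- move=> a {nf fc}f a0 nf; rewrite /Phi -ge0_integralZl//; last 2 first.
  + exact: (nnm_semigroup t0 nf).1.
  + by move=> s _; exact: (nnm_semigroup t0 nf).2.
  by apply: eq_integral => s _; rewrite semigroupZ.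
- move=> {nf fc}f g nf ng fg; apply: le_integral_ge0 => s _.
    exact: (nnm_semigroup t0 nf).2.
  by apply: le_semigroup => //; exact: nf.2.
- move=> A mA; apply: (etrans _ (PiS t A t0 mA)); apply: eq_integral => s _.
  by rewrite transitionE.
Qed.

(* Total mass 1 leaves at most 1 - exp(- L u) for the histories with an arrival. *)
Lemma stationary_age_op (Pi : probability st R) u f (c : R) :
  stationary C I pol Pi -> (0 <= u)%R -> (0 <= c)%R -> nnm f -> (forall s, f s <= c%:E) ->
  \int[Pi]_s f s <= \int[Pi]_s age_op C I u f s + (L * u * c)%:E.
Proof.
move=> PiS u0 c0 nf fc.
pose tail f s : \bar R := \sum_(1 <= n <oo) evolve n u f s.
have e0 : (0 <= expR (- L * u))%R by exact: expR_ge0.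
have split g s : nnm g -> semigroup u g s = evolve 0 u g s + tail g s.
  move=> ng; rewrite /semigroup (nneseries_split 0 1)//; last first.
    by move=> n _; exact: (nnm_evolve C pol_adm n u0 ng).2.
  by rewrite add0n big_nat1.
have nnm_tail g : nnm g -> nnm (tail g).
  move=> ng; rewrite (_ : tail g = fun s => \sum_(0 <= n <oo) evolve n.+1 u g s).
    by apply: nnm_series => n; exact: nnm_evolve.
  apply/funext => s; rewrite /tail -nneseries_addn; last first.
    by move=> n; exact: (nnm_evolve C pol_adm n u0 ng).2.
  by apply: eq_eseriesr => n _; rewrite addn1.
have int_split g : nnm g -> (exists c : R, forall s, g s <= c%:E) ->
    \int[Pi]_s g s = \int[Pi]_s evolve 0 u g s + \int[Pi]_s tail g s.
  move=> ng [b gb]; rewrite -(stationary_integral PiS u0 ng gb).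
  rewrite -ge0_integralD//; last 4 first.
  - by move=> s _; exact: (nnm_evolve C pol_adm 0 u0 ng).2.
  - exact: (nnm_evolve C pol_adm 0 u0 ng).1.
  - by move=> s _; exact: (nnm_tail _ ng).2.
  - exact: (nnm_tail _ ng).1.
  by apply: eq_integral => s _; exact: split.
have n1 : nnm (fun _ : st => 1 : \bar R) by exact: nnm_cst.
have : \int[Pi]_s tail (fun=> 1) s <= (L * u)%:E.
  have /(int_split _ n1) : exists c : R, forall s : st, 1 <= c%:E by exists 1%R.
  rewrite integral_probability_cst.
  rewrite (eq_integral (fun=> (expR (- L * u))%:E)); last first.
    by move=> s _; rewrite /= age_op_cst mule1.
  rewrite integral_probability_cst => h.
  have : 0 <= \int[Pi]_s tail (fun=> 1) s by apply: integral_ge0 => s _; exact: (nnm_tail _ n1).2.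
  move: h; case: (\int[Pi]_s tail (fun=> 1) s) => [r|//|//]; rewrite -EFinD => -[h] _.
  rewrite lee_fin; have := expR_ge1Dx (- L * u); lra.
move=> tail1.
rewrite (int_split f nf (ex_intro _ c fc)); apply: leeD.
  apply: le_integral_ge0 => s _ ; first exact: (nnm_evolve C pol_adm 0 u0 nf).2.
  rewrite /= gee_pMl ?age_op_ge0//; [exact: nf.2|].
  rewrite lee_fin expR_le1 mulNr oppr_le0 mulr_ge0//; exact: total_rate_ge0.
rewrite (@le_trans _ _ (\int[Pi]_s (c%:E * tail (fun=> 1) s)))//.
  apply: le_integral_ge0 => s _; first exact: (nnm_tail _ nf).2.
  rewrite /tail -nneseriesZl; last by move=> n _; exact: (nnm_evolve C pol_adm n u0 n1).2.
  apply: lee_nneseries => n _; first by move=> _; exact: (nnm_evolve C pol_adm n u0 nf).2.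
  rewrite -evolveZ//; apply: le_evolve => //; first exact: nf.2.
  by move=> s'; rewrite mule1.
rewrite ge0_integralZl//; last 2 first.
- exact: (nnm_tail _ n1).1.
- by move=> s _; exact: (nnm_tail _ n1).2.
by rewrite (mulrC _ c) EFinM lee_wpmul2l// lee_fin.
Qed.

End stationary_integral.

(** * Residual work of the customers in service *)

Section residual_work.
Context (R : realType) (C M : nat) (I : 'I_M -> customer_class R).
Notation st := (state R M).
Implicit Types (s : st) (t u e : R).
Notation L := (total_rate I).

(* e * sum_(i < n) P(S > a + i e | S > a), an upper Riemann sum for the mean
   residual service time at age a, truncated at n e. *)
Definition residual_work e n (G : probability R R) a : R :=
  e * \sum_(i < n) residual G a (i%:R * e).

(** The truncation [take C] matches [present], which sees only the first [C] positions of each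
    list. *)
Definition total_work e n s : R :=
  \sum_(j < M) \sum_(a <- take C (s j)) residual_work e n (cl_serv (I j)) a.

Lemma residual_work_ge0 e n G a : 0 <= e -> 0 <= residual_work e n G a.
Proof. by move=> e0; rewrite mulr_ge0// sumr_ge0// => i _; exact: residual_ge0. Qed.

Lemma residual_work_le e n G a : 0 <= e -> residual_work e n G a <= e * n%:R.
Proof.
move=> e0; rewrite ler_wpM2l// -[leRHS]mulr1 mulr_natl -[n in leRHS]card_ord -sumr_const.
by apply: ler_sum => i _; apply: residual_le1; rewrite mulr_ge0.
Qed.

(** Conditional survival is multiplicative at [w = u + v] and decreases in [w]; if age [a + u]
    cannot be reached, both sides vanish. *)
Lemma residual_mul (G : probability R R) a u v w : 0 <= v -> u + v <= w ->
  residual G a w <= residual G a u * residual G (a + u) v.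
Proof.
move=> v0 uvw; rewrite /residual.
have [S0|S0] := eqVneq (survival G (a + u)) 0; last first.
  rewrite mulrCA mulrAC divff// mul1r ler_wpM2r ?invr_ge0 ?survival_ge0//.
  by apply: survival_nonincreasing; rewrite -addrA lerD2l.
rewrite S0 mul0r mul0r (_ : survival G (a + w) = 0) ?mul0r//; apply/eqP.
rewrite eq_le survival_ge0 andbT -S0; apply: survival_nonincreasing.
by rewrite lerD2l; apply: le_trans uvw; rewrite lerDl.
Qed.

(** Shift the Riemann sum by one index. The first term costs at most [e]; since [u <= e], the term
    at [(i + 1) e] is at most the one at [i e] seen from age [a + u], weighted by the probability of
    reaching that age. *)
Lemma residual_work_step e n G a u : 0 <= u <= e ->
  residual_work e n G a <= residual G a u * residual_work e n G (a + u) + e.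
Proof.
move=> /andP[u0 ue]; have e0 := le_trans u0 ue.
rewrite /residual_work mulrCA -[X in _ + X]mulr1 -mulrDr ler_wpM2l//.
case: n => [|n]; first by rewrite !big_ord0 mulr0 add0r.
rewrite big_ord_recl addrC lerD//; last by rewrite mul0r residual_le1.
rewrite big_ord_recr/= mulrDr -[leLHS]addr0 lerD//; last first.
  by rewrite mulr_ge0// residual_ge0.
rewrite mulr_sumr ler_sum// => i _; apply: residual_mul; first by rewrite mulr_ge0.
by rewrite /bump/= add1n -natr1 mulrDl mul1r addrC lerD2l.
Qed.

(** An accepted customer enters with probability [survival G 0], a zero service time leaving no
    trace. Multiplying by it undoes the conditioning on a positive service time. *)
Lemma residual_work0 e n (G : probability R R) : 0 <= e ->
  survival G 0 * residual_work e n G 0 = e * \sum_(i < n) survival G (i%:R * e).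
Proof.
move=> e0; rewrite /residual_work mulrCA mulr_sumr; congr (_ * _); apply: eq_bigr => i _.
rewrite /residual add0r mulrCA.
have [S0|S0] := eqVneq (survival G 0) 0; last by rewrite divff// mulr1.
rewrite S0 mul0r mulr0; apply/esym/eqP; rewrite eq_le survival_ge0 andbT -S0.
by apply: survival_nonincreasing; rewrite mulr_ge0.
Qed.

Lemma sum_take (h : R -> R) (l : seq R) :
  \sum_(a <- take C l) h a = \sum_(k < C | (k < size l)%N) h (nth 0 l k).
Proof.
have szC : (size (take C l) <= C)%N by rewrite size_take_min geq_minl.
rewrite (big_nth 0) big_mkord (big_ord_widen_cond _ xpredT (fun i => h (nth 0 (take C l) i)) szC).
apply: eq_big => [k|k _]; last by rewrite nth_take.
by rewrite /= size_take_min leq_min ltn_ord.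
Qed.

Lemma total_workE e n s : total_work e n s =
  \sum_(k in present C s) residual_work e n (cl_serv (I k.1)) (nth 0 (s k.1) k.2).
Proof.
rewrite /total_work (eq_bigr _ (fun j _ => sum_take _ _)) pair_big_dep/=.
by apply: eq_bigl => k; rewrite inE.
Qed.

Lemma size_aged s (K : {set 'I_M * 'I_C}) u j : (size (aged s K u j) <= C)%N.
Proof.
rewrite /aged ffunE size_map size_filter (leq_trans (count_size _ _))//.
by rewrite size_enum_ord.
Qed.

Lemma total_work_aged e n s (K : {set 'I_M * 'I_C}) u : total_work e n (aged s K u) =
  \sum_(k in K) residual_work e n (cl_serv (I k.1)) (nth 0 (s k.1) k.2 + u).
Proof.
rewrite /total_work.
rewrite (eq_bigr (fun j => \sum_(k < C | (j, k) \in K)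
    residual_work e n (cl_serv (I j)) (nth 0 (s j) k + u))); last first.
  move=> j _; rewrite take_oversize ?size_aged// /aged ffunE big_map big_filter.
  by rewrite big_enum_cond.
by rewrite pair_big_dep; apply: eq_bigl => -[j k].
Qed.

(** Work is additive over customers, so only the marginal staying probabilities enter. *)
Lemma age_op_total_work e n s u :
  age_op C I u (fun s => (total_work e n s)%:E) s =
  (\sum_(k in present C s) stay_prob I s k u *
     residual_work e n (cl_serv (I k.1)) (nth 0 (s k.1) k.2 + u))%:E.
Proof.
rewrite age_op_fin; congr (_%:E).
pose w (k : 'I_M * 'I_C) := residual_work e n (cl_serv (I k.1)) (nth 0 (s k.1) k.2 + u).
rewrite (eq_bigr (fun K : {set 'I_M * 'I_C} => \sum_(k in present C s)
    stay_weight I s u K * (k \in K)%:R * w k)); last first.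
  move=> K; rewrite powersetE => /fintype.subsetP KP.
  rewrite total_work_aged mulr_sumr big_mkcond [RHS]big_mkcond; apply: eq_bigr => k _ /=.
  case: (boolP (k \in K)) => [/KP ->|_]; first by rewrite mulr1.
  by rewrite mulr0 mul0r if_same.
rewrite exchange_big; apply: eq_bigr => k kP.
by rewrite -mulr_suml sum_stay_weight_in.
Qed.

Lemma le_age_op_total_work e n s u : 0 <= u <= e ->
  ((total_work e n s)%:E <=
   age_op C I u (fun s => (total_work e n s)%:E) s + (e * #|present C s|%:R)%:E)%E.
Proof.
move=> ue; rewrite age_op_total_work -EFinD lee_fin total_workE.
rewrite mulr_natr -sumr_const -big_split/=; apply: ler_sum => k _.
exact: residual_work_step.
Qed.

Lemma total_work_ge0 e n s : 0 <= e -> 0 <= total_work e n s.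
Proof. by move=> e0; rewrite total_workE sumr_ge0// => k _; exact: residual_work_ge0. Qed.

Lemma card_present s : (#|present C s| <= M * C)%N.
Proof. by rewrite (leq_trans (max_card _))// card_prod !card_ord. Qed.

Lemma total_work_le e n s : 0 <= e -> total_work e n s <= (M * C)%:R * (e * n%:R).
Proof.
move=> e0; rewrite total_workE.
apply: (@le_trans _ _ (\sum_(k in present C s) e * n%:R)).
  by apply: ler_sum => k _; exact: residual_work_le.
rewrite sumr_const -[leLHS]mulr_natl ler_wpM2r ?mulr_ge0// ler_nat.
exact: card_present.
Qed.

Lemma total_work_add e n s j : (in_service s < C)%N ->
  total_work e n (add_customer j s) = total_work e n s + residual_work e n (cl_serv (I j)) 0.
Proof.
move=> sC; have szj : (size (s j) < C)%N.
  by apply: leq_ltn_trans sC; rewrite /in_service (bigD1 j)//= leq_addr.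
rewrite /total_work (bigD1 j)//= [in RHS](bigD1 j)//= addrAC; congr (_ + _).
  rewrite ffunE eqxx !take_oversize ?size_rcons//; last exact: ltnW.
  by rewrite -cats1 big_cat/= big_seq1.
by apply: eq_bigr => i ij; rewrite ffunE (negbTE ij).
Qed.

(** The rate at which arrivals bring work; the factor after [pol s j] is the upper Riemann sum for
    the mean service time, truncated at [n e]. *)
Definition entry_work (pol : policy R M) e n s : R :=
  if (in_service s < C)%N then
    \sum_(j < M) pol s j * (e * \sum_(i < n) survival (cl_serv (I j)) (i%:R * e))
  else 0.

Lemma arrival_op_total_work (pol : policy R M) e n s : 0 <= e ->
  arrival_op C I pol (fun s => (total_work e n s)%:E) s =
  (L * total_work e n s + entry_work pol e n s)%:E.
Proof.
move=> e0; rewrite /arrival_op /entry_work /total_rate mulr_suml.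
case: (boolP (in_service s < C)%N) => sC; last first.
  by rewrite addr0 -[RHS]sumEFin; apply: eq_bigr => j _; rewrite EFinM.
rewrite -big_split -[RHS]sumEFin; apply: eq_bigr => j _ /=.
rewrite total_work_add// -residual_work0// -!EFinM -EFinD; congr (_%:E); ring.
Qed.

Lemma entry_work_ge0 (pol : policy R M) e n s : admissible I pol -> 0 <= e ->
  0 <= entry_work pol e n s.
Proof.
move=> adm e0; rewrite /entry_work; case: ifP => // _; apply: sumr_ge0 => j _.
have /andP[p0 _] := adm.2 s j.
by rewrite !mulr_ge0// sumr_ge0// => i _; exact: survival_ge0.
Qed.

Lemma entry_work_le (pol : policy R M) e n s : admissible I pol -> 0 <= e ->
  entry_work pol e n s <= L * (e * n%:R).
Proof.
move=> adm e0; have L0 := total_rate_ge0 I.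
rewrite /entry_work; case: ifP => // _; last by rewrite !mulr_ge0.
rewrite /total_rate mulr_suml; apply: ler_sum => j _.
have /andP[p0 p1] := adm.2 s j; apply: ler_pM => //.
  by rewrite mulr_ge0// sumr_ge0// => i _; exact: survival_ge0.
rewrite ler_wpM2l// -[leRHS]mulr1 mulr_natl -[n in leRHS]card_ord -sumr_const.
by apply: ler_sum => i _; exact: survival_le1.
Qed.

Lemma measurable_card_present :
  measurable_fun [set: st] (fun s : st => (#|present C s|)%:R : R).
Proof.
rewrite (_ : (fun s => _) = fun s : st => \sum_(k : 'I_M * 'I_C) (k \in present C s)%:R).
  apply: measurable_sum => k.
  rewrite (_ : (fun s => _) = fun s : st => if k \in present C s then 1 else 0 : R).
    by apply: measurable_fun_ifT => //; exact: measurable_present.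
  by apply/funext => s; case: (k \in _).
apply/funext => s; rewrite -sum1_card natr_sum big_mkcond/=.
by apply: eq_bigr => k _; case: (k \in _).
Qed.

Lemma measurable_total_work e n : measurable_fun [set: st] (total_work e n).
Proof.
rewrite (_ : total_work e n = fun s : st => \sum_(k : 'I_M * 'I_C)
  if k \in present C s then residual_work e n (cl_serv (I k.1)) (nth 0 (s k.1) k.2) else 0).
  apply: measurable_sum => k; apply: measurable_fun_ifT => //.
    exact: measurable_present.
  apply: measurable_funM => //; apply: measurable_sum => i.
  apply: measurable_residual => //; exact: measurable_age.
by apply/funext => s; rewrite total_workE big_mkcond.
Qed.

Lemma measurable_nonfull : measurable_fun [set: st] (fun s : st => (in_service s < C)%N).
Proof. exact: (measurableT_comp (f := fun n : nat => (n < C)%N) _ (@measurable_in_service R M)). Qed.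

Lemma measurable_entry_work (pol : policy R M) e n : admissible I pol ->
  measurable_fun [set: st] (entry_work pol e n).
Proof.
move=> adm; apply: measurable_fun_ifT => //; first exact: measurable_nonfull.
by apply: measurable_sum => j; apply: measurable_funM => //; exact: adm.1.
Qed.

End residual_work.

(** * The work balance over one short time step *)

Section little_step.
Context (R : realType) (C M : nat) (I : 'I_M -> customer_class R).
Variables (pol : policy R M) (Pi : probability (state R M) R).
Hypothesis pol_adm : admissible I pol.
Hypothesis PiS : stationary C I pol Pi.
Notation st := (state R M).
Implicit Types (s : st) (t u : R).
Notation L := (total_rate I).
Variables (e : R) (n : nat).
Hypothesis e_gt0 : 0 < e.
Local Open Scope ereal_scope.

Let e_ge0 : (0 <= e)%R := ltW e_gt0.
Let L0 : (0 <= L)%R := total_rate_ge0 I.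
Let f s := (total_work C I e n s)%:E.
Let psi s := (entry_work C I pol e n s)%:E.
Let K : R := (M * C)%:R.
Let E0 : R := expR (- L * e).

Let nnm_f : nnm f.
Proof.
split; last by move=> s; rewrite lee_fin total_work_ge0.
by apply/measurable_EFinP; exact: measurable_total_work.
Qed.

Let nnm_psi : nnm psi.
Proof.
split; last by move=> s; rewrite lee_fin entry_work_ge0.
by apply/measurable_EFinP; exact: measurable_entry_work.
Qed.

Let nnm_card : nnm (fun s : st => (#|present C s|%:R)%:E : \bar R).
Proof. by split => //; apply/measurable_EFinP; exact: measurable_card_present. Qed.

Let le_f_age u s : (0 <= u <= e)%R -> f s <= age_op C I u f s + (e * K)%:E.
Proof.
move=> ue; apply: (le_trans (le_age_op_total_work C I n s ue)).
by rewrite leeD2l// lee_fin ler_wpM2l// ler_nat card_present.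
Qed.

(** Histories with one arrival after time [u], followed by a time [v]: the jump adds [psi], and each
    of the two ageing stages loses at most [e] per customer present, hence at most [e K]. *)
Lemma le_age_arrival_age u v s : (0 <= u <= e)%R -> (0 <= v <= e)%R ->
  L%:E * f s + age_op C I u psi s <=
  age_op C I u (arrival_op C I pol (age_op C I v f)) s + (L * (e * K) + L * (e * K))%:E.
Proof.
move=> ue ve; have [u0 _] := andP ue; have [v0 _] := andP ve.
have K0 : (0 <= e * K)%R by rewrite mulr_ge0.
have f0 := nnm_f.2; have psi0 := nnm_psi.2.
have av0 s' : 0 <= age_op C I v f s' by exact: age_op_ge0.
have jump s' : L%:E * f s' + psi s' <= arrival_op C I pol (age_op C I v f) s' + (L * (e * K))%:E.
  rewrite -EFinM -EFinD -(arrival_op_total_work _ _ _ _ _ e_ge0) -(arrival_op_cst C I pol _ s').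
  rewrite -arrival_opD//; apply: le_arrival_op => // s''.
  exact: le_f_age.
rewrite EFinD addeA; apply: (@le_trans _ _ (L%:E * age_op C I u f s + age_op C I u psi s + (L * (e * K))%:E)).
  rewrite [X in _ <= X]addeAC leeD2r// EFinM -ge0_muleDr//; last exact: age_op_ge0.
  by rewrite lee_wpmul2l// le_f_age.
rewrite leeD2r// -age_opZ// -age_opD//; last first.
  by move=> s'; rewrite mule_ge0.
rewrite -[X in _ + X](age_op_cst C I u _ s) -age_opD//; last 2 first.
- by move=> s'; exact: arrival_op_ge0.
- by move=> s'; rewrite lee_fin mulr_ge0.
exact: le_age_op.
Qed.

Let apsi (z : st * R) := age_op C I (Num.max z.2 0)%R psi z.1.

Let apsi_ge0 z : 0 <= apsi z.
Proof. by apply: age_op_ge0; [rewrite le_max lexx orbT|exact: nnm_psi.2]. Qed.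

Let measurable_apsi : measurable_fun [set: st * R] apsi.
Proof.
apply: (@measurable_age_op _ C M I _ (st * R)%type fst (fun z => Num.max z.2 0)%R (fun=> psi)) => //.
  exact: measurable_maxr.
exact: (measurableT_comp nnm_psi.1).
Qed.

Lemma le_evolve1 s :
  (E0 * (e * L))%:E * f s + E0%:E * \int[lebesgue_measure]_(u in `[0%R, e]) apsi (s, u)
  <= evolve C I pol 1 e f s + (E0 * (e * (L * (e * K) + L * (e * K))))%:E.
Proof.
have E00 : (0 <= E0)%R := expR_ge0 _.
have K0 : (0 <= L * (e * K) + L * (e * K))%R by rewrite addr_ge0// !mulr_ge0.
have leb : lebesgue_measure `[0%R, e] = e%:E :> \bar R.
  by rewrite lebesgue_measure_itv/= lte_fin e_gt0 sube0.
have mapsi : measurable_fun [set: R] (fun u => apsi (s, u)).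
  by apply: (measurableT_comp measurable_apsi); exact: measurable_fun_pair.
have nev := nnm_evolve_integrand C pol_adm 0 e s nnm_f.
have int_cst (c : R) : \int[lebesgue_measure]_(u in `[0%R, e]) c%:E = (e * c)%:E.
  by rewrite (mulrC e) EFinM -leb; exact: (integral_cst lebesgue_measure).
have ifs : (e * L)%:E * f s = \int[lebesgue_measure]_(u in `[0%R, e]) (L%:E * f s).
  by rewrite -[in RHS]EFinM int_cst -EFinM mulrA.
rewrite EFinM -muleA ifs -ge0_muleDr; last 2 first.
- by apply: integral_ge0 => u _; rewrite mule_ge0 ?lee_fin// total_work_ge0.
- by apply: integral_ge0 => u _; exact: apsi_ge0.
rewrite -ge0_integralD//; last 2 first.
- by move=> u _; rewrite mule_ge0 ?lee_fin// total_work_ge0.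
- exact: measurable_funTS.
rewrite -ge0_integralZl//; last 2 first.
- apply: emeasurable_funD => //; exact: measurable_funTS.
- by move=> u _; rewrite adde_ge0 ?apsi_ge0// mule_ge0 ?lee_fin// total_work_ge0.
rewrite mulrCA -int_cst evolveS_itv// -ge0_integralD//; last 3 first.
- by move=> u _; exact: nev.2.
- exact: measurable_funTS nev.1.
- by move=> u _; rewrite lee_fin mulr_ge0.
apply: le_integral_ge0 => u /=.
  by move=> _; rewrite mule_ge0 ?lee_fin// adde_ge0 ?apsi_ge0// mule_ge0 ?lee_fin// total_work_ge0.
rewrite in_itv/= => /andP[u0 ue].
have v0 : (0 <= e - u)%R by rewrite subr_ge0.
have ve : (e - u <= e)%R by rewrite lerBlDr lerDl.
have f0 := nnm_f.2.
rewrite /evolve_integrand/apsi/= (max_l u0) (max_l e_ge0) (max_l v0).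
(* The waiting factors for [u] and [e - u] multiply to [E0], whatever [u] is. *)
rewrite [X in _ <= X + _](_ : _ = E0%:E * age_op C I u (arrival_op C I pol (age_op C I (e - u) f)) s); last first.
  rewrite (_ : arrival_op _ _ _ _ = fun s' => (expR (- L * (e - u)))%:E * arrival_op C I pol (age_op C I (e - u) f) s'); last first.
    by apply/funext => s'; rewrite arrival_opZ ?expR_ge0// => s''; exact: age_op_ge0.
  rewrite age_opZ ?expR_ge0//; last by move=> s'; apply: arrival_op_ge0 => // s''; exact: age_op_ge0.
  rewrite muleA -EFinM -expRD; congr ((expR _)%:E * _); ring.
rewrite EFinM -ge0_muleDr ?lee_fin//; last first.
  by apply: age_op_ge0 => // s'; apply: arrival_op_ge0 => // s''; exact: age_op_ge0.
rewrite lee_wpmul2l ?lee_fin//; apply: le_age_arrival_age; first by rewrite u0.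
by rewrite v0.
Qed.


Lemma fubini_apsi : \int[Pi]_s \int[lebesgue_measure]_(u in `[0%R, e]) apsi (s, u) =
  \int[lebesgue_measure]_(u in `[0%R, e]) \int[Pi]_s apsi (s, u).
Proof.
rewrite [RHS]integral_mul_indic.
transitivity (\int[Pi]_s \int[lebesgue_measure]_u (apsi (s, u) * (\1_`[0%R, e] u)%:E)).
  by apply: eq_integral => s _; rewrite integral_mul_indic.
have mind : measurable_fun [set: st * R] (fun z => (\1_`[0%R, e] z.2)%:E : \bar R).
  exact: measurable_indic_itv0.
pose G (z : st * R) := apsi z * (\1_`[0%R, e] z.2)%:E.
have mG : measurable_fun [set: st * R] G by exact: emeasurable_funM.
have G0 z : 0 <= G z by rewrite mule_ge0 ?apsi_ge0.
apply: (etrans (fubini_tonelli (m1 := Pi) (m2 := lebesgue_measure) G mG G0)).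
apply: eq_integral => u _; rewrite muleC -ge0_integralZl//.
  by apply: eq_integral => s _; rewrite muleC.
by apply: (measurableT_comp (g := fun s : st => (s, u)) measurable_apsi); exact: measurable_fun_pair.
Qed.

Let B : R := (L * (e * n%:R))%R.
Let fin_int (g : st -> \bar R) (c : R) : nnm g -> (forall s, g s <= c%:E) ->
  exists2 r : R, \int[Pi]_s g s = r%:E & (0 <= r <= c)%R.
Proof.
move=> ng gc; have : \int[Pi]_s g s <= c%:E.
  rewrite -[leRHS](integral_probability_cst Pi); apply: le_integral_ge0 => s _ //.
  exact: ng.2.
have : 0 <= \int[Pi]_s g s by apply: integral_ge0 => s _; exact: ng.2.
case: (\int[Pi]_s g s) => [r|//|//]; rewrite !lee_fin => r0 rc.
by exists r => //; rewrite r0.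
Qed.

(** Integrate the work over a step of length [e]. Without arrival it drops by at most [e] per
    customer present, histories with one arrival gain about [e psi], and those with more are dropped
    because work is nonnegative. Stationarity keeps the mean work at [F]; after cancelling it and
    dividing by [e], the entering work is at most the mean number in service up to a multiple of
    [e]. *)
Lemma little_step : (L * e <= 2^-1)%R ->
  \int[Pi]_s psi s <= \int[Pi]_s (#|present C s|%:R)%:E +
    (e * (L * K + L * K + L * B + (L * L + L * L) * (K * (e * n%:R))))%:E.
Proof.
move=> Le2; have E00 : (0 < E0)%R := expR_gt0 _.
have K0 : (0 <= K)%R by exact: ler0n.
have B0 : (0 <= B)%R by rewrite !mulr_ge0.
have [P PE /andP[P0 _]] : exists2 r : R, \int[Pi]_s psi s = r%:E & (0 <= r <= B)%R.
  by apply: fin_int => // s; rewrite lee_fin entry_work_le.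
have [F FE /andP[F0 FK]] : exists2 r : R, \int[Pi]_s f s = r%:E & (0 <= r <= K * (e * n%:R))%R.
  by apply: fin_int => // s; rewrite lee_fin total_work_le.
have [N NE /andP[N0 _]] : exists2 r : R, \int[Pi]_s (#|present C s|%:R)%:E = r%:E & (0 <= r <= K)%R.
  by apply: fin_int => // s; rewrite lee_fin ler_nat card_present.
have fb s : f s <= (K * (e * n%:R))%:E by rewrite lee_fin total_work_le.
have psib s : psi s <= B%:E by rewrite lee_fin entry_work_le.
have n0 := nnm_evolve C pol_adm 0 e_ge0 nnm_f.
have n1 := nnm_evolve C pol_adm 1 e_ge0 nnm_f.
have hC : \int[Pi]_s evolve C I pol 0 e f s + \int[Pi]_s evolve C I pol 1 e f s <= F%:E.
  rewrite -FE -(stationary_integral pol_adm PiS e_ge0 nnm_f fb) -ge0_integralD//; last 4 first.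
  - by move=> s _; exact: n0.2.
  - exact: n0.1.
  - by move=> s _; exact: n1.2.
  - exact: n1.1.
  apply: le_integral_ge0 => s _; first by rewrite adde_ge0// ?n0.2 ?n1.2.
  rewrite /semigroup (nneseries_split 0 2)//; last first.
    by move=> k _; exact: (nnm_evolve C pol_adm k e_ge0 nnm_f).2.
  rewrite add0n big_nat_recl// big_nat1 leeDl//; apply: nneseries_ge0 => k _ _.
  exact: (nnm_evolve C pol_adm k e_ge0 nnm_f).2.
have hD : E0%:E * F%:E <= \int[Pi]_s evolve C I pol 0 e f s + (E0 * (e * N))%:E.
  rewrite -FE -ge0_integralZl//; last 3 first.
  - exact: nnm_f.1.
  - by move=> s _; exact: nnm_f.2.
  - by rewrite lee_fin ltW.
  rewrite mulrA EFinM -NE -ge0_integralZl//; last 2 first.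
  - exact: nnm_card.1.
  - by rewrite lee_fin mulr_ge0// ltW.
  rewrite -ge0_integralD//; last 4 first.
  - by move=> s _; exact: n0.2.
  - exact: n0.1.
  - by move=> s _; rewrite mule_ge0// lee_fin mulr_ge0// ltW.
  - by apply: emeasurable_funM => //; exact: nnm_card.1.
  apply: le_integral_ge0 => s _.
    by rewrite mule_ge0 ?lee_fin ?(ltW E00)// total_work_ge0.
  rewrite /= [X in _ <= _ + X](_ : _ = E0%:E * (e * #|present C s|%:R)%:E); last first.
    by rewrite -!EFinM mulrA.
  rewrite -ge0_muleDr ?lee_fin ?mulr_ge0//; last first.
    by apply: age_op_ge0 => // s'; exact: nnm_f.2.
  rewrite lee_wpmul2l ?lee_fin ?(ltW E00)//.
  by apply: le_age_op_total_work; rewrite e_ge0 lexx.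
have mapsiF : measurable_fun [set: R] (fun u => \int[Pi]_s apsi (s, u)).
  exact: (measurable_fun_fubini_tonelli_G (m1 := Pi) apsi measurable_apsi apsi_ge0).
have mapsiG : measurable_fun [set: st] (fun s => \int[lebesgue_measure]_(u in `[0%R, e]) apsi (s, u)).
  under eq_fun do rewrite integral_mul_indic.
  apply: (measurable_fun_fubini_tonelli_F (m2 := lebesgue_measure)
    (fun z : st * R => apsi z * (\1_`[0%R, e] z.2)%:E)).
    by apply: emeasurable_funM => //; exact: measurable_indic_itv0.
  by move=> z; rewrite mule_ge0 ?apsi_ge0.
have int_cst (c : R) : \int[lebesgue_measure]_(u in `[0%R, e]) c%:E = (e * c)%:E.
  have leb : lebesgue_measure `[0%R, e] = e%:E :> \bar R.
    by rewrite lebesgue_measure_itv/= lte_fin e_gt0 sube0.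
  by rewrite (mulrC e) EFinM -leb; exact: (integral_cst lebesgue_measure).
(* Here [psi] is seen after an ageing of length [u]; [stationary_age_op] removes the ageing at a
   cost of second order in [e]. *)
have hB : (e * P)%:E <= \int[Pi]_s \int[lebesgue_measure]_(u in `[0%R, e]) apsi (s, u)
    + (e * (L * e * B))%:E.
  rewrite fubini_apsi -!int_cst -ge0_integralD//; last 3 first.
  - by move=> u _; apply: integral_ge0.
  - exact: measurable_funTS.
  - by move=> u _; rewrite lee_fin !mulr_ge0.
  apply: le_integral_ge0 => u /=; first by rewrite lee_fin.
  rewrite in_itv/= => /andP[u0 ue]; rewrite -PE.
  apply: (le_trans (stationary_age_op pol_adm PiS u0 B0 nnm_psi psib)).
  rewrite /apsi/= (max_l u0) leeD2l// lee_fin ler_wpM2r//.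
  by rewrite ler_wpM2l.
have hA : (E0 * (e * L))%:E * F%:E +
    E0%:E * \int[Pi]_s \int[lebesgue_measure]_(u in `[0%R, e]) apsi (s, u) <=
    \int[Pi]_s evolve C I pol 1 e f s + (E0 * (e * (L * (e * K) + L * (e * K))))%:E.
  rewrite -FE -ge0_integralZl//; last 3 first.
  - exact: nnm_f.1.
  - by move=> s _; exact: nnm_f.2.
  - by rewrite lee_fin !mulr_ge0// ltW.
  rewrite -ge0_integralZl//; last 2 first.
  - by move=> s _; apply: integral_ge0.
  - by rewrite lee_fin ltW.
  rewrite -ge0_integralD//; last 4 first.
  - by move=> s _; rewrite mule_ge0// ?lee_fin ?mulr_ge0 ?(ltW E00)// total_work_ge0.
  - by apply: emeasurable_funM => //; exact: nnm_f.1.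
  - by move=> s _; rewrite mule_ge0 ?lee_fin ?(ltW E00)// integral_ge0.
  - exact: emeasurable_funM.
  rewrite -[X in _ <= _ + X](integral_probability_cst Pi) -ge0_integralD//; last 3 first.
  - by move=> s _; exact: n1.2.
  - exact: n1.1.
  - by move=> s _; rewrite lee_fin !(mulr_ge0, addr_ge0)// ltW.
  apply: le_integral_ge0 => s _; last exact: le_evolve1.
  by rewrite adde_ge0// mule_ge0 ?lee_fin ?mulr_ge0 ?(ltW E00)// ?total_work_ge0// integral_ge0.
rewrite PE NE -EFinD lee_fin.
have X00 : 0 <= \int[Pi]_s evolve C I pol 0 e f s by apply: integral_ge0 => s _; exact: n0.2.
have X10 : 0 <= \int[Pi]_s evolve C I pol 1 e f s by apply: integral_ge0 => s _; exact: n1.2.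
have X0F := le_trans (leeDl _ X10) hC; have X1F := le_trans (leeDr _ X00) hC.
have : 0 <= \int[Pi]_s \int[lebesgue_measure]_(u in `[0%R, e]) apsi (s, u).
  by apply: integral_ge0 => s _; exact: integral_ge0.
move: hA hB hC hD X00 X10 X0F X1F.
case: (\int[Pi]_s evolve C I pol 0 e f s) => [X0|//|//].
case: (\int[Pi]_s evolve C I pol 1 e f s) => [X1|//|//].
case: (\int[Pi]_s \int[lebesgue_measure]_(u in `[0%R, e]) apsi (s, u)) => [Y||//]; last first.
  by move=> + _ _ _ _ _ _ _ _; rewrite gt0_muley ?lte_fin// addey.
rewrite -!EFinM -!EFinD !lee_fin => hA hB hC hD _ _ _ _ _.
have h : (E0 * (F * (1 + L * e) + e * P) <=
    F + E0 * (e * N + e * (e * (L * K + L * K + L * B))))%R.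
  have := ler_wpM2l (ltW E00) hB; nra.
(* With [x = L e], [(1 - x) (1 + x + 2 x^2) = 1 + x^2 (1 - 2 x)], which is where [x <= 1/2]
   enters. *)
have expL : (E0 * (1 + L * e + 2 * (L * e) ^+ 2) >= 1)%R.
  have := expR_ge1Dx (- (L * e)); rewrite -mulNr -/E0 => h1.
  have Le0 : (0 <= L * e)%R by rewrite mulr_ge0.
  apply: (@le_trans _ _ ((1 + - (L * e)) * (1 + L * e + 2 * (L * e) ^+ 2))%R); last first.
    by rewrite ler_wpM2r -?mulNr// !addr_ge0// mulr_ge0// sqr_ge0.
  set x := (L * e)%R in Le2 Le0 *; rewrite -/x.
  have hx : (0 <= x ^+ 2 * (1 - 2 * x))%R by rewrite mulr_ge0 ?sqr_ge0//; lra.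
  rewrite -subr_ge0; apply: (le_trans hx); rewrite le_eqVlt; apply/orP; left; apply/eqP.
  ring.
have h2 : (E0 * (F * (1 + L * e) + e * P) <= E0 * (F * (1 + L * e + 2 * (L * e) ^+ 2)
   + (e * N + e * (e * (L * K + L * K + L * B)))))%R.
  apply: (le_trans h); rewrite [leRHS]mulrDr lerD2r mulrCA -[leLHS]mulr1.
  by rewrite ler_wpM2l.
move: h2; rewrite ler_pM2l// => h2.
have h3 : (e * P <= e * (N + e * (L * K + L * K + L * B) + e * (L * L + L * L) * F))%R.
  move: h2; rewrite -subr_ge0 => h2; rewrite -subr_ge0.
  by apply: le_trans h2 _; rewrite le_eqVlt; apply/orP; left; apply/eqP; ring.
move: h3; rewrite ler_pM2l// => h3; apply: (le_trans h3).
rewrite -addrA lerD2l -mulrA -mulrDr ler_wpM2l// lerD2l ler_wpM2l//.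
by rewrite addr_ge0// mulr_ge0.
Qed.

End little_step.

(** * Survival sums and mean service times *)

Section truncated_mean.
Context (R : realType) (G : probability R R).
Hypothesis G_ge0 : G [set` `[0, +oo[] = 1%E.
Local Open Scope ereal_scope.

Definition truncated_mean (t : R) : \bar R := \int[G]_x (Num.min (Num.max x 0) t)%:E.

Let nnm_trunc (t : R) : (0 <= t)%R -> nnm (fun x : R => (Num.min (Num.max x 0) t)%:E : \bar R).
Proof.
move=> t0; split; last by move=> x; rewrite lee_fin le_min t0 le_max lexx orbT.
by apply/measurable_EFinP; apply: measurable_minr => //; exact: measurable_maxr.
Qed.

(** Each survival probability is the integral of an indicator, so the sum is the integral of a
    staircase, and [layer_ge] bounds that staircase from below. *)
Lemma truncated_mean_le (e : R) n : (0 <= e)%R ->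
  truncated_mean (n%:R * e) <= (e * \sum_(i < n) survival G (i%:R * e))%:E.
Proof.
move=> e0; rewrite mulr_sumr -sumEFin.
rewrite (eq_bigr (fun i : 'I_n => \int[G]_x (e%:E * (\1_`]i%:R * e, +oo[ x)%:E))); last first.
  move=> i _; rewrite ge0_integralZl//; last first.
    by apply/measurable_EFinP; exact: measurable_indic.
  by rewrite integral_indic// setIT EFinM survivalE.
rewrite -ge0_integral_sum//; last 2 first.
- by move=> i; apply: emeasurable_funM => //; apply/measurable_EFinP; exact: measurable_indic.
- by move=> i x _; rewrite mule_ge0// lee_fin.
apply: le_integral_ge0 => x _; first by apply: (nnm_trunc _).2; rewrite mulr_ge0.
rewrite (eq_bigr (fun i : 'I_n => (e * (i%:R * e < Num.max x 0)%R%:R)%:E)); last first.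
  move=> i _; rewrite -EFinM indicE mem_setE in_itv/= andbT; congr (e * _)%:E.
  by rewrite lt_max [X in _ || X]ltNge mulr_ge0// orbF.
by rewrite sumEFin lee_fin; apply: layer_ge => //; rewrite le_max lexx orbT.
Qed.

Lemma service_meanE : service_mean G = \int[G]_x (Num.max x 0)%:E.
Proof.
apply: ae_eq_integral => //.
  by apply/measurable_EFinP; exact: measurable_maxr.
exists (~` [set` `[0%R, +oo[]); split; first exact: measurableC.
  by apply: (etrans (probability_setC G _)) => //; rewrite [X in 1 - X]G_ge0 subee.
move=> x /= h; rewrite in_itv/= andbT => x0; apply: h => _.
by rewrite max_l.
Qed.

Lemma truncated_mean_cvg : truncated_mean k%:R @[k --> \oo] --> service_mean G.
Proof.
rewrite service_meanE.
pose g (k : nat) (x : R) : \bar R := (Num.min (Num.max x 0) k%:R)%:E.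
rewrite (_ : \int[G]_x (Num.max x 0)%:E = \int[G]_x limn (g^~ x)); last first.
  apply: eq_integral => x _; apply/esym/lim_near_cst => //.
  near=> k; rewrite /g min_l//; near: k.
  exact: nbhs_infty_ger.
apply: cvg_monotone_convergence => //.
- by move=> k; exact: (nnm_trunc _).1.
- by move=> k x _; exact: (nnm_trunc _).2.
move=> x _ a b ab; rewrite lee_fin le_min ge_min lexx/= ge_min.
by rewrite ler_nat ab orbT.
Unshelve. all: by end_near. Qed.

End truncated_mean.

(** * Little's law for stationary dynamic policies *)

Section little.
Context (R : realType) (C M : nat) (I : 'I_M -> customer_class R).
Variables (pol : policy R M) (Pi : probability (state R M) R).
Hypothesis pol_adm : admissible I pol.
Hypothesis PiS : stationary C I pol Pi.
Notation st := (state R M).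
Notation L := (total_rate I).
Local Open Scope ereal_scope.

Definition nonfull := [set s : st | (in_service s < C)%N].

Lemma measurable_nonfull_set : measurable nonfull.
Proof.
rewrite -[nonfull]setTI.
exact: (@measurable_nonfull R C M measurableT [set true]).
Qed.

Definition throughput (j : 'I_M) : R := fine (\int[Pi]_(s in nonfull) (pol s j)%:E).

Lemma nnm_throughput j : nnm (fun s : st => (pol s j * \1_nonfull s)%:E : \bar R).
Proof.
split; last by move=> s; rewrite lee_fin mulr_ge0//; have /andP[] := pol_adm.2 s j.
apply/measurable_EFinP; apply: measurable_funM; first exact: pol_adm.1.
exact: measurable_indic measurable_nonfull_set.
Qed.

Lemma throughputE j : (throughput j)%:E = \int[Pi]_s (pol s j * \1_nonfull s)%:E.
Proof.
have E : \int[Pi]_(s in nonfull) (pol s j)%:E = \int[Pi]_s (pol s j * \1_nonfull s)%:E.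
  by rewrite integral_mul_indic.
rewrite -E fineK// E ge0_fin_numE; last first.
  by apply: integral_ge0 => s _; exact: (nnm_throughput j).2.
apply: (@le_lt_trans _ _ (\int[Pi]_s (cl_rate (I j))%:E)).
  apply: le_integral_ge0 => s _; first exact: (nnm_throughput j).2.
  by have /andP[p0 p1] := pol_adm.2 s j; rewrite lee_fin -[leRHS]mulr1 ler_pM.
by rewrite integral_probability_cst ltry.
Qed.

Lemma throughput_ge0 j : (0 <= throughput j)%R.
Proof. by rewrite -lee_fin throughputE; apply: integral_ge0 => s _; exact: (nnm_throughput j).2. Qed.

Lemma integral_entry_work e n : (0 <= e)%R ->
  \int[Pi]_s (entry_work C I pol e n s)%:E =
  (\sum_(j < M) throughput j * (e * \sum_(i < n) survival (cl_serv (I j)) (i%:R * e)))%:E.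
Proof.
move=> e0; rewrite -sumEFin.
have w0 j : (0 <= e * \sum_(i < n) survival (cl_serv (I j)) (i%:R * e))%R.
  by rewrite mulr_ge0// sumr_ge0// => i _; exact: survival_ge0.
transitivity (\int[Pi]_s \sum_(j < M) (e * \sum_(i < n) survival (cl_serv (I j)) (i%:R * e))%:E *
    (pol s j * \1_nonfull s)%:E).
  apply: eq_integral => s _; rewrite /entry_work.
  under [RHS]eq_bigr do rewrite -EFinM.
  rewrite sumEFin indicE; congr (_%:E).
  have -> : (s \in nonfull) = (in_service s < C)%N.
    by apply/idP/idP; rewrite ?inE// => h; rewrite inE.
  case: (in_service s < C)%N; last by rewrite big1// => j _; rewrite !mulr0.
  by apply: eq_bigr => j _; rewrite mulr1 mulrC.
rewrite ge0_integral_sum//; last 2 first.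
- by move=> j; apply: emeasurable_funM => //; exact: (nnm_throughput j).1.
- by move=> j s _; apply: mule_ge0; [rewrite lee_fin|exact: (nnm_throughput j).2].
apply: eq_bigr => j _; rewrite ge0_integralZl ?lee_fin//; last 2 first.
- exact: (nnm_throughput j).1.
- by move=> s _; exact: (nnm_throughput j).2.
by rewrite -throughputE -EFinM mulrC.
Qed.

Lemma truncated_mean_fin j (k : nat) : truncated_mean (cl_serv (I j)) k%:R \is a fin_num.
Proof.
have t0 x : (0 <= Num.min (Num.max x 0) k%:R :> R)%R by rewrite le_min le_max lexx orbT/=.
rewrite ge0_fin_numE; last by apply: integral_ge0 => x _; rewrite lee_fin.
apply: (@le_lt_trans _ _ (\int[cl_serv (I j)]__ k%:R%:E)).
  by apply: le_integral_ge0 => x _; rewrite lee_fin// ge_min lexx orbT.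
by rewrite integral_probability_cst ltry.
Qed.

Lemma truncated_little (N : R) (k : nat) :
  \int[Pi]_s (#|present C s|%:R)%:E = N%:E ->
  (\sum_(j < M) throughput j * fine (truncated_mean (cl_serv (I j)) k%:R) <= N)%R.
Proof.
move=> NE.
have [->|k0] := eqVneq k 0%N.
  rewrite big1 => [|j _]; last first.
    rewrite /truncated_mean (eq_integral (fun=> 0)) ?integral0 ?mulr0// => x _.
    by rewrite min_r// le_max lexx orbT.
  by rewrite -lee_fin -NE; apply: integral_ge0 => s _; rewrite lee_fin.
have k1 : (0 < k%:R :> R)%R by rewrite ltr0n lt0n.
set K : R := (M * C)%:R.
pose c := (L * K + L * K + L * (L * k%:R) + (L * L + L * L) * (K * k%:R))%R.
have L0 := total_rate_ge0 I.
have c0 : (0 <= c)%R by rewrite !(addr_ge0, mulr_ge0).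
apply/ler_addgt0Pr => eps eps0.
(* For [e = k / n] the horizon [n e = k] stays fixed, while this [n] gives both [L e <= 1/2] and
   [e c <= eps]. *)
pose n := (Num.truncn (k%:R * c / eps + 2 * L * k%:R)).+1.
have n0 : (0 < n%:R :> R)%R by rewrite ltr0n.
have hn : (k%:R * c / eps + 2 * L * k%:R <= n%:R)%R by apply/ltW; apply: truncnS_gt.
have ha : (0 <= k%:R * c / eps)%R by rewrite divr_ge0 ?mulr_ge0// ltW.
have hb : (0 <= 2 * L * k%:R)%R by rewrite !mulr_ge0.
pose e : R := (k%:R / n%:R)%R.
have e0 : (0 < e)%R by rewrite divr_gt0.
have en : (n%:R * e = k%:R)%R by rewrite mulrC divfK// gt_eqF.
have Le : (L * e <= 2^-1)%R.
  rewrite mulrA ler_pdivrMr//; lra.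
have ec : (e * c <= eps)%R.
  rewrite /e mulrAC ler_pdivrMr// -ler_pdivrMl//; lra.
have := little_step pol_adm PiS n e0 Le.
rewrite NE integral_entry_work ?(ltW e0)// -EFinD lee_fin => h.
have h1 : (\sum_(j < M) throughput j * fine (truncated_mean (cl_serv (I j)) k%:R) <=
   \sum_(j < M) throughput j * (e * \sum_(i < n) survival (cl_serv (I j)) (i%:R * e)))%R.
  apply: ler_sum => j _; rewrite ler_wpM2l ?throughput_ge0//.
  rewrite -lee_fin fineK ?truncated_mean_fin//.
  by rewrite -en; apply: truncated_mean_le; exact: ltW.
apply: (le_trans h1); apply: (le_trans h); rewrite lerD2l.
apply: le_trans ec; rewrite (mulrC e n%:R) en; exact: lexx.
Qed.

Lemma measurable_nonneg_ages : measurable [set s : st | forall j, all (fun a => 0 <= a)%R (s j)].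
Proof.
rewrite (_ : [set s | _] = [set s : st | [forall j, all (fun a => 0 <= a)%R (s j)]]); last first.
  by apply/seteqP; split => s /= /forallP.
rewrite -[X in measurable X]setTI.
suff mall j : measurable_fun [set: st] (fun s : st => all (fun a => 0 <= a)%R (s j)).
  exact: (measurable_forall mall measurableT (Y := [set true])).
apply: (measurable_fun_bool true); rewrite setTI.
rewrite (_ : _ @^-1` _ = \bigcap_(k : nat) (fun s : st => nth 0%R (s j) k) @^-1` `[0%R, +oo[).
  apply: bigcapT_measurable => k; rewrite -[X in measurable X]setTI.
  exact: measurable_age.
apply/seteqP; split => [s /= /allP sj k _|s h] /=.
  rewrite in_itv/= andbT; have [ks|ks] := ltnP k (size (s j)).
    by apply: sj; rewrite mem_nth.
  by rewrite nth_default.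
apply/allP => a /(nthP 0%R)[k ks <-].
by have := h k Logic.I; rewrite /= in_itv/= andbT.
Qed.

Lemma measurable_state_space : measurable (@state_space R C M).
Proof.
rewrite (_ : @state_space R C M = [set s : st | (in_service s <= C)%N] `&`
  [set s : st | forall j, all (fun a => 0 <= a)%R (s j)]).
  apply: measurableI; last exact: measurable_nonneg_ages.
  rewrite -[X in measurable X]setTI.
  exact: (measurable_in_service measurableT (Y := [set n : nat | (n <= C)%N])).
by apply/seteqP; split => s /= [? h]; split => // j; case: (h j).
Qed.

Lemma measurable_states_with (x : 'I_M -> nat) : measurable (@states_with R M x).
Proof.
rewrite (_ : states_with x = (\bigcap_j [set s : st | size (s j) = x j]) `&`
  [set s : st | forall j, all (fun a => 0 <= a)%R (s j)]).
  apply: measurableI; last exact: measurable_nonneg_ages.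
  apply: fin_bigcap_measurable => [|j _]; [exact: finite_finset|exact: measurable_size_eq].
apply/seteqP; split => s /=.
  by move=> h; split => j => [_|]; case: (h j).
by move=> [h1 h2] j; split; [exact: (h1 j)|exact: h2].
Qed.

(** A state that is not full leaves a unit idle. This integer slack is the origin of the probability
    term in [little]. *)
Lemma card_present_nonfull (s : st) : @state_space R C M s ->
  (#|present C s| + (in_service s < C) <= C)%N.
Proof.
move=> [sC _].
have ps : (#|present C s| <= in_service s)%N.
  rewrite -(ler_nat R) -sum1_card natr_sum natr_sum.
  rewrite (eq_bigl (fun k : 'I_M * 'I_C => (k.2 < size (s k.1))%N)); last by move=> k; rewrite inE.
  rewrite -(pair_big_dep xpredT (fun j (k : 'I_C) => (k < size (s j))%N) (fun _ _ => 1%R))/=.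
  apply: ler_sum => j _; rewrite -(sum_take C (fun=> 1%R)) big_const_seq count_predT.
  by rewrite iter_addr_0 ler_nat size_take_min geq_minr.
have [sC'|sC'] := ltnP (in_service s) C; last by rewrite addn0 (leq_trans ps).
by rewrite addn1 (leq_ltn_trans ps).
Qed.

Lemma integral_le_state_space (f : st -> \bar R) (c b : R) : nnm f -> (0 <= c)%R ->
  (forall s, f s <= b%:E) -> (forall s, @state_space R C M s -> f s <= c%:E) ->
  \int[Pi]_s f s <= c%:E.
Proof.
move=> nf c0 fb fc; have mS := measurable_state_space.
have PC : Pi (~` @state_space R C M) = 0.
  by apply: (etrans (probability_setC Pi mS)); rewrite [X in 1 - X]PiS.1 subee.
have -> : \int[Pi]_s f s = \int[Pi]_(s in @state_space R C M) f s.
  rewrite -(setUv (@state_space R C M)) ge0_integral_setU//; last 4 first.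
  - exact: measurableC.
  - by rewrite setUv; exact: nf.1.
  - by move=> s _; exact: nf.2.
  - exact/disj_setPCl.
  rewrite [X in _ + X](null_set_integral _ _ PC) ?adde0//; [exact: measurableC|].
  exact: measurable_funTS nf.1.
apply: (@le_trans _ _ (\int[Pi]_(s in @state_space R C M) c%:E)).
  by apply: le_integral_ge0 => // s _; exact: nf.2.
by rewrite (integral_cst Pi mS) [X in _ * X]PiS.1 mule1.
Qed.

Lemma little :
  (\sum_(j < M) throughput j * mean_service I j + fine (Pi nonfull) <= C%:R)%R.
Proof.
have ncard : nnm (fun s : st => (#|present C s|%:R)%:E : \bar R).
  by split => //; apply/measurable_EFinP; exact: measurable_card_present.
have nind : nnm (fun s : st => (\1_nonfull s)%:E : \bar R).
  exact: nnm_indic measurable_nonfull_set.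
have pE : Pi nonfull = (fine (Pi nonfull))%:E.
  by rewrite fineK//; apply: fin_num_measure; exact: measurable_nonfull_set.
have : \int[Pi]_s ((#|present C s|%:R)%:E + (\1_nonfull s)%:E) <= C%:R%:E.
  apply: (@integral_le_state_space _ _ ((M * C)%:R + 1)%R) => //; first exact: nnmD.
    by move=> s; rewrite -EFinD lee_fin lerD// ler_nat card_present.
  move=> s /card_present_nonfull; rewrite -(ler_nat R) natrD -EFinD lee_fin indicE.
  by rewrite (_ : (s \in nonfull) = (in_service s < C)%N)//; apply/idP/idP; rewrite ?inE// => h; rewrite inE.
rewrite ge0_integralD//; last 2 first.
- exact: ncard.1.
- exact: nind.1.
rewrite integral_indic//; last exact: measurable_nonfull_set.
rewrite setIT [X in _ + X]pE.
case E : (\int[Pi]_s (#|present C s|%:R)%:E) => [N||]//; last first.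
  have : 0 <= \int[Pi]_s (#|present C s|%:R)%:E by apply: integral_ge0 => s _; exact: ncard.2.
  by rewrite E.
rewrite -EFinD lee_fin; apply: le_trans; rewrite lerD2r.
have tl k := truncated_little k E.
apply/ler_addgt0Pr => eps eps0.
pose S := (1 + \sum_(j < M) throughput j)%R.
have S0 : (0 < S)%R.
  by rewrite ltr_pwDl// sumr_ge0// => j _; exact: throughput_ge0.
have es0 : (0 < eps / S)%R by rewrite divr_gt0.
have [k hk] : exists k : nat, forall j,
    (mean_service I j - eps / S <= fine (truncated_mean (cl_serv (I j)) k%:R))%R.
  pose f (j : 'I_M) := [set k : nat | (mean_service I j - eps / S <=
    fine (truncated_mean (cl_serv (I j)) k%:R))%R].
  suff /(@filter_ex _ \oo) : \forall k \near \oo, forall j, f j k by [].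
  apply: filter_forall => j; rewrite /f/=.
  have mfin : service_mean (cl_serv (I j)) \is a fin_num.
    by have /andP[m0 mo] := cl_serv_mean (I j); rewrite ge0_fin_numE// ltW.
  have := truncated_mean_cvg (cl_serv_ge0 (I j)).
  rewrite -(fineK mfin) => /fine_cvgP[_ /cvgrPdist_le /(_ _ es0) ].
  by apply: filterS => k /=; rewrite ler_distlC => /andP[h _].
apply: (@le_trans _ _ (\sum_(j < M) throughput j * (fine (truncated_mean (cl_serv (I j)) k%:R) + eps / S))%R).
  by apply: ler_sum => j _; rewrite ler_wpM2l ?throughput_ge0// -lerBlDr.
rewrite (eq_bigr _ (fun j _ => mulrDr _ _ _)) big_split/= lerD// -mulr_suml mulrCA.
by rewrite ler_piMr ?(ltW eps0)// ler_pdivrMr// mul1r /S lerDr.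
Qed.
End little.

(** * Concave envelopes and supporting lines *)

Section concave_envelope.
Context (R : realType) (L : R).
Implicit Types (g h : R -> R) (x y t : R).

Lemma concave_onP h : concave_on L h <-> forall t x y, 0 <= t <= 1 ->
  0 <= x <= L -> 0 <= y <= L -> t * h x + (1 - t) * h y <= h (t * x + (1 - t) * y).
Proof.
split=> [hc t x y t01 xL yL|hc t x y].
  have := hc (Itv01 (andP t01).1 (andP t01).2) x y.
  rewrite !mem_setE !in_itv/= xL yL => /(_ erefl erefl).
  by rewrite convRE /conv/= lerNl opprD !mulrN !opprK -!/(_ * _).
rewrite !mem_setE !in_itv/= => xL yL.
have := hc t%:num x y _ xL yL; rewrite ge0 le1 => /(_ erefl) h1.
by rewrite !convRE lerNl opprD !mulrN !opprK.
Qed.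

Lemma affine_concave (a b : R) : concave_on L (fun x => a + b * x).
Proof. by apply/concave_onP => t x y _ _ _; rewrite le_eqVlt; apply/orP; left; apply/eqP; ring. Qed.

(** The bound [B] supplies a constant concave majorant; over an empty set of majorants [inf] would
    be a mere default value. *)
Lemma le_concave_envelope g (B : R) x :
  (forall y, 0 <= y <= L -> g y <= B) -> 0 <= x <= L -> g x <= concave_envelope L g x.
Proof.
move=> gB xL; apply: lb_le_inf.
  exists B; exists (fun=> B) => //; split; last by move=> y; rewrite in_itv/=; exact: gB.
  have -> : (fun=> B) = (fun y => B + 0 * y) by apply/funext => y; rewrite mul0r addr0.
  exact: affine_concave.
by move=> _ [h [_ gh] <-]; apply: gh; rewrite in_itv/=.
Qed.

Lemma concave_envelope_le g h x : concave_on L h ->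
  (forall y, 0 <= y <= L -> g y <= h y) -> 0 <= x <= L -> concave_envelope L g x <= h x.
Proof.
move=> hc gh xL; apply: ge_inf; last first.
  by exists h => //; split => // y; rewrite in_itv/=; exact: gh.
by exists (g x) => _ [k [_ gk] <-]; apply: gk; rewrite in_itv/=.
Qed.

Lemma concave_envelope_concave g (B : R) :
  (forall y, 0 <= y <= L -> g y <= B) -> concave_on L (concave_envelope L g).
Proof.
move=> gB; apply/concave_onP => t x y /andP[t0 t1] xL yL.
have [[x0 xL'] [y0 yL']] := (andP xL, andP yL).
have zL : 0 <= t * x + (1 - t) * y <= L by apply/andP; split; nra.
apply: lb_le_inf.
  exists B; exists (fun=> B) => //; split; last by move=> z; rewrite in_itv/=; exact: gB.
  have -> : (fun=> B) = (fun y => B + 0 * y) by apply/funext => z; rewrite mul0r addr0.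
  exact: affine_concave.
move=> _ [h [hc gh] <-].
have gh' z : 0 <= z <= L -> g z <= h z by move=> zz; apply: gh; rewrite in_itv/=.
have t01 : 0 <= t <= 1 by rewrite t0.
have /concave_onP := hc; move=> /(_ t x y t01 xL yL); apply: le_trans.
by rewrite lerD// ler_wpM2l ?subr_ge0//; exact: concave_envelope_le.
Qed.

(** [c] is the supremum of the slopes to the right of [x0]; by concavity each of these is at most
    every slope from the left. *)
Lemma concave_support h x0 : concave_on L h -> 0 < x0 < L ->
  exists c, forall x, 0 <= x <= L -> h x <= h x0 + c * (x - x0).
Proof.
move=> /concave_onP hc /andP[x00 x0L].
pose A := [set q | exists2 y, x0 < y <= L & q = (h y - h x0) / (y - x0)].
have slope x y : 0 <= x < x0 -> x0 < y <= L ->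
    (h y - h x0) / (y - x0) <= (h x0 - h x) / (x0 - x).
  move=> /andP[x_ge0 xx0] /andP[x0y yL].
  have d0 : 0 < y - x by lra.
  have t01 : 0 <= (y - x0) / (y - x) <= 1.
    apply/andP; split; first by rewrite divr_ge0//; lra.
    by rewrite ler_pdivrMr// mul1r; lra.
  have xL : 0 <= x <= L by lra.
  have yL' : 0 <= y <= L by lra.
  have := hc _ x y t01 xL yL'.
  rewrite (_ : (y - x0) / (y - x) * x + (1 - (y - x0) / (y - x)) * y = x0); last by field; lra.
  rewrite (_ : (y - x0) / (y - x) * h x + (1 - (y - x0) / (y - x)) * h y
    = ((y - x0) * h x + (x0 - x) * h y) / (y - x)); last by field; lra.
  rewrite ler_pdivrMr// => h1.
  rewrite ler_pdivrMr ?subr_gt0// mulrAC ler_pdivlMr ?subr_gt0//; nra.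
have A0 : A !=set0 by exists ((h L - h x0) / (L - x0)); exists L => //; rewrite x0L lexx.
have ubA : has_ubound A.
  exists ((h x0 - h 0) / (x0 - 0)) => _ [y yL ->]; apply: slope => //.
  by rewrite lexx.
exists (sup A) => x /andP[x_ge0 xL].
have [xx0|xx0|->] := ltgtP x x0; last by rewrite subrr mulr0 addr0.
  have : sup A <= (h x0 - h x) / (x0 - x).
    apply: ge_sup => // _ [y yL ->]; apply: slope => //.
    by rewrite x_ge0.
  rewrite ler_pdivlMr ?subr_gt0//; lra.
have : (h x - h x0) / (x - x0) <= sup A.
  by apply: ub_le_sup => //; exists x => //; rewrite xx0.
rewrite ler_pdivrMr ?subr_gt0//; lra.
Qed.

(* A supporting line of a nonnegative function is a nonnegative combination
   of x and L - x. *)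
Lemma concave_support_ge0 h x0 : concave_on L h -> (forall x, 0 <= x <= L -> 0 <= h x) ->
  0 < x0 < L -> exists a b, [/\ 0 <= a, 0 <= b, h x0 = a * x0 + b * (L - x0) &
    forall x, 0 <= x <= L -> h x <= a * x + b * (L - x)].
Proof.
move=> hc h0 x0L; have [c hcx] := concave_support hc x0L.
have [x00 x0L'] := andP x0L; have L0 : 0 < L by lra.
have hz : 0 <= h x0 + c * (0 - x0) by apply: le_trans (hcx 0 _); [apply: h0|]; rewrite lexx ltW.
have hL : 0 <= h x0 + c * (L - x0) by apply: le_trans (hcx L _); [apply: h0|]; rewrite lexx ltW.
exists ((h x0 + c * (L - x0)) / L), ((h x0 + c * (0 - x0)) / L).
split; rewrite ?divr_ge0// ?ltW//; first by field; lra.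
move=> x xL; apply: le_trans (hcx x xL) _.
by rewrite le_eqVlt; apply/orP; left; apply/eqP; field; lra.
Qed.

End concave_envelope.

(** * Monotonicity in the Erlang loss formula *)

Section erlang.
Context (R : realType).
Implicit Types (r a b : R) (n C : nat).

(** [partial_exp C r / partial_exp C.+1 r] is one minus the Erlang blocking probability at load
    [r]. *)
Definition partial_exp n r : R := \sum_(0 <= i < n) r ^+ i / i`!%:R.

Lemma partial_expS n r : partial_exp n.+1 r = partial_exp n r + r ^+ n / n`!%:R.
Proof. by rewrite /partial_exp big_nat_recr. Qed.

Lemma partial_exp_gt0 n r : (0 < n)%N -> 0 <= r -> 0 < partial_exp n r.
Proof.
case: n => // n _ r0; rewrite /partial_exp big_nat_recl// expr0 fact0 divr1.
by rewrite ltr_pwDl// sumr_ge0// => i _; rewrite divr_ge0 ?exprn_ge0.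
Qed.

Lemma fact_gt0R n : 0 < n`!%:R :> R.
Proof. by rewrite ltr0n fact_gt0. Qed.

Lemma partial_expS_le C r : (0 < C)%N -> 0 <= r ->
  partial_exp C.+1 r <= (1 + r / C%:R) * partial_exp C r.
Proof.
case: C => // n _ r0; rewrite partial_expS mulrDl mul1r lerD2l partial_expS.
have -> : r ^+ n.+1 / (n.+1)`!%:R = r / n.+1%:R * (r ^+ n / n`!%:R).
  by rewrite exprS factS natrM invfM; ring.
rewrite ler_wpM2l ?divr_ge0// lerDr.
by apply: sumr_ge0 => i _; rewrite divr_ge0 ?exprn_ge0.
Qed.

Lemma expr_swap a b k i : 0 <= a <= b -> (k <= i)%N ->
  a ^+ i * b ^+ k <= b ^+ i * a ^+ k.
Proof.
move=> /andP[a0 ab] ki; have b0 := le_trans a0 ab.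
rewrite -(subnK ki) !exprD -mulrA -[leRHS]mulrA (mulrC (a ^+ k)).
by rewrite ler_wpM2r ?mulr_ge0 ?exprn_ge0// lerXn2r.
Qed.

Lemma partial_exp_ratio_incr C a b : 0 <= a <= b ->
  partial_exp C.+1 a * partial_exp C b <= partial_exp C.+1 b * partial_exp C a.
Proof.
move=> /andP[a0 ab]; have b0 := le_trans a0 ab.
rewrite !partial_expS !mulrDl (mulrC (partial_exp C a)) lerD2l.
rewrite /partial_exp !mulr_sumr !big_mkord; apply: ler_sum => i _.
rewrite mulrACA [leRHS]mulrACA ler_wpM2r ?mulr_ge0 ?invr_ge0//.
by apply: expr_swap; [rewrite a0|exact: ltnW].
Qed.

Let weight C i : R := (i + (i < C))%:R.

(** Multiplying by [r] shifts the series: [r * r^i / i!] is [i + 1] times the term of index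
    [i + 1]. *)
Let partial_exp_mul C r :
  (1 + r) * partial_exp C r = \sum_(i < C.+1) weight C i * (r ^+ i / i`!%:R).
Proof.
rewrite mulrDl mul1r /partial_exp big_mkord mulr_sumr.
rewrite (eq_bigr (fun i : 'I_C.+1 => (i < C)%N%:R * (r ^+ i / i`!%:R) + i%:R * (r ^+ i / i`!%:R))).
  rewrite big_split/=; congr (_ + _).
    rewrite big_ord_recr/= ltnn mul0r addr0.
    by apply: eq_bigr => i _; rewrite ltn_ord mul1r.
  rewrite big_ord_recl mul0r add0r; apply: eq_bigr => i _.
  rewrite lift0 exprS factS natrM invfM.
  have : i.+1%:R != 0 :> R by rewrite pnatr_eq0.
  by move=> h; rewrite [RHS]mulrCA mulVKf// mulrA.
by move=> i _; rewrite /weight natrD addrC mulrDl.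
Qed.

Let weight_mono C i k : (i <= k <= C)%N -> weight C i <= weight C k.
Proof.
move=> /andP[ik kC]; rewrite ler_nat; move: ik; rewrite leq_eqVlt => /predU1P[->//|ik].
by rewrite (leq_trans _ (leq_addr _ _))// (leq_trans _ ik)// -[i.+1]addn1 leq_add2l leq_b1.
Qed.

(* Chebyshev's sum inequality: (1 + r) * partial_exp C r is the mean of the
   increasing weights min(i + 1, C) under a law increasing in r. *)
Lemma partial_exp_ratio_decr C a b : 0 <= a <= b ->
  (1 + a) * partial_exp C a * partial_exp C.+1 b <=
  (1 + b) * partial_exp C b * partial_exp C.+1 a.
Proof.
move=> /andP[a0 ab]; have b0 := le_trans a0 ab.
rewrite !partial_exp_mul /partial_exp !big_mkord.
pose t r (i : nat) := r ^+ i / i`!%:R; rewrite -!/(t _ _).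
pose X (i k : 'I_C.+1) := t b i * t a k - t a i * t b k.
rewrite -subr_ge0 !mulr_suml -sumrB.
rewrite (eq_bigr (fun i : 'I_C.+1 => \sum_(k < C.+1) weight C i * X i k)); last first.
  move=> i _; rewrite !mulr_sumr -sumrB; apply: eq_bigr => k _.
  rewrite /X -!/(t _ _); ring.
set D := \sum_(i < C.+1) _.
(* Symmetrising in [i] and [k] turns each term into a product of two differences of the same
   sign. *)
have DE : D + D = \sum_(i < C.+1) \sum_(k < C.+1) (weight C i - weight C k) * X i k.
  rewrite {2}/D exchange_big -big_split/=; apply: eq_bigr => i _.
  by rewrite -big_split/=; apply: eq_bigr => k _; rewrite /X; ring.
have X0 (i k : 'I_C.+1) : (k <= i)%N -> 0 <= X i k.
  move=> ki; rewrite subr_ge0 /t mulrACA [leRHS]mulrACA ler_wpM2r ?mulr_ge0 ?invr_ge0//.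
  by apply: expr_swap; rewrite ?a0.
suff : 0 <= D + D by rewrite -mulr2n pmulrn_lge0.
rewrite DE; apply: sumr_ge0 => i _; apply: sumr_ge0 => k _.
have [ki|ik] := leqP k i.
  by rewrite mulr_ge0 ?X0// subr_ge0 weight_mono// ki -ltnS ltn_ord.
have -> : X i k = - X k i by rewrite /X; ring.
rewrite mulrN -mulNr mulr_ge0//; last by rewrite X0// ltnW.
by rewrite opprB subr_ge0 weight_mono// (ltnW ik) -ltnS ltn_ord.
Qed.

Lemma GratioE C : (0 < C)%N ->
  Gratio R C = partial_exp C C.-1%:R / partial_exp C.+1 C.-1%:R.
Proof.
move=> C0; rewrite /Gratio -/(partial_exp C.+1 _).
have S0 : 0 < partial_exp C.+1 C.-1%:R by exact: partial_exp_gt0.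
have -> : partial_exp C C.-1%:R = partial_exp C.+1 C.-1%:R - C.-1%:R ^+ C / C`!%:R.
  by rewrite partial_expS addrK.
by rewrite mulrBl divff ?gt_eqF.
Qed.

(* The bound used for n = C - 1 is attained at C = 3. *)
Lemma Gratio_ge C : (0 < C)%N -> 15 / 19 <= Gratio R C.
Proof.
move=> C0; rewrite /Gratio -/(partial_exp C.+1 _).
set S := partial_exp _ _; have S0 : 0 < S by exact: partial_exp_gt0.
suff h : C.-1%:R ^+ C / C`!%:R <= 4 / 19 * S.
  have : C.-1%:R ^+ C / C`!%:R / S <= 4 / 19 by rewrite ler_pdivrMr.
  lra.
move: @S S0 => /= _; case: C C0 => [//|[|[|[|k]]]] _ /=.
- by rewrite expr1 mul0r mulr_ge0// ltW// partial_exp_gt0.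
- by rewrite /partial_exp !big_nat_recl//= big_geq// !expr1n !factS fact0/=; lra.
- by rewrite /partial_exp !big_nat_recl//= big_geq// !factS fact0 !exprS expr0/=; lra.
(* From [C = 4] on, the top five terms of the sum suffice. They are rational multiples of [v], and
   the claim becomes the positivity of a cubic with positive coefficients. *)
set n : R := k.+3%:R.
rewrite !partial_expS.
have P0 : 0 <= partial_exp k n by apply: sumr_ge0 => i _; rewrite divr_ge0 ?exprn_ge0.
have nE : n = k%:R + 3 by rewrite /n -addn3 natrD.
have k0 : 0 <= k%:R :> R by exact: ler0n.
set v := n ^+ k / k`!%:R.
have v0 : 0 <= v by rewrite divr_ge0 ?exprn_ge0.
have tS i : n ^+ i.+1 / i.+1`!%:R = n ^+ i / i`!%:R * (n / i.+1%:R).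
  by rewrite exprS factS natrM invfM; ring.
rewrite !tS -/v.
have -> : k.+1%:R = k%:R + 1 :> R by rewrite -addn1 natrD.
have -> : k.+2%:R = k%:R + 2 :> R by rewrite -addn2 natrD.
have -> : k.+4%:R = k%:R + 4 :> R by rewrite -addn4 natrD.
rewrite -/n.
move: P0; set P := partial_exp k n => P0.
move: (P) (v) P0 v0 => {}P {}v P0 v0; rewrite nE.
set x : R := k%:R in k0 *.
suff : 0 <= 4 / 19 * (v + v * ((x + 3) / (x + 1)) + v * ((x + 3) / (x + 1)) * ((x + 3) / (x + 2)) +
   v * ((x + 3) / (x + 1)) * ((x + 3) / (x + 2)) * ((x + 3) / (x + 3)) +
  v * ((x + 3) / (x + 1)) * ((x + 3) / (x + 2)) * ((x + 3) / (x + 3)) * ((x + 3) / (x + 4)))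
   - v * ((x + 3) / (x + 1)) * ((x + 3) / (x + 2)) * ((x + 3) / (x + 3)) * ((x + 3) / (x + 4)) by lra.
rewrite (_ : _ - _ = v * (4 * x ^+ 3 / 16 + 36 * x ^+ 2 / 16 + 76 * x / 16 + 44 / 16) * (4 / 19) / ((x + 1) * (x + 2) * (x + 4))); last first.
  field; rewrite !gt_eqF//; lra.
rewrite divr_ge0//; first by rewrite !mulr_ge0// !addr_ge0 ?divr_ge0 ?mulr_ge0 ?exprn_ge0.
by rewrite !mulr_ge0// addr_ge0.
Qed.

(* The worst case for the static policy of offered load rho against a dynamic
   policy that is not full with probability p is p = 1 and rho = C - 1. *)
Lemma partial_exp_ratio_bound C p rho : (0 < C)%N -> 0 < p <= 1 -> 0 <= rho ->
  p * rho + p <= C%:R ->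
  p * (partial_exp C.+1 rho / partial_exp C rho) <= (Gratio R C)^-1.
Proof.
move=> C0 /andP[p0 p1] rho0 h; rewrite GratioE// invf_div.
have S0 r : 0 <= r -> 0 < partial_exp C r by exact: partial_exp_gt0.
have S10 r : 0 <= r -> 0 < partial_exp C.+1 r by exact: partial_exp_gt0.
set m : R := C.-1%:R; have m0 : 0 <= m by exact: ler0n.
have mE : 1 + m = C%:R by rewrite /m -{2}(prednK C0) -addn1 natrD addrC.
(* Up to load [C - 1], bound [p] by 1 and use that blocking grows. Beyond it the constraint caps [p]
   at [C / (1 + rho)], and with [C = 1 + m] the claim is [partial_exp_ratio_decr]. *)
have [rm|mr] := leP rho m.
  apply: (@le_trans _ _ (partial_exp C.+1 rho / partial_exp C rho)).
    by rewrite ler_piMl// divr_ge0 ?ltW ?S0 ?S10.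
  rewrite ler_pdivrMr ?S0// mulrAC ler_pdivlMr ?S0//.
  by apply: partial_exp_ratio_incr; rewrite rho0.
have r1 : 0 < 1 + rho by rewrite ltr_pwDl.
have pC : p <= C%:R / (1 + rho) by rewrite ler_pdivlMr//; lra.
apply: (@le_trans _ _ (C%:R / (1 + rho) * (partial_exp C.+1 rho / partial_exp C rho))).
  by rewrite ler_wpM2r// divr_ge0 ?ltW ?S0 ?S10.
rewrite -mE mulf_div ler_pdivrMr ?mulr_gt0 ?S0// mulrAC ler_pdivlMr ?S0//.
have := @partial_exp_ratio_decr C m rho; rewrite m0 (ltW mr) => /(_ erefl); lra.
Qed.

End erlang.

(** * Prices and bounds on the revenue rates *)

Section pricing_facts.
Context (R : realType) (V : valuation R).
Implicit Types (L lam x : R).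

Lemma law_cdf_nondecreasing (P : probability R R) x y : x <= y -> law_cdf P x <= law_cdf P y.
Proof.
move=> xy; rewrite fine_le ?fin_num_measure//; apply: le_measure; rewrite ?inE//.
by apply: subset_itvl; rewrite bnd_simp.
Qed.

Lemma law_cdf_le1 (P : probability R R) x : law_cdf P x <= 1.
Proof. by rewrite -lee_fin fineK ?fin_num_measure// probability_le1. Qed.

Lemma law_cdf_cvg1 (P : probability R R) : law_cdf P n%:R @[n --> \oo] --> (1 : R).
Proof.
have : (P \o (fun n : nat => [set` `]-oo, n%:R : R]])) @ \oo --> (1%E : \bar R).
  rewrite -(@probability_setT _ _ _ P).
  rewrite (_ : [set: R] = \bigcup_n [set` `]-oo, n%:R : R]]).
    apply: nondecreasing_cvg_mu => //; first by apply: bigcup_measurable.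
    move=> m n mn; apply/subsetPset; apply: subset_itvl.
    by rewrite bnd_simp ler_nat.
  rewrite eqEsubset; split => // x _; exists (Num.truncn x).+1 => //=.
  by rewrite in_itv/= ltW// truncnS_gt.
by move=> /fine_cvgP[_].
Qed.

Lemma price_ge_lo L lam : val_lo V <= price V L lam.
Proof.
rewrite /price; case: xgetP => [x _ [/andP[+ _] _]|]; last by rewrite lexx.
by rewrite lee_fin.
Qed.

Lemma price_ge0 L lam : 0 <= price V L lam.
Proof. exact: le_trans (val_lo_ge0 V) (price_ge_lo L lam). Qed.

Lemma price_le_hi L lam : ((price V L lam)%:E <= val_hi V)%E.
Proof.
rewrite /price; case: xgetP => [x _ [/andP[_ +] _]//|_].
exact/ltW/val_lo_hi.
Qed.

Lemma revenue_bounded L : 0 < L ->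
  (val_hi V = +oo%E -> cvg (l * price V L l @[l --> 0^'+])) ->
  exists2 B, 0 <= B & forall lam, 0 <= lam <= L -> 0 <= revenue V L lam <= B.
Proof.
move=> L0 cv.
case E : (val_hi V) => [h| |].
- exists (L * `|h|); first by rewrite mulr_ge0// ltW.
  move=> lam /andP[l0 lL]; rewrite /revenue E andbF mulr_ge0 ?price_ge0//=.
  apply: ler_pM => //; rewrite ?price_ge0// (le_trans _ (ler_norm h))//.
  by have := price_le_hi L lam; rewrite E lee_fin.
- have {}cv := cv E.
  set r0 := lim (l * price V L l @[l --> 0^'+]) in cv.
  have r00 : 0 <= r0.
    by apply: limr_ge => //; near=> l; rewrite mulr_ge0// price_ge0.
  have : \forall l \near 0^'+, l * price V L l <= r0 + 1.
    by apply: (cvgr_le r0) => //; rewrite ltrDl.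
  move=> /nbhs_right0P[d/= d0 hd].
  (* Below rate [d] the revenue is within 1 of its limit at 0; a rate of at least [d] can only come
     from a price at most [X]. *)
  have [X hX] : exists X, L * (1 - val_cdf V X) < d / 2.
    have : \forall n \near \oo, 1 - d / (2 * L) < law_cdf (val_law V) n%:R.
      apply: (cvgr_gt 1); first exact: law_cdf_cvg1.
      by rewrite ltrBlDr ltrDl divr_gt0// mulr_gt0.
    move=> /filter_ex[n hn]; exists n%:R; rewrite mulrC -ltr_pdivlMr//.
    move: hn; rewrite /val_cdf (_ : d / (2 * L) = d / 2 / L); last by rewrite invfM mulrA.
    lra.
  (* The term [val_lo V] covers the default value of [price] at rates that no price induces. *)
  exists (r0 + 1 + L * (`|X| + val_lo V)).
    by rewrite !addr_ge0// mulr_ge0 ?(ltW L0)// addr_ge0// val_lo_ge0.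
  move=> lam /andP[l0 lL].
  have N0 : 0 <= L * (`|X| + val_lo V).
    by rewrite mulr_ge0 ?(ltW L0)// addr_ge0// val_lo_ge0.
  rewrite /revenue E eqxx andbT; case: eqP => [_|/eqP lam0]; first by rewrite r00/= -addrA lerDl addr_ge0.
  have lam_gt0 : 0 < lam by rewrite lt0r lam0.
  rewrite mulr_ge0 ?price_ge0//=.
  have [ld|dl] := ltP lam d.
    have := hd lam; rewrite /= sub0r normrN gtr0_norm// => /(_ ld lam_gt0); rewrite add0r => h.
    by rewrite (le_trans h)// lerDl.
  rewrite (@le_trans _ _ (L * (`|X| + val_lo V)))//; last by rewrite lerDr addr_ge0.
  apply: ler_pM => //; rewrite ?price_ge0// /price; case: xgetP => [x _ [_ hx]|_]; last by rewrite lerDr.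
  have [xX|Xx] := leP x X.
    by rewrite (le_trans xX)// (le_trans (ler_norm X))// lerDl val_lo_ge0.
  have := law_cdf_nondecreasing (val_law V) (ltW Xx); rewrite -!/(val_cdf _ _) => h.
  have : L * (1 - val_cdf V x) <= L * (1 - val_cdf V X) by rewrite ler_wpM2l ?(ltW L0)// lerB.
  rewrite hx; lra.
- by have := val_lo_hi V; rewrite E.
Unshelve. all: by end_near. Qed.

Lemma val_cdf_lt x y : val_lo V < x -> x < y -> (y%:E < val_hi V)%E ->
  val_cdf V x < val_cdf V y.
Proof.
move=> lox xy yhi.
have inV z : x <= z <= y -> ((val_lo V)%:E < z%:E < val_hi V)%E.
  move=> /andP[xz zy]; rewrite lte_fin (lt_le_trans lox)//=.
  by apply: le_lt_trans yhi; rewrite lee_fin.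
apply: (@gtr0_derive1_incr _ (val_cdf V) x y) => // [z|z|].
- rewrite in_itv/= => /andP[/ltW xz /ltW zy].
  by have [[]] := @val_smooth _ V z (inV z (introT andP (conj xz zy))).
- rewrite in_itv/= => /andP[/ltW xz /ltW zy].
  have [dF _ f0] := @val_smooth _ V z (inV z (introT andP (conj xz zy))).
  by rewrite derive1E (@derive_val _ _ _ _ _ _ _ dF).
- apply: continuous_in_subspaceT => z; rewrite inE/= in_itv/= => zxy.
  have [[dz _] _ _] := @val_smooth _ V z (inV z zxy).
  exact/differentiable_continuous/derivable1_diffP.
Qed.

Lemma val_interior : exists x0 x1 x2,
  [/\ val_lo V < x0, x0 < x1, x1 < x2 & (x2%:E < val_hi V)%E].
Proof.
have := val_lo_hi V; case: (val_hi V) => [h| |//].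
  rewrite lte_fin => lh; set a := val_lo V in lh *.
  by exists (a + (h - a) / 4), (a + (h - a) / 2), (a + (h - a) * 3 / 4); rewrite lte_fin; split; lra.
by move=> _; exists (val_lo V + 1), (val_lo V + 2), (val_lo V + 3); split; rewrite ?ltry//; lra.
Qed.

(** This makes static optima positive, so that the ratios of the theorem have a positive
    numerator. *)
Lemma revenue_pos L : 0 < L -> exists2 lam, 0 <= lam <= L & 0 < revenue V L lam.
Proof.
move=> L0; have [x0 [x1 [x2 [lo0 x01 x12 x2hi]]]] := val_interior.
have F01 : val_cdf V x0 < val_cdf V x1.
  by apply: val_cdf_lt => //; apply: lt_trans x2hi; rewrite lte_fin.
have F12 : val_cdf V x1 < val_cdf V x2 by apply: val_cdf_lt => //; exact: lt_trans x01.
have F21 : val_cdf V x2 <= 1 by exact: law_cdf_le1.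
have F0 : 0 <= val_cdf V x1 by rewrite fine_ge0.
set lam := L * (1 - val_cdf V x1).
have lam0 : 0 < lam by rewrite mulr_gt0//; lra.
exists lam; first by rewrite (ltW lam0)/= ler_piMr ?(ltW L0)//; lra.
rewrite /revenue gt_eqF//= mulr_gt0// /price.
have [/andP[lo hi] hx] : [set x | ((val_lo V)%:E <= x%:E <= val_hi V)%E /\ L * (1 - val_cdf V x) = lam]
    (xget (val_lo V) [set x | ((val_lo V)%:E <= x%:E <= val_hi V)%E /\ L * (1 - val_cdf V x) = lam]).
  apply: xgetPex; exists x1; split => //; rewrite lee_fin; apply/andP; split; first by lra.
  by apply/ltW; apply: lt_trans x2hi; rewrite lte_fin.
set x := xget _ _ in lo hi hx *.
(* [price] may select another solution than [x1], but one with the same CDF value, hence above [x0],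
   which is positive. *)
have [xx0|x0x] := leP x x0; last first.
  by apply: le_lt_trans x0x; apply/ltW; apply: le_lt_trans lo0; exact: val_lo_ge0.
have := law_cdf_nondecreasing (val_law V) xx0; rewrite -!/(val_cdf _ _) => h.
move: hx; rewrite /lam => /(mulfI (lt0r_neq0 L0)) hx; exfalso; lra.
Qed.

End pricing_facts.

(** * Upper bounds on the dynamic revenue *)

Section dynamic_upper_bound.
Context (R : realType) (C M : nat) (I : 'I_M -> customer_class R).
Notation st := (state R M).
Local Open Scope ereal_scope.

Lemma rev_bounded j : exists2 B : R, (0 <= B)%R &
  forall lam, (0 <= lam <= cl_rate (I j))%R -> (0 <= Defs.rev I j lam <= B)%R.
Proof. by apply: revenue_bounded; [exact: cl_rate_gt0|exact: cl_rev0]. Qed.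

Lemma rev_le_revbar j lam : (0 <= lam <= cl_rate (I j))%R -> (Defs.rev I j lam <= revbar I j lam)%R.
Proof.
have [B _ hB] := rev_bounded j; apply: le_concave_envelope => y /hB/andP[_]; exact.
Qed.

Lemma revbar_ge0 j lam : (0 <= lam <= cl_rate (I j))%R -> (0 <= revbar I j lam)%R.
Proof.
move=> lamL; apply: le_trans (rev_le_revbar lamL).
by have [B _ /(_ _ lamL)/andP[]] := rev_bounded j.
Qed.

Lemma revbar_concave j : concave_on (cl_rate (I j)) (revbar I j).
Proof.
have [B _ hB] := rev_bounded j.
by apply: (@concave_envelope_concave _ _ _ B) => y /hB/andP[].
Qed.

Lemma revbar_le_affine j (a b : R) : (forall x, (0 <= x <= cl_rate (I j))%R -> (Defs.rev I j x <= a + b * x)%R) ->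
  forall x, (0 <= x <= cl_rate (I j))%R -> (revbar I j x <= a + b * x)%R.
Proof.
move=> h x xL; apply: (concave_envelope_le (h := fun x => (a + b * x)%R)) => //.
exact: affine_concave.
Qed.

Lemma revbar_bounded j : exists2 B : R, (0 <= B)%R &
  forall lam, (0 <= lam <= cl_rate (I j))%R -> (revbar I j lam <= B)%R.
Proof.
have [B B0 hB] := rev_bounded j; exists B => // x xL.
rewrite -[B]addr0 -(mul0r x); apply: revbar_le_affine => // y yL.
by rewrite mul0r addr0; have /andP[] := hB y yL.
Qed.

(** The vectors of counts partition the nonfull states with nonnegative ages: [x0], the vector of
    list lengths, is the only one that matches. *)
Lemma sum_states_with (s : st) :
  (\sum_(i < C) \sum_(x : {ffun 'I_M -> 'I_C.+1} | (\sum_(j < M) x j)%N == i)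
     \1_(states_with (fun j => x j)) s =
   \1_(@nonfull R C M `&` [set s : st | forall j, all (fun a => 0 <= a)%R (s j)]) s :> R)%R.
Proof.
rewrite [RHS]indicE; have [ages|ages] := pselect (forall j, all (fun a => 0 <= a)%R (s j)); last first.
  rewrite memNset; last by move=> [].
  apply: big1 => i _; apply: big1 => x _; rewrite indicE memNset// => h.
  by apply: ages => j; case: (h j).
have E (x : {ffun 'I_M -> 'I_C.+1}) :
    (\1_(states_with (fun j => x j)) s = [forall j, size (s j) == x j]%:R :> R)%R.
  rewrite indicE; congr ((nat_of_bool _)%:R); apply/idP/forallP => [|h].
    by rewrite inE => h j; case: (h j) => ->.
  by rewrite inE => j; split => //; apply/eqP.
have [sC|sC] := boolP (in_service s < C)%N; last first.
  rewrite memNset; last by move=> [/= h _]; rewrite h in sC.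
  apply: big1 => i _; apply: big1 => x /eqP xi; rewrite E.
  case: forallP => // h; move: sC; rewrite /in_service (eq_bigr _ (fun j _ => eqP (h j))) xi.
  by rewrite ltn_ord.
rewrite mem_set//; pose x0 := [ffun j => inord (size (s j))] : {ffun 'I_M -> 'I_C.+1}.
have szC j : (size (s j) < C.+1)%N.
  by rewrite ltnS (leq_trans _ (ltnW sC))// /in_service (bigD1 j)//= leq_addr.
have x0s : (\sum_(j < M) x0 j = in_service s)%N.
  by apply: eq_bigr => j _; rewrite ffunE inordK.
rewrite (bigD1 (Ordinal sC))//= (bigD1 x0) ?x0s//= E.
have -> : [forall j, size (s j) == x0 j] by apply/forallP => j; rewrite ffunE inordK.
have other (x : {ffun 'I_M -> 'I_C.+1}) : x != x0 -> (\1_(states_with (fun j => x j)) s = 0 :> R)%R.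
  move=> xx0; rewrite E; case: forallP => // h; case/negP: xx0; apply/eqP/ffunP => j.
  by apply/val_inj; rewrite ffunE /= inordK// (eqP (h j)).
rewrite big1 ?addr0; last by move=> x /andP[_]; exact: other.
rewrite big1 ?addr0// => i; rewrite -val_eqE/= => ii; apply: big1 => x /eqP xi; apply: other.
by apply: contraNneq ii => xx; rewrite -xi xx x0s.
Qed.

Lemma nonfull_ages_measurable :
  measurable (@nonfull R C M `&` [set s : st | forall j, all (fun a => 0 <= a)%R (s j)]).
Proof. by apply: measurableI; [exact: measurable_nonfull_set|exact: measurable_nonneg_ages]. Qed.

Variables (pol : policy R M) (Pi : probability st R).
Hypothesis pol_adm : admissible I pol.

Lemma integral_states_with (g : st -> \bar R) : nnm g ->
  \sum_(i < C) \sum_(x : {ffun 'I_M -> 'I_C.+1} | (\sum_(j < M) x j)%N == i)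
     \int[Pi]_(s in states_with (fun j => x j)) g s =
  \int[Pi]_(s in @nonfull R C M `&` [set s : st | forall j, all (fun a => 0 <= a)%R (s j)]) g s.
Proof.
move=> ng; rewrite [RHS]integral_mul_indic.
have nx (x : {ffun 'I_M -> 'I_C.+1}) : nnm (fun s => g s * (\1_(states_with (fun j => x j)) s)%:E).
  split; last by move=> s; rewrite mule_ge0 ?ng.2.
  apply: emeasurable_funM; first exact: ng.1.
  by apply/measurable_EFinP; apply: measurable_indic; exact: measurable_states_with.
transitivity (\int[Pi]_s \sum_(i < C) \sum_(x : {ffun 'I_M -> 'I_C.+1} | (\sum_(j < M) x j)%N == i)
   (g s * (\1_(states_with (fun j => x j)) s)%:E)); last first.
  apply: eq_integral => s _; rewrite -sum_states_with -sumEFin ge0_sume_distrr; last first.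
    by move=> i _; rewrite lee_fin sumr_ge0.
  apply: eq_bigr => i _; rewrite -sumEFin ge0_sume_distrr// => x _.
rewrite ge0_integral_sum//; last 2 first.
- by move=> i; apply: (nnm_sum _ (fun x _ => nx x)).1.
- by move=> i s _; apply: sume_ge0 => x _; exact: (nx x).2.
apply: eq_bigr => i _.
under eq_integral do rewrite big_mkcond.
rewrite big_mkcond ge0_integral_sum//; last 2 first.
- by move=> x; case: eqP => // _; exact: (nx x).1.
- by move=> x s _; case: eqP => // _; exact: (nx x).2.
apply: eq_bigr => x _; case: eqP => _; last by rewrite integral0.
exact: integral_mul_indic.
Qed.

(** The majorants are written in [x] and [L - x] with nonnegative coefficients, so that every
    integral is that of a nonnegative function even for a line of negative slope. *)
Lemma dynamic_revenue_le (a b : 'I_M -> R) :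
  (forall j, 0 <= a j)%R -> (forall j, 0 <= b j)%R ->
  (forall j x, (0 <= x <= cl_rate (I j))%R ->
     (revbar I j x <= a j * x + b j * (cl_rate (I j) - x))%R) ->
  dynamic_revenue C I pol Pi <= (\sum_(j < M) (a j * throughput C pol Pi j +
    b j * (cl_rate (I j) * fine (Pi (@nonfull R C M)) - throughput C pol Pi j)))%:E.
Proof.
move=> a0 b0 hab; have mnf := @measurable_nonfull_set R C M.
pose g j (s : st) : \bar R := (a j)%:E * (pol s j)%:E + (b j)%:E * (cl_rate (I j) - pol s j)%:E.
have npol j : nnm (fun s : st => (pol s j)%:E : \bar R).
  by split => [|s]; [apply/measurable_EFinP; exact: pol_adm.1|have /andP[] := pol_adm.2 s j].
have npol' j : nnm (fun s : st => (cl_rate (I j) - pol s j)%:E : \bar R).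
  split => [|s]; last by have /andP[] := pol_adm.2 s j; rewrite lee_fin subr_ge0.
  by apply/measurable_EFinP; apply: measurable_funB => //; exact: pol_adm.1.
have ng j : nnm (g j) by apply: nnmD; apply: nnmZ.
have nsg : nnm (fun s => \sum_(j < M) g j s) by exact: nnm_sum.
apply: (@le_trans _ _ (\sum_(i < C) \sum_(x : {ffun 'I_M -> 'I_C.+1} | (\sum_(j < M) x j)%N == i)
     \int[Pi]_(s in states_with (fun j => x j)) \sum_(j < M) g j s)).
  apply: lee_sum => i _; apply: lee_sum => x _; apply: le_integral_ge0 => s _.
    by rewrite lee_fin sumr_ge0// => j _; exact/revbar_ge0/pol_adm.2.
  by rewrite -sumEFin; apply: lee_sum => j _; rewrite /g -!EFinM -EFinD lee_fin hab// pol_adm.2.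
rewrite integral_states_with//.
apply: (@le_trans _ _ (\int[Pi]_(s in @nonfull R C M) \sum_(j < M) g j s)).
  apply: ge0_subset_integral => //; first exact: nonfull_ages_measurable.
  - by apply: measurable_funTS; exact: nsg.1.
  - by move=> s _; exact: nsg.2.
rewrite ge0_integral_sum//; last 2 first.
- by move=> j; apply: measurable_funTS; exact: (ng j).1.
- by move=> j s _; exact: (ng j).2.
rewrite -sumEFin le_eqVlt; apply/orP; left; apply/eqP; apply: eq_bigr => j _.
have thE : \int[Pi]_(s in @nonfull R C M) (pol s j)%:E = (throughput C pol Pi j)%:E.
  by rewrite (throughputE C Pi pol_adm) integral_mul_indic.
rewrite ge0_integralD//; last 4 first.
- by move=> s _; rewrite mule_ge0 ?(npol j).2// lee_fin.
- by apply: measurable_funTS; exact: (nnmZ _ (npol j)).1.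
- by move=> s _; rewrite mule_ge0 ?(npol' j).2// lee_fin.
- by apply: measurable_funTS; exact: (nnmZ _ (npol' j)).1.
rewrite !ge0_integralZl_EFin//; last 4 first.
- by move=> s _; exact: (npol' j).2.
- by apply: measurable_funTS; exact: (npol' j).1.
- by move=> s _; exact: (npol j).2.
- by apply: measurable_funTS; exact: (npol j).1.
rewrite thE EFinD !EFinM; congr (_ + _ * _).
have : \int[Pi]_(s in @nonfull R C M) (cl_rate (I j) - pol s j)%:E + (throughput C pol Pi j)%:E =
   (cl_rate (I j) * fine (Pi (@nonfull R C M)))%:E.
  rewrite -thE -ge0_integralD//; last 4 first.
  - by move=> s _; exact: (npol' j).2.
  - by apply: measurable_funTS; exact: (npol' j).1.
  - by move=> s _; exact: (npol j).2.
  - by apply: measurable_funTS; exact: (npol j).1.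
  under eq_integral do rewrite -EFinD subrK.
  rewrite integral_cst// EFinM fineK//; exact: fin_num_measure.
by move=> h; rewrite EFinB -h addeK.
Qed.

Lemma throughput_le j : (throughput C pol Pi j <= cl_rate (I j) * fine (Pi (@nonfull R C M)))%R.
Proof.
rewrite -lee_fin (throughputE C Pi pol_adm) EFinM fineK; last first.
  by apply: fin_num_measure; exact: measurable_nonfull_set.
rewrite -integral_cst; last exact: measurable_nonfull_set.
rewrite [leRHS]integral_mul_indic; apply: le_integral_ge0 => s _.
  exact: (nnm_throughput C pol_adm j).2.
by rewrite -EFinM lee_fin ler_wpM2r//; have /andP[] := pol_adm.2 s j.
Qed.

Hypothesis C0 : (0 < C)%N.
Hypothesis Pi_stat : stationary C I pol Pi.

Lemma mean_service_gt0 j : (0 < mean_service I j)%R.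
Proof. by rewrite /mean_service fine_gt0// cl_serv_mean. Qed.

(* [lh] is the conditional mean [th / p] moved slightly into the interior, where
   the concave function has a supporting line even if it jumps at an endpoint. *)
Lemma jensen j (e : R) : (0 < e < 1)%R -> (0 < fine (Pi (@nonfull R C M)))%R ->
  let p := fine (Pi (@nonfull R C M)) in
  let lh := ((1 - e) * (throughput C pol Pi j / p) + e * (cl_rate (I j) / 2))%R in
  (0 <= lh <= cl_rate (I j))%R /\
  exists a b, [/\ (0 <= a)%R, (0 <= b)%R,
    (forall x, (0 <= x <= cl_rate (I j))%R ->
     (revbar I j x <= a * x + b * (cl_rate (I j) - x))%R) &
    ((1 - e) * (a * throughput C pol Pi j + b * (cl_rate (I j) * p - throughput C pol Pi j)) <=
      p * revbar I j lh)%R].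
Proof.
move=> /andP[e0 e1] p0 p lh; have L0 := cl_rate_gt0 (I j).
have th0 := throughput_ge0 C Pi pol_adm j; have thL := throughput_le j.
set th := throughput C pol Pi j in th0 thL lh *; set L := cl_rate (I j) in L0 thL lh *.
have q0 : (0 <= th / p)%R by rewrite divr_ge0// ltW.
have qL : (th / p <= L)%R by rewrite ler_pdivrMr.
have thE : (th = p * (th / p))%R by rewrite mulrC divfK// gt_eqF.
have lhL : (0 < lh < L)%R by apply/andP; split; rewrite /lh; nra.
split; first by case/andP: lhL => /ltW -> /ltW ->.
have [a [b [a0 b0 E hab]]] := concave_support_ge0 (@revbar_concave j) (@revbar_ge0 j) lhL.
exists a, b; split => //; rewrite E thE /lh.
set q := (th / p)%R in q0 qL *; rewrite -subr_ge0.
rewrite [X in (0 <= X)%R](_ : _ = p * e * (L / 2) * (a + b))%R; last by rewrite -/L; field.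
by rewrite !mulr_ge0// ?addr_ge0// ltW.
Qed.


Let p := fine (Pi (@nonfull R C M)).

Lemma nonfull_prob_itv : (0 <= p <= 1)%R.
Proof.
apply/andP; split; first exact/fine_ge0/measure_ge0.
rewrite -lee_fin fineK ?probability_le1//; first exact: measurable_nonfull_set.
by apply: fin_num_measure; exact: measurable_nonfull_set.
Qed.

Lemma dynamic_revenue_le0 : p = 0%R -> dynamic_revenue C I pol Pi <= 0.
Proof.
move=> p0; have /choice[B hB] : forall j, exists B : R, (0 <= B)%R /\
    forall x, (0 <= x <= cl_rate (I j))%R -> (revbar I j x <= B)%R.
  by move=> j; have [B] := revbar_bounded j; exists B.
pose a j := (B j / cl_rate (I j))%R.
have a0 j : (0 <= a j)%R by rewrite divr_ge0 ?(hB j).1// ltW// cl_rate_gt0.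
apply: le_trans (@dynamic_revenue_le a a a0 a0 _) _ => [j x xL|].
  rewrite -mulrDr addrCA subrr addr0 /a divfK ?gt_eqF ?cl_rate_gt0//.
  exact: (hB j).2.
rewrite lee_fin big1// => j _.
by rewrite -/p p0 mulr0 sub0r mulrN subrr.
Qed.

Lemma static_revenue_ge0 (q : 'I_M -> R -> R) lam :
  (forall j x, (0 <= x <= cl_rate (I j))%R -> (0 <= q j x)%R) ->
  static_rates I lam -> (0 <= static_revenue C I q lam)%R.
Proof.
move=> q0 laml; rewrite /static_revenue mulr_ge0 ?sumr_ge0// => [j _|].
  by apply: q0; exact: laml.
rewrite divr_ge0// sumr_ge0// => i _; rewrite divr_ge0// exprn_ge0// sumr_ge0// => j _;
  by rewrite mulr_ge0 ?(ltW (mean_service_gt0 j))//; have /andP[] := laml j.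
Qed.

(** The supporting lines at the rates [lh] of [jensen] bound the dynamic revenue, up to the factor
    [1 - e], by [p] times the envelopes at [lh], hence by a static revenue over an Erlang ratio;
    [partial_exp_ratio_bound] then applies. Moving the rates inward adds a load of at most [e Q],
    paid for by the factor [1 + e Q], and finally [e] tends to 0. *)
Lemma dynamic_le_randomized (S : R) :
  (forall lam, static_rates I lam -> (static_revenue C I (revbar I) lam <= S)%R) ->
  dynamic_revenue C I pol Pi <= (S / Gratio R C)%:E.
Proof.
move=> hS; have [p_ge0 p1] := andP nonfull_prob_itv.
have G0 : (0 < Gratio R C)%R by apply: lt_le_trans (Gratio_ge R C0); lra.
have S0 : (0 <= S)%R.
  have h0 : static_rates I (fun=> 0%R) by move=> j; rewrite lexx ltW// cl_rate_gt0.
  by apply: le_trans (hS _ h0); apply: static_revenue_ge0 => // j x; exact: revbar_ge0.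
have [p0|pN0] := eqVneq p 0%R.
  by apply: le_trans (dynamic_revenue_le0 p0) _; rewrite lee_fin divr_ge0// ltW.
have p0 : (0 < p)%R by rewrite lt_neqAle eq_sym pN0.
pose Q := (\sum_(j < M) cl_rate (I j) / 2 * mean_service I j)%R.
have Q0 : (0 <= Q)%R.
  by apply: sumr_ge0 => j _; rewrite !mulr_ge0// ltW ?cl_rate_gt0// mean_service_gt0.
suff bound e : (0 < e < 1)%R ->
    dynamic_revenue C I pol Pi <= ((1 - e)^-1 * (1 + e * Q) * (S / Gratio R C))%:E.
  set K := (S / Gratio R C)%R; have K0 : (0 <= K)%R by rewrite divr_ge0// ltW.
  apply/lee_addgt0Pr => d d0.
  have [z0 z1] : (0 < 1 + Q + d + K * (1 + Q))%R /\ (d < 1 + Q + d + K * (1 + Q))%R by split; nra.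
  (* The bound at [e] is within [d] of [K] as soon as [e (K + K Q + d) <= d]; the extra [1 + Q] in
     the denominator keeps [e] below 1. *)
  pose e := (d / (1 + Q + d + K * (1 + Q)))%R.
  have e0 : (0 < e)%R by rewrite divr_gt0.
  have e1 : (e < 1)%R by rewrite ltr_pdivrMr// mul1r.
  apply: le_trans (bound e _) _; first by rewrite e0.
  rewrite -EFinD lee_fin -mulrA mulrC ler_pdivrMr ?subr_gt0//.
  have eE : (e * (1 + Q + d + K * (1 + Q)) = d)%R by rewrite /e divfK// gt_eqF.
  have : (e * (1 + Q) >= 0)%R by rewrite mulr_ge0 ?addr_ge0// ltW.
  rewrite -/K => e1Q; rewrite -subr_ge0.
  rewrite (_ : _ - _ = e * (1 + Q) + (d - e * (1 + Q + d + K * (1 + Q))))%R; last by ring.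
  by rewrite eE subrr addr0.
move=> /andP[e0 e1]; have e01 : (0 < e < 1)%R by rewrite e0.
pose lh j := ((1 - e) * (throughput C pol Pi j / p) + e * (cl_rate (I j) / 2))%R.
have lhL : static_rates I lh by move=> j; have [] := jensen j e01 p0.
have /choice[ab hab] : forall j, exists ab : R * R, [/\ (0 <= ab.1)%R, (0 <= ab.2)%R,
    (forall x, (0 <= x <= cl_rate (I j))%R ->
     (revbar I j x <= ab.1 * x + ab.2 * (cl_rate (I j) - x))%R) &
    ((1 - e) * (ab.1 * throughput C pol Pi j + ab.2 * (cl_rate (I j) * p - throughput C pol Pi j)) <=
      p * revbar I j (lh j))%R].
  by move=> j; have [_ [a [b h]]] := jensen j e01 p0; exists (a, b).
apply: le_trans (@dynamic_revenue_le (fun j => (ab j).1) (fun j => (ab j).2) _ _ _) _.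
- by move=> j; case: (hab j).
- by move=> j; case: (hab j).
- by move=> j; case: (hab j).
rewrite lee_fin -/p -mulrA mulrC ler_pdivlMr ?subr_gt0// mulrC.
apply: (@le_trans _ _ (p * \sum_(j < M) revbar I j (lh j))%R).
  by rewrite !mulr_sumr; apply: ler_sum => j _; case: (hab j).
set rho := (\sum_(j < M) lh j * mean_service I j)%R.
have rho0 : (0 <= rho)%R.
  by apply: sumr_ge0 => j _; rewrite mulr_ge0 ?(ltW (mean_service_gt0 j))//; have /andP[] := lhL j.
have := hS _ lhL; rewrite /static_revenue -/rho -!/(partial_exp _ _).
have A0 : (0 < partial_exp C rho)%R by exact: partial_exp_gt0.
have B0 : (0 < partial_exp C.+1 rho)%R by exact: partial_exp_gt0.
set Z := (\sum_(j < M) revbar I j (lh j))%R => hZ.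
have {}hZ : (Z <= S * (partial_exp C.+1 rho / partial_exp C rho))%R.
  by rewrite -ler_pdivrMr ?divr_gt0// invf_div.
have eQ : (1 <= 1 + e * Q)%R by rewrite lerDl mulr_ge0// ltW.
have eQ0 : (0 < 1 + e * Q)%R by lra.
have prho : (p * rho = (1 - e) * (\sum_(j < M) throughput C pol Pi j * mean_service I j) + p * (e * Q))%R.
  rewrite /rho /Q !mulr_sumr -big_split/=; apply: eq_bigr => j _.
  by rewrite /lh; field.
have thm0 : (0 <= \sum_(j < M) throughput C pol Pi j * mean_service I j)%R.
  by apply: sumr_ge0 => j _; rewrite mulr_ge0 ?(throughput_ge0 C Pi pol_adm)// ltW// mean_service_gt0.
have := little pol_adm Pi_stat; rewrite -/p => lit.
have C1 : (1 <= C%:R :> R)%R by rewrite ler1n.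
(* Dividing [p] by [1 + e Q] restores the capacity constraint, since [C + e Q <= C (1 + e Q)]. *)
have load : (p / (1 + e * Q) * rho + p / (1 + e * Q) <= C%:R)%R.
  rewrite mulrAC -mulrDl ler_pdivrMr// prho.
  have : (0 <= (C%:R - 1) * (e * Q))%R by rewrite mulr_ge0 ?subr_ge0// mulr_ge0// ltW.
  have : (p * (e * Q) <= e * Q)%R by rewrite ler_piMl// mulr_ge0// ltW.
  have : (0 <= e * \sum_(j < M) throughput C pol Pi j * mean_service I j)%R by rewrite mulr_ge0// ltW.
  lra.
have p'01 : (0 < p / (1 + e * Q) <= 1)%R.
  by rewrite divr_gt0//= ler_pdivrMr// mul1r (le_trans p1).
have h := partial_exp_ratio_bound C0 p'01 rho0 load.
apply: (@le_trans _ _ (p * (S * (partial_exp C.+1 rho / partial_exp C rho)))%R).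
  by rewrite ler_wpM2l.
have -> : (p * (S * (partial_exp C.+1 rho / partial_exp C rho)) =
  (1 + e * Q) * S * (p / (1 + e * Q) * (partial_exp C.+1 rho / partial_exp C rho)))%R.
  by field; rewrite !gt_eqF.
by rewrite [leRHS]mulrA ler_wpM2l// mulr_ge0// ltW.
Qed.

(** By [partial_expS_le] any static rates have total revenue rate at most [D (1 + rho / C)], a bound
    affine in the rates and thus separable: the lowest line of slope [k j] above [rev I j] has
    intercept [c j], and the [c j] sum to at most [D]. These lines dominate the envelopes too, and
    integrating them with Little's law gives at most [p D + (D / C) (C - p)], which is largest at
    [p = 1]. *)
Lemma dynamic_le_deterministic (D : R) :
  (forall lam, static_rates I lam -> (static_revenue C I (Defs.rev I) lam <= D)%R) ->
  dynamic_revenue C I pol Pi <= (D * (2 * C%:R - 1) / C%:R)%:E.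
Proof.
move=> hD; have [p_ge0 p1] := andP nonfull_prob_itv.
have C1 : (1 <= C%:R :> R)%R by rewrite ler1n.
have C00 : (0 < C%:R :> R)%R by rewrite ltr0n.
have rev_ge0 j x : (0 <= x <= cl_rate (I j))%R -> (0 <= Defs.rev I j x)%R.
  by move=> xL; have [B _ /(_ _ xL)/andP[]] := rev_bounded j.
have h0 : static_rates I (fun=> 0%R) by move=> j; rewrite lexx ltW// cl_rate_gt0.
have D0 : (0 <= D)%R by apply: le_trans (hD _ h0); apply: static_revenue_ge0.
pose k j := (D * mean_service I j / C%:R)%R.
have k0 j : (0 <= k j)%R by rewrite divr_ge0 ?mulr_ge0// ?ltW// mean_service_gt0.
pose A j := [set (Defs.rev I j x - k j * x)%R | x in [set x | (0 <= x <= cl_rate (I j))%R]].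
have A0 j : A j (Defs.rev I j 0%R) by exists 0%R; rewrite ?mulr0 ?subr0//; exact: h0.
have hsA j : has_sup (A j).
  split; first by exists (Defs.rev I j 0%R).
  have [B _ hB] := rev_bounded j; exists B => _ [x xL <-].
  have /andP[_ rB] := hB x xL; rewrite lerBlDr (le_trans rB)// lerDl mulr_ge0//.
  by case/andP: xL.
pose c j := sup (A j).
have c_ub j x : (0 <= x <= cl_rate (I j))%R -> (Defs.rev I j x <= c j + k j * x)%R.
  by move=> xL; rewrite -lerBlDr; apply: (ub_le_sup (hsA j).2); exists x.
have c_ge0 j : (0 <= c j)%R.
  by have := c_ub j 0%R (h0 j); rewrite mulr0 addr0; apply: le_trans; exact/rev_ge0/h0.
have sumc : (\sum_(j < M) c j <= D)%R.
  apply/ler_addgt0Pr => e e0.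
  (* The suprema are approached class by class; [M] slacks of [e / M.+1] add up to at most [e], also
     for [M = 0]. *)
  have M0 : (0 < M.+1%:R :> R)%R by rewrite ltr0n.
  have eM : (0 < e / M.+1%:R)%R by rewrite divr_gt0.
  have /choice[x hx] : forall j, exists x, (0 <= x <= cl_rate (I j))%R /\
      (c j - e / M.+1%:R < Defs.rev I j x - k j * x)%R.
    by move=> j; have [_ [x xL <-] hx] := sup_adherent eM (hsA j); exists x.
  have xs : static_rates I x by move=> j; case: (hx j).
  have := hD _ xs; rewrite /static_revenue -!/(partial_exp _ _).
  set rho := (\sum_(j < M) x j * mean_service I j)%R.
  have rho0 : (0 <= rho)%R.
    by apply: sumr_ge0 => j _; rewrite mulr_ge0 ?(ltW (mean_service_gt0 j))//; have /andP[] := xs j.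
  have a0 : (0 < partial_exp C rho)%R by exact: partial_exp_gt0.
  have b0 : (0 < partial_exp C.+1 rho)%R by exact: partial_exp_gt0.
  rewrite mulrA ler_pdivrMr// -ler_pdivlMr// -mulrA => h.
  have h1 : (\sum_(j < M) Defs.rev I j (x j) <= D * (1 + rho / C%:R))%R.
    apply: (le_trans h); rewrite ler_wpM2l// ler_pdivrMr//; exact: partial_expS_le.
  apply: (@le_trans _ _ (\sum_(j < M) (Defs.rev I j (x j) - k j * x j + e / M.+1%:R))%R).
    by apply: ler_sum => j _; rewrite -lerBlDr ltW//; case: (hx j).
  rewrite big_split/= sumr_const card_ord sumrB lerD//.
    rewrite lerBlDr (le_trans h1)// mulrDr mulr1 lerD2l /rho mulr_suml mulr_sumr.
    by apply: ler_sum => j _; rewrite /k le_eqVlt; apply/orP; left; apply/eqP; ring.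
  have -> : (e / M.+1%:R *+ M = e * M%:R / M.+1%:R :> R)%R by rewrite mulrAC mulr_natr.
  by rewrite ler_pdivrMr// ler_wpM2l ?ler_nat// ltW.
have L0 j : (0 < cl_rate (I j))%R by exact: cl_rate_gt0.
apply: le_trans (@dynamic_revenue_le (fun j => c j / cl_rate (I j) + k j)%R (fun j => c j / cl_rate (I j))%R _ _ _) _.
- by move=> j; apply: addr_ge0; [exact: divr_ge0 (c_ge0 j) (ltW (L0 j))|exact: k0].
- by move=> j; exact: divr_ge0 (c_ge0 j) (ltW (L0 j)).
- move=> j x xL; rewrite mulrDl addrAC -mulrDr addrCA subrr addr0 divfK ?gt_eqF//.
  by apply: revbar_le_affine xL; exact: c_ub.
rewrite lee_fin -/p.
have := little pol_adm Pi_stat; rewrite -/p => lit.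
apply: (@le_trans _ _ (p * D + D / C%:R * (C%:R - p))%R).
  apply: (@le_trans _ _ (p * (\sum_(j < M) c j) + D / C%:R * \sum_(j < M) throughput C pol Pi j * mean_service I j)%R).
    rewrite !mulr_sumr -big_split/=; apply: ler_sum => j _.
    by rewrite le_eqVlt; apply/orP; left; apply/eqP; rewrite /k; field; rewrite !gt_eqF.
  by rewrite lerD ?ler_wpM2l// ?divr_ge0// ?(ltW C00)//; lra.
rewrite -subr_ge0 (_ : _ - _ = D * (1 - p) * (C%:R - 1) / C%:R)%R; last by field; rewrite gt_eqF.
by rewrite divr_ge0 ?(ltW C00)// !mulr_ge0// subr_ge0.
Qed.

End dynamic_upper_bound.

(** * The static optimum and the lower bounds on the ratios *)

Section static_optimum.
Context (R : realType) (C M : nat) (I : 'I_M -> customer_class R).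
Hypotheses (C0 : (0 < C)%N) (M0 : (0 < M)%N).
Variable q : 'I_M -> R -> R.
Hypothesis q_ge0 : forall j x, 0 <= x <= cl_rate (I j) -> 0 <= q j x.
Hypothesis q_bounded : forall j, exists2 B : R, 0 <= B &
  forall x, 0 <= x <= cl_rate (I j) -> q j x <= B.
Hypothesis rev_le_q : forall j x, 0 <= x <= cl_rate (I j) -> Defs.rev I j x <= q j x.

Lemma static_opt_pos : exists S : R, [/\ static_opt C I q = S%:E, 0 < S &
  forall lam, static_rates I lam -> static_revenue C I q lam <= S].
Proof.
have rho0 (lam : 'I_M -> R) : static_rates I lam -> 0 <= \sum_(j < M) lam j * mean_service I j.
  by move=> h; apply: sumr_ge0 => j _; rewrite mulr_ge0 ?(ltW (mean_service_gt0 I j))//; have /andP[] := h j.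
have /choice[B hB] : forall j, exists B : R, 0 <= B /\
    forall x, 0 <= x <= cl_rate (I j) -> q j x <= B.
  by move=> j; have [B] := q_bounded j; exists B.
have ub lam : static_rates I lam -> static_revenue C I q lam <= \sum_(j < M) B j.
  move=> lamL; rewrite /static_revenue -!/(partial_exp _ _).
  set rho := \sum_(j < M) lam j * mean_service I j.
  rewrite -[leRHS]mulr1; apply: ler_pM.
  - by apply: sumr_ge0 => j _; exact: q_ge0.
  - by rewrite divr_ge0// ltW// partial_exp_gt0// rho0.
  - by apply: ler_sum => j _; exact: (hB j).2.
  - rewrite ler_pdivrMr ?partial_exp_gt0 ?rho0// mul1r partial_expS lerDl.
    by rewrite divr_ge0 ?exprn_ge0 ?rho0.
have [j0 _] : exists j0 : 'I_M, True by exists (Ordinal M0).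
have [x xL x0] := revenue_pos (cl_val (I j0)) (cl_rate_gt0 (I j0)).
pose lam j := if j == j0 then x else 0.
have lamL : static_rates I lam.
  by move=> j; rewrite /lam; case: eqP => [->|_]//; rewrite lexx ltW// cl_rate_gt0.
have rev0 : 0 < static_revenue C I q lam.
  rewrite /static_revenue -!/(partial_exp _ _) mulr_gt0//; last first.
    by rewrite divr_gt0// partial_exp_gt0// rho0.
  rewrite (bigD1 j0)//= ltr_pwDl//.
    by rewrite /lam eqxx (lt_le_trans x0)//; exact: rev_le_q.
  by apply: sumr_ge0 => j _; exact: q_ge0.
have le_opt l : static_rates I l -> ((static_revenue C I q l)%:E <= static_opt C I q)%E.
  by move=> h; apply: ereal_sup_ubound; exists l.
have opt_fin : static_opt C I q \is a fin_num.
  rewrite fin_numElt (lt_le_trans _ (le_opt _ lamL)) ?ltNyr//=.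
  apply: (@le_lt_trans _ _ (\sum_(j < M) B j)%:E); last exact: ltry.
  by apply: ge_ereal_sup => _ [l hl <-]; rewrite lee_fin ub.
exists (fine (static_opt C I q)); split; first by rewrite fineK.
  by rewrite -lte_fin fineK// (lt_le_trans _ (le_opt _ lamL))// lte_fin.
by move=> l hl; rewrite -lee_fin fineK// le_opt.
Qed.

End static_optimum.

(** At [d = 0] the extended inverse is [+oo], and [S > 0] makes the quotient infinite rather than
    0. *)
Lemma le_ediv (R : realType) (S c : R) (d : \bar R) : 0 < S -> 0 < c -> (0 <= d)%E ->
  (d <= (S / c)%:E)%E -> (c%:E <= S%:E / d)%E.
Proof.
move=> S0 c0; case: d => [d| _ |]; rewrite ?leye_eq ?leeNy_eq//.
rewrite lee_fin le_eqVlt => /predU1P[<- _|d0 dS].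
  by rewrite inve0 gt0_muley ?lte_fin// leey.
rewrite inver gt_eqF// -EFinM lee_fin ler_pdivlMr// mulrC.
by rewrite -ler_pdivlMr.
Qed.

Lemma Gratio_gt0 (R : realType) C : (0 < C)%N -> 0 < Gratio R C.
Proof. by move=> C0; apply: lt_le_trans (Gratio_ge R C0); lra. Qed.

Lemma deterministic_ratio_gt0 (R : realType) C : (0 < C)%N -> 0 < C%:R / (2 * C%:R - 1) :> R.
Proof.
move=> C0; have C1 : 1 <= C%:R :> R by rewrite ler1n.
by apply: divr_gt0; lra.
Qed.

Section ratio_lower_bounds.
Context (R : realType) (C M : nat) (I : 'I_M -> customer_class R).
Hypotheses (C0 : (0 < C)%N) (M0 : (0 < M)%N) (dyn0 : (0 <= dynamic_opt C I)%E).

Lemma randomized_ratio_ge :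
  ((Gratio R C)%:E <= static_opt_randomized C I / dynamic_opt C I)%E.
Proof.
have [S [SE S0 hS]] := static_opt_pos C0 M0 (@revbar_ge0 _ _ I) (revbar_bounded I) (@rev_le_revbar _ _ I).
rewrite /static_opt_randomized SE; apply: le_ediv => //.
  exact: Gratio_gt0.
apply: ge_ereal_sup => _ [pol [Pi [pol_adm Pi_stat ->]]].
exact: dynamic_le_randomized.
Qed.

Lemma deterministic_ratio_ge :
  ((C%:R / (2 * C%:R - 1) : R)%:E <= static_opt_deterministic C I / dynamic_opt C I)%E.
Proof.
have rev_ge0 j x : 0 <= x <= cl_rate (I j) -> 0 <= Defs.rev I j x.
  by move=> xL; have [B _ /(_ _ xL)/andP[]] := rev_bounded I j.
have rev_bd j : exists2 B : R, 0 <= B & forall x, 0 <= x <= cl_rate (I j) -> Defs.rev I j x <= B.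
  by have [B B0 hB] := rev_bounded I j; exists B => // x /hB/andP[].
have [S [SE S0 hS]] := static_opt_pos C0 M0 rev_ge0 rev_bd (fun j x _ => lexx _).
rewrite /static_opt_deterministic SE; apply: le_ediv => //.
  exact: deterministic_ratio_gt0.
apply: ge_ereal_sup => _ [pol [Pi [pol_adm Pi_stat ->]]].
by rewrite invf_div mulrA; exact: dynamic_le_deterministic.
Qed.

End ratio_lower_bounds.

Lemma tonelli d1 d2 (T1 : measurableType d1) (T2 : measurableType d2) (R : realType)
    (m1 : {sigma_finite_measure set T1 -> \bar R}) (m2 : {sigma_finite_measure set T2 -> \bar R})
    (f : T1 -> T2 -> \bar R) :
  nnm (fun z : T1 * T2 => f z.1 z.2) ->
  (\int[m1]_x \int[m2]_y f x y = \int[m2]_y \int[m1]_x f x y)%E.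
Proof. by move=> [mf f0]; exact: (fubini_tonelli (fun z => f z.1 z.2)). Qed.

(** * Changes of variables and iterated integrals *)

Section lebesgue_translation.
Context (R : realType).
Local Open Scope ereal_scope.
Local Notation mu := (@lebesgue_measure R).

(** The image of Lebesgue measure under a reflection agrees with it on half-open intervals, which
    determine it. *)
Lemma integral_reflect (c : R) (f : R -> \bar R) : nnm f ->
  \int[mu]_x f x = \int[mu]_x f (c - x)%R.
Proof.
move=> [mf f0].
have mphi : measurable_fun [set: R] (fun x : R => (c - x)%R : measurableTypeR R) by exact: measurable_funB.
transitivity (\int[pushforward mu (fun x : R => (c - x)%R : measurableTypeR R)]_x f x).
  apply: eq_measure_integral => A mA _; apply: lebesgue_measure_unique => // _ [[a b]] _ <-.
  have E : (fun x : R => c - x)%R @^-1` [set` `]a, b]%R] = [set` `[c - b, c - a[%R].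
    by apply/seteqP; split => x /=; rewrite !in_itv/= => /andP[? ?]; apply/andP; split; lra.
  transitivity (mu [set` `[c - b, c - a[%R]); last by rewrite -E.
  rewrite /= !lebesgue_measure_itv/= !lte_fin ltrD2l ltrN2.
  by case: ifP => // _; rewrite -!EFinB; congr (_%:E); ring.
exact: (@ge0_integral_pushforward _ _ (measurableTypeR R) (measurableTypeR R) R
  (fun x : R => (c - x)%R) mphi mu setT f measurableT mf (fun y _ => f0 y)).
Qed.

(** A translation is the composite of two reflections. *)
Lemma integral_shift (c : R) (f : R -> \bar R) : nnm f ->
  \int[mu]_x f x = \int[mu]_x f (x - c)%R.
Proof.
move=> nf; rewrite (integral_reflect 0 nf) (@integral_reflect c); last first.
  split => [|x]; last exact: nf.2.
  by apply: (measurableT_comp nf.1); exact: measurable_funB.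
by apply: eq_integral => x _; congr f; ring.
Qed.

Lemma triangle_indic (t s v : R) :
  ((\1_`[0, s] v : R)%:E * (\1_`[0, t] s : R)%:E =
   (\1_`[0, t] (s - v) : R)%:E * (\1_`[0, t - (s - v)] v : R)%:E :> \bar R)%E.
Proof.
rewrite -!EFinM !indicE !mem_setE !in_itv/=; congr EFin.
rewrite -!natrM !mulnb; apply: (congr1 (fun b : bool => b%:R)).
apply/and3P/and3P => -[/andP[h1 h2] h3 h4]; split; [|lra|lra| |lra|lra].
  by apply/andP; split; lra.
by apply/andP; split; lra.
Qed.

(** Both sides integrate [F v r] over the triangle [0 <= v], [0 <= r], [v + r <= t]: put [r = s - v]
    on the left and [r = t - u] on the right. *)
Lemma integral_triangle (t : R) (F : R -> R -> \bar R) :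
  nnm (fun z : R * R => F z.1 z.2) ->
  \int[mu]_(s in `[0%R, t]) \int[mu]_(v in `[0%R, s]) F v (s - v)%R =
  \int[mu]_(u in `[0%R, t]) \int[mu]_(v in `[0%R, u]) F v (t - u)%R.
Proof.
move=> [mF F0].
pose K (v r : R) : \bar R := F v r * (\1_`[0%R, t] r)%:E * (\1_`[0%R, (t - r)%R] v)%:E.
have mK : measurable_fun [set: R * R] (fun z => K z.1 z.2).
  apply: emeasurable_funM; last by apply: measurable_indic_itv0 => //; exact: measurable_funB.
  by apply: emeasurable_funM => //; exact: measurable_indic_itv0.
have K0 v r : 0 <= K v r by rewrite /K !mule_ge0 ?lee_fin//; exact: (F0 (v, r)).
have nK1 r : nnm (K^~ r).
  split => // ; apply: (measurableT_comp (g := fun v => (v, r)) mK).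
  exact: measurable_fun_pair.
have nK2 v : nnm (K v).
  split => // ; apply: (measurableT_comp (g := fun r => (v, r)) mK).
  exact: measurable_fun_pair.
have nF1 (a : R -> R) : measurable_fun [set: R] a -> nnm (fun v => F v (a v)).
  move=> ma; split => [|v]; last exact: F0 (v, a v).
  by apply: (measurableT_comp (g := fun v => (v, a v)) mF); exact: measurable_fun_pair.
have mI (D : set R) : measurable D -> measurable_fun [set: R] (fun v => (\1_D v)%:E : \bar R).
  by move=> mD; apply/measurable_EFinP; exact: measurable_indic.
have inner (x b y : R) (a : R -> R) : measurable_fun [set: R] a ->
    (\int[mu]_(v in `[0%R, b]) F v (a v)) * (\1_`[0%R, y] x)%:E =
    \int[mu]_v (F v (a v) * (\1_`[0%R, b] v)%:E * (\1_`[0%R, y] x)%:E).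
  move=> ma; rewrite integral_mul_indic -ge0_integralZr ?lee_fin//.
    by apply: emeasurable_funM; [exact: (nF1 _ ma).1|exact: mI].
  by move=> v _; rewrite mule_ge0 ?(nF1 _ ma).2// lee_fin.
transitivity (\int[mu]_v \int[mu]_r K v r).
  transitivity (\int[mu]_s \int[mu]_v K v (s - v)%R).
    rewrite integral_mul_indic; apply: eq_integral => s _.
    rewrite inner; last exact: measurable_funB.
    apply: eq_integral => v _; rewrite /K -!muleA; congr (_ * _).
    exact: triangle_indic.
  transitivity (\int[mu]_v \int[mu]_s K v (s - v)%R); last first.
    by apply: eq_integral => v _; rewrite -integral_shift.
  apply: (tonelli mu mu (f := fun s v => K v (s - v)%R)); split => [|z]; last exact: K0.
  apply: (measurableT_comp (g := fun z : R * R => (z.2, (z.1 - z.2)%R)) mK).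
  by apply: measurable_fun_pair => //; exact: measurable_funB.
transitivity (\int[mu]_r \int[mu]_v K v r).
  by apply: (tonelli mu mu (f := K)); split => // z; exact: K0.
transitivity (\int[mu]_u \int[mu]_v K v (t - u)%R).
  apply: integral_reflect; split; last by move=> r; apply: integral_ge0.
  exact: (@measurable_fun_fubini_tonelli_G _ _ _ _ _ mu (fun z => K z.1 z.2)).
rewrite [RHS]integral_mul_indic; apply: eq_integral => u _.
rewrite inner//.
apply: eq_integral => v _; rewrite /K -!muleA; congr (_ * _).
have -> : (t - (t - u) = u)%R by ring.
have -> : \1_`[0%R, t] (t - u)%R = \1_`[0%R, t] u :> R.
  by rewrite !indicE !mem_setE !in_itv/= subr_ge0 gerBl andbC.
exact: muleC.
Qed.
End lebesgue_translation.

Section iterated_integrals.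
Context d1 d2 (T1 : measurableType d1) (T2 : measurableType d2) (R : realType).
Local Open Scope ereal_scope.

Lemma nnm_integral (m : {sigma_finite_measure set T2 -> \bar R}) (K : T1 -> T2 -> \bar R) :
  nnm (fun z : T1 * T2 => K z.1 z.2) -> nnm (fun x => \int[m]_y K x y).
Proof.
move=> [mK K0]; split; last by move=> x; apply: integral_ge0 => y _; exact: (K0 (x, y)).
exact: (measurable_fun_fubini_tonelli_F (m2 := m) (fun z => K z.1 z.2)).
Qed.

Lemma nnm_section (K : T1 -> T2 -> \bar R) x : nnm (fun z : T1 * T2 => K z.1 z.2) -> nnm (K x).
Proof.
move=> [mK K0]; split => [|y]; last exact: (K0 (x, y)).
by apply: (measurableT_comp (g := fun y => (x, y)) mK); exact: measurable_fun_pair.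
Qed.

Lemma nnm_integral_in (m : {sigma_finite_measure set T2 -> \bar R}) (D : set T2)
    (K : T1 -> T2 -> \bar R) : measurable D ->
  nnm (fun z : T1 * T2 => K z.1 z.2) -> nnm (fun x => \int[m]_(y in D) K x y).
Proof.
move=> mD [mK K0].
rewrite (_ : (fun x => _) = fun x => \int[m]_y (K x y * (\1_D y)%:E)); last first.
  by apply/funext => x; rewrite integral_mul_indic.
apply: (nnm_integral m (K := fun x y => K x y * (\1_D y)%:E)).
split; last by move=> z; rewrite mule_ge0// lee_fin.
apply: emeasurable_funM => //; apply/measurable_EFinP.
exact: (measurableT_comp (measurable_indic mD)).
Qed.

Lemma tonelli_in (m1 : {sigma_finite_measure set T1 -> \bar R})
    (m2 : {sigma_finite_measure set T2 -> \bar R}) (D : set T2) (K : T1 -> T2 -> \bar R) :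
  measurable D -> nnm (fun z : T1 * T2 => K z.1 z.2) ->
  \int[m1]_x \int[m2]_(y in D) K x y = \int[m2]_(y in D) \int[m1]_x K x y.
Proof.
move=> mD nK; have [mK K0] := nK.
have mI : measurable_fun [set: T1 * T2] (fun z => (\1_D z.2)%:E : \bar R).
  by apply/measurable_EFinP; apply: (measurableT_comp (measurable_indic mD)).
rewrite [RHS]integral_mul_indic.
transitivity (\int[m2]_y \int[m1]_x (K x y * (\1_D y)%:E)); last first.
  apply: eq_integral => y _; rewrite ge0_integralZr//.
  - by apply: (measurableT_comp (g := fun x => (x, y)) mK); exact: measurable_fun_pair.
  - by move=> x _; exact: (K0 (x, y)).
rewrite -(tonelli m1 m2 (f := fun x y => K x y * (\1_D y)%:E)).
  by apply: eq_integral => x _; rewrite integral_mul_indic.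
by split; [exact: emeasurable_funM|move=> z; rewrite mule_ge0// lee_fin].
Qed.

End iterated_integrals.

Lemma nnm_integral_itv (R : realType) (K : R -> R -> \bar R) :
  nnm (fun z : R * R => K z.1 z.2) ->
  nnm (fun s : R => \int[lebesgue_measure]_(v in `[0%R, s]) K s v)%E.
Proof.
move=> [mK K0].
rewrite (_ : (fun s : R => _) = fun s => \int[lebesgue_measure]_v (K s v * (\1_`[0%R, s] v)%:E))%E; last first.
  by apply/funext => s; rewrite integral_mul_indic.
apply: (nnm_integral lebesgue_measure (K := fun s v => K s v * (\1_`[0%R, s] v)%:E)%E).
split; last by move=> z; rewrite mule_ge0// lee_fin.
by apply: emeasurable_funM => //; exact: measurable_indic_itv0.
Qed.

Lemma integral_reflect_itv (R : realType) (t : R) (h : R -> \bar R) : nnm h ->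
  (\int[lebesgue_measure]_(u in `[0%R, t]) h (t - u)%R =
   \int[lebesgue_measure]_(u in `[0%R, t]) h u)%E.
Proof.
move=> [mh h0]; rewrite integral_mul_indic [RHS]integral_mul_indic.
rewrite (@integral_reflect _ t (fun u => h u * (\1_`[0%R, t] u)%:E)%E); last first.
  split; last by move=> u; rewrite mule_ge0// lee_fin.
  by apply: emeasurable_funM => //; apply/measurable_EFinP; exact: measurable_indic.
apply: eq_integral => u _; rewrite (_ : \1_`[0%R, t] (t - u) = \1_`[0%R, t] u :> R)//.
by rewrite !indicE !mem_setE !in_itv/= subr_ge0 gerBl andbC.
Qed.

Section discrete_operators.
Context (R : realType) (S : Type).
Local Open Scope ereal_scope.

(** The shape shared by [age_op] and [arrival_op]: at each state a finite nonnegative combination of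
    values, which commutes with series and integrals. *)
Definition discrete_op (Op : (S -> \bar R) -> S -> \bar R) : Prop :=
  forall s, exists (J : finType) (w : J -> R) (x : J -> S), (forall i, (0 <= w i)%R) /\
    forall f, Op f s = \sum_(i in J) (w i)%:E * f (x i).

Lemma discrete_op_series Op (F : nat -> S -> \bar R) s : discrete_op Op ->
  (forall n s, 0 <= F n s) ->
  Op (fun s => \sum_(0 <= n <oo) F n s) s = \sum_(0 <= n <oo) Op (F n) s.
Proof.
move=> /(_ s)[J [w [x [w0 E]]]] F0; rewrite E.
under eq_eseriesr do rewrite E.
rewrite nneseries_sum; last by move=> i n _; rewrite mule_ge0// lee_fin.
by apply: eq_bigr => i _; rewrite nneseriesZl.
Qed.

Lemma discrete_op_sum (I : Type) (r : seq I) Op (F : I -> S -> \bar R) s : discrete_op Op ->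
  (forall i s, 0 <= F i s) ->
  Op (fun s => \sum_(i <- r) F i s) s = \sum_(i <- r) Op (F i) s.
Proof.
move=> /(_ s)[J [w [x [w0 E]]]] F0; rewrite E.
under [RHS]eq_bigr do rewrite E.
rewrite exchange_big/=; apply: eq_bigr => i _.
by rewrite ge0_sume_distrr.
Qed.

Lemma discrete_op_integral d (T : measurableType d) (mu : {measure set T -> \bar R}) (D : set T)
    Op (h : T -> S -> \bar R) s : measurable D -> discrete_op Op -> (forall s, nnm (h^~ s)) ->
  Op (fun s => \int[mu]_(x in D) h x s) s = \int[mu]_(x in D) Op (h x) s.
Proof.
move=> mD /(_ s)[J [w [y [w0 E]]]] nh; rewrite E.
under [RHS]eq_integral do rewrite E.
rewrite ge0_integral_sum//; last 2 first.
- by move=> i; apply: measurable_funTS; exact: (nnmZ _ (nh (y i))).1.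
- by move=> i x _; rewrite mule_ge0 ?lee_fin//; exact: (nh (y i)).2.
apply: eq_bigr => i _; rewrite ge0_integralZl_EFin//.
- by move=> x _; exact: (nh (y i)).2.
- by apply: measurable_funTS; exact: (nh (y i)).1.
Qed.

End discrete_operators.

(** * A single-arrival criterion for stationarity *)

Section balance.
Context (R : realType) (C M : nat) (I : 'I_M -> customer_class R).
Variable pol : policy R M.
Hypothesis pol_adm : admissible I pol.
Hypothesis M0 : (0 < M)%N.
Notation st := (state R M).
Local Open Scope ereal_scope.
Implicit Types (f g : st -> \bar R) (s : st) (t u : R).
Local Notation L := (total_rate I).
Local Notation mu := (@lebesgue_measure R).
Local Notation evolve := (evolve C I pol).
Local Notation semigroup := (semigroup C I pol).
Local Notation arrival := (arrival_op C I pol).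

Lemma total_rate_gt0 : (0 < L)%R.
Proof.
rewrite /total_rate (bigD1 (Ordinal M0))//= ltr_pwDl ?cl_rate_gt0//.
by apply: sumr_ge0 => j _; rewrite ltW ?cl_rate_gt0.
Qed.

Lemma discrete_arrival_op : discrete_op arrival.
Proof.
move=> s; exists ('I_M * bool)%type.
exists (fun i : 'I_M * bool => let a := (pol s i.1 * survival (cl_serv (I i.1)) 0)%R in
  if (in_service s < C)%N then (if i.2 then a else cl_rate (I i.1) - a)%R
  else if i.2 then 0%R else cl_rate (I i.1)).
exists (fun i : 'I_M * bool => if i.2 then add_customer i.1 s else s); split.
  move=> [j b] /=; have /andP[a0 a1] := entry_rate_itv pol_adm s j.
  by have := ltW (cl_rate_gt0 (I j)); case: ifP => _; case: b => //; rewrite subr_ge0.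
move=> f; rewrite -(pair_bigA _ (fun j b => (let a := (pol s j * survival (cl_serv (I j)) 0)%R in
  if (in_service s < C)%N then (if b then a else cl_rate (I j) - a)%R
  else if b then 0%R else cl_rate (I j))%:E * f (if b then add_customer j s else s)))/=.
apply: eq_bigr => j _; rewrite big_bool/=.
by case: ifP => _ //; rewrite mul0e add0e.
Qed.

Lemma discrete_age_op u : (0 <= u)%R -> discrete_op (age_op C I u).
Proof.
move=> u0 s; exists {set 'I_M * 'I_C}.
exists (fun K => if K \in powerset (present C s) then stay_weight I s u K else 0%R).
exists (fun K => aged s K u); split => [K|f]; first by case: ifP => // _; exact: stay_weight_ge0.
rewrite age_opE big_mkcond; apply: eq_bigr => K _.
by case: ifP => // _; rewrite mul0e.
Qed.

(** The backward equation: condition on the first arrival, at time [u], and move the sum over the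
    number of later arrivals inside. *)
Lemma semigroupS t f s : (0 <= t)%R -> nnm f ->
  semigroup t f s = evolve 0 t f s +
    \int[mu]_(u in `[0%R, t]) evolve 0 u (arrival (semigroup (t - u)%R f)) s.
Proof.
move=> t0 nf; rewrite /semigroup (nneseries_split 0 1)//; last first.
  by move=> n _; exact: (nnm_evolve C pol_adm n t0 nf).2.
rewrite add0n big_nat1; congr (_ + _).
transitivity (\sum_(0 <= n <oo) evolve n.+1 t f s).
  rewrite -nneseries_addn; last by move=> n; exact: (nnm_evolve C pol_adm n t0 nf).2.
  by apply: eq_eseriesr => n _; rewrite addn1.
transitivity (\sum_(0 <= n <oo)
    \int[mu]_(u in `[0%R, t]) evolve_integrand C I pol n f ((t, s), u)).
  by apply: eq_eseriesr => n _; rewrite evolveS_itv.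
rewrite -integral_nneseries//; last 2 first.
- by move=> n; apply: measurable_funTS; exact: (nnm_evolve_integrand C pol_adm n t s nf).1.
- by move=> n x _; exact: (nnm_evolve_integrand C pol_adm n t s nf).2.
apply: eq_integral => u; rewrite inE/= in_itv/= => /andP[u0 ut].
have tu0 : (0 <= t - u)%R by rewrite subr_ge0.
have n0 n := nnm_evolve C pol_adm n tu0 nf.
rewrite /evolve_integrand/= (max_l t0) (max_l u0) (max_l tu0).
rewrite nneseriesZl; last first.
  by move=> n _; apply: age_op_ge0 => // s'; apply: arrival_op_ge0 => // s''; exact: (n0 n).2.
rewrite -(discrete_op_series s (discrete_age_op u0) (F := fun n => arrival (evolve n (t - u)%R f))); last first.
  by move=> n s'; apply: arrival_op_ge0 => // s''; exact: (n0 n).2.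
congr (_ * age_op _ _ _ _ _); apply/funext => s'.
by rewrite -(discrete_op_series s' discrete_arrival_op)// => n s''; exact: (n0 n).2.
Qed.

Lemma integral_expR t : (0 <= t)%R ->
  \int[mu]_(u in `[0%R, t]) (expR (- L * u) * L)%:E = (1 - expR (- L * t))%:E.
Proof.
rewrite le_eqVlt => /predU1P[<-|t0].
  by rewrite set_itv1 integral_set1 mulr0 expR0 subrr.
have := exponential_prob_itv0c L t0; rewrite EFinB => <-.
rewrite /exponential_prob; apply: eq_integral => u; rewrite inE/= in_itv/= => /andP[u0 _].
by rewrite exponential_pdfE//= mulrC.
Qed.

(** Induction on the number of arrivals allowed: the mass [expR (- L * t)] without arrival and the
    density of the first arrival on [[0, t]] add up to 1. *)
Lemma semigroup_le t f (c : R) s : (0 <= t)%R -> (0 <= c)%R -> nnm f ->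
  (forall s, f s <= c%:E) -> semigroup t f s <= c%:E.
Proof.
move=> t0 c0 nf fc; apply: lime_le.
  by apply: is_cvg_nneseries => n _ _; exact: (nnm_evolve C pol_adm n t0 nf).2.
apply: nearW => N; elim: N t t0 s => [|N IH] t t0 s; first by rewrite big_geq.
rewrite big_nat_recl//.
apply: (@le_trans _ _ ((expR (- L * t) * c)%:E + (c * (1 - expR (- L * t)))%:E)); last first.
  by rewrite -EFinD lee_fin; lra.
apply: leeD; first by rewrite -(evolve0_cst C I pol t c s) /=; apply: lee_wpmul2l;
  [rewrite lee_fin expR_ge0|exact: le_age_op].
rewrite EFinM -integral_expR// -ge0_integralZl_EFin//; last 2 first.
- by move=> u _; rewrite lee_fin mulr_ge0 ?expR_ge0// ltW// total_rate_gt0.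
- apply/measurable_EFinP; apply: measurable_funTS; apply: measurable_funM => //.
  by apply: measurableT_comp => //; exact: measurable_funM.
rewrite (eq_bigr (fun n => \int[mu]_(u in `[0%R, t]) evolve_integrand C I pol n f ((t, s), u))); last first.
  by move=> n _; rewrite evolveS_itv.
rewrite -ge0_integral_sum//; last 2 first.
- by move=> n; apply: measurable_funTS; exact: (nnm_evolve_integrand C pol_adm n t s nf).1.
- by move=> n x _; exact: (nnm_evolve_integrand C pol_adm n t s nf).2.
apply: ge0_le_integral => //.
- by move=> u _; apply: sume_ge0 => n _; exact: (nnm_evolve_integrand C pol_adm n t s nf).2.
- by apply: measurable_funTS; exact: (nnm_sum _ (fun n _ => nnm_evolve_integrand C pol_adm n t s nf)).1.
- apply: measurable_funTS; apply: emeasurable_funM => //.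
  apply/measurable_EFinP; apply: measurable_funM => //.
  by apply: measurableT_comp => //; exact: measurable_funM.
move=> u /=; rewrite in_itv/= => /andP[u0 ut].
have tu0 : (0 <= t - u)%R by rewrite subr_ge0.
have nE n := nnm_evolve C pol_adm n tu0 nf.
rewrite (_ : \sum_(0 <= k < N) _ = (expR (- L * u))%:E *
    age_op C I u (arrival (fun s => \sum_(0 <= k < N) evolve k (t - u)%R f s)) s); last first.
  rewrite (_ : arrival _ = fun s => \sum_(0 <= k < N) arrival (evolve k (t - u)%R f) s); last first.
    apply/funext => s'; apply: (discrete_op_sum _ _ discrete_arrival_op) => n s''.
    exact: (nE n).2.
  have J0 k s' : 0 <= arrival (evolve k (t - u)%R f) s'.
    by apply: arrival_op_ge0 => // s''; exact: (nE k).2.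
  rewrite (discrete_op_sum _ _ (discrete_age_op u0))// ge0_sume_distrr; last first.
    by move=> k _; exact: age_op_ge0.
  apply: eq_bigr => k _; rewrite /evolve_integrand/=.
  by rewrite (max_l t0) (max_l u0) (max_l tu0).
rewrite EFinM muleCA; apply: lee_wpmul2l; first by rewrite lee_fin expR_ge0.
rewrite -EFinM mulrC -(age_op_cst C I u (L * c) s); apply: le_age_op => // s'.
rewrite -(arrival_op_cst C I pol c s'); apply: le_arrival_op => // s''.
exact: IH.
Qed.

Lemma measurable_semigroup f : nnm f ->
  measurable_fun [set: R * st] (fun z => semigroup (Num.max z.1 0)%R f z.2).
Proof.
move=> nf; apply: (nnm_series (F := fun n (z : R * st) => evolve n (Num.max z.1 0)%R f z.2) _).1 => n.
split; first exact: measurable_evolve.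
by move=> z; apply: (nnm_evolve C pol_adm n _ nf).2; rewrite le_max lexx orbT.
Qed.

Lemma measurable_evolve0 d (T : measurableType d) (sigma : T -> st) (u : T -> R)
    (f : T -> st -> \bar R) :
  measurable_fun [set: T] sigma -> measurable_fun [set: T] u ->
  measurable_fun [set: T * st] (fun z => f z.1 z.2) ->
  measurable_fun [set: T] (fun x => evolve 0 (u x) (f x) (sigma x)).
Proof.
move=> ms mu mf; apply: emeasurable_funM; last exact: measurable_age_op.
by apply/measurable_EFinP; apply: measurableT_comp => //; exact: measurable_funM.
Qed.

Variable Pi : probability st R.
(** Invariance decomposed at the last arrival before [t], [v] being the time elapsed since it. Only
    one arrival appears, so the identity can be checked on an explicit law. *)
Hypothesis balanced : forall t f (c : R), (0 <= t)%R -> nnm f -> (forall s, f s <= c%:E) ->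
  \int[Pi]_s f s = \int[Pi]_s evolve 0 t f s +
    \int[mu]_(v in `[0%R, t]) \int[Pi]_s arrival (evolve 0 v f) s.

Section fixed_function.
Variables (f : st -> \bar R) (c : R).
Hypotheses (nf : nnm f) (fc : forall s, f s <= c%:E) (c0 : (0 <= c)%R).

Let G (r : R) : st -> \bar R := semigroup (Num.max r 0)%R f.
Let JG r : st -> \bar R := arrival (G r).

Let nG r : nnm (G r).
Proof. by apply: nnm_semigroup => //; rewrite le_max lexx orbT. Qed.

Let JG_ge0 r s : 0 <= JG r s.
Proof. by apply: arrival_op_ge0 => // s'; exact: (nG r).2. Qed.

Let JG_le r s : JG r s <= (L * c)%:E.
Proof.
rewrite -(arrival_op_cst C I pol c s); apply: le_arrival_op => // s'.
by apply: semigroup_le => //; rewrite le_max lexx orbT.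
Qed.

Let mJG d (T : measurableType d) (r : T -> R) (sigma : T -> st) :
  measurable_fun [set: T] r -> measurable_fun [set: T] sigma ->
  measurable_fun [set: T] (fun x => JG (r x) (sigma x)).
Proof.
move=> mr ms; apply: (measurable_arrival_op (f := fun x => G (r x)) C pol_adm ms).
apply: (measurableT_comp (g := fun z : T * st => (r z.1, z.2)) (measurable_semigroup nf)).
apply: measurable_fun_pair => //; exact: (measurableT_comp mr).
Qed.

Let nJG r : nnm (JG r).
Proof. by split; [apply: (mJG (r := fun=> r) (sigma := id))|exact: JG_ge0]. Qed.

Let TJG (u r : R) : st -> \bar R := evolve 0 (Num.max u 0)%R (JG r).

Let mTJG d (T : measurableType d) (u r : T -> R) (sigma : T -> st) :
  measurable_fun [set: T] u -> measurable_fun [set: T] r -> measurable_fun [set: T] sigma ->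
  measurable_fun [set: T] (fun x => TJG (u x) (r x) (sigma x)).
Proof.
move=> mu' mr ms; apply: (measurable_evolve0 (f := fun x => JG (r x))) => //.
  exact: measurable_maxr.
by apply: mJG => //; exact: (measurableT_comp mr).
Qed.

Let TJG_ge0 u r s : 0 <= TJG u r s.
Proof. by apply: (nnm_evolve C pol_adm 0 _ (nJG r)).2; rewrite le_max lexx orbT. Qed.

Let F (v r : R) : \bar R := \int[Pi]_s arrival (TJG v r) s.

Let mJTJG : measurable_fun [set: (R * R) * st] (fun z => arrival (TJG z.1.1 z.1.2) z.2).
Proof.
apply: (measurable_arrival_op (f := fun z : (R * R) * st => TJG z.1.1 z.1.2) C pol_adm) => //.
apply: (mTJG (u := fun z : ((R * R) * st) * st => z.1.1.1) (r := fun z => z.1.1.2)) => //.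
- exact: (measurableT_comp _ (measurableT_comp _ (@measurable_fst _ _ _ _))).
- exact: (measurableT_comp _ (measurableT_comp _ (@measurable_fst _ _ _ _))).
Qed.

Let JTJG_ge0 v r s : 0 <= arrival (TJG v r) s.
Proof. by apply: arrival_op_ge0 => // s'; exact: TJG_ge0. Qed.

Let nF : nnm (fun z : R * R => F z.1 z.2).
Proof.
split; last by move=> z; apply: integral_ge0.
apply: (measurable_fun_fubini_tonelli_F (m2 := Pi) (fun z => arrival (TJG z.1.1 z.1.2) z.2)) => //.
Qed.

Let stepE y x s : (0 <= x <= y)%R ->
  evolve 0 x (arrival (semigroup (y - x)%R f)) s = TJG x (y - x)%R s.
Proof. by move=> /andP[x0 xy]; rewrite /TJG /JG /G (max_l x0) max_l// subr_ge0. Qed.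

Let JGE r x : (0 <= r)%R -> JG r x = arrival (evolve 0 r f) x +
  \int[mu]_(v in `[0%R, r]) arrival (TJG v (r - v)%R) x.
Proof.
move=> r0; have nK : nnm (fun z : st * R => TJG z.2 (r - z.2)%R z.1).
  split; last by move=> z; exact: TJG_ge0.
  by apply: (mTJG (u := snd) (r := fun z => r - z.2)%R) => //; exact: measurable_funB.
rewrite -(discrete_op_integral mu x (measurable_itv `[0%R, r]) discrete_arrival_op (h := fun v => TJG v (r - v)%R)); last first.
  by move=> y; exact: (nnm_section (K := fun (y : st) v => TJG v (r - v)%R y) y nK).
rewrite -(arrival_opD C I pol); last 2 first.
- exact: (nnm_evolve C pol_adm 0 r0 nf).2.
- by move=> y; apply: integral_ge0.
rewrite /JG /G (max_l r0); apply: (congr1 (fun h => arrival h x)); apply/funext => y.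
rewrite (semigroupS y r0 nf); apply: (congr1 (fun z => _ + z)).
by apply: eq_integral => v; rewrite inE/= in_itv/= => vs; exact: stepE.
Qed.

(** Compute the integral over [u] of the mean of [JG (t - u)] in two ways. Unfolding the semigroup
    at its first arrival gives the last-arrival term of [f] plus a double integral; applying
    [balanced] to [JG (t - u)] gives the first-arrival term of the semigroup plus the same double
    integral, by [integral_triangle]. It is finite because [f] is bounded, so it cancels. *)
Lemma balanced_semigroup t : (0 <= t)%R -> \int[Pi]_s semigroup t f s = \int[Pi]_s f s.
Proof.
move=> t0.
pose A u := \int[Pi]_s TJG u (t - u)%R s.
have nT : nnm (fun z : st * R => TJG z.2 (t - z.2)%R z.1).
  split; last by move=> z; exact: TJG_ge0.
  by apply: (mTJG (u := snd) (r := fun z => t - z.2)%R) => //; exact: measurable_funB.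
have nFt : nnm (fun z : R * R => F z.2 (t - z.1)%R).
  split; last by move=> z; exact: (nF.2 (z.2, (t - z.1)%R)).
  apply: (measurableT_comp (g := fun z : R * R => (z.2, (t - z.1)%R)) nF.1).
  by apply: measurable_fun_pair => //; exact: measurable_funB.
have nFs : nnm (fun z : R * R => F z.2 (z.1 - z.2)%R).
  split; last by move=> z; exact: (nF.2 (z.2, (z.1 - z.2)%R)).
  apply: (measurableT_comp (g := fun z : R * R => (z.2, (z.1 - z.2)%R)) nF.1).
  by apply: measurable_fun_pair => //; exact: measurable_funB.
have nPJG : nnm (fun r => \int[Pi]_s JG r s).
  apply: (nnm_integral Pi (K := JG)); split; last by move=> z; exact: JG_ge0.
  exact: (mJG (r := fst) (sigma := snd)).
have phiE : \int[Pi]_s semigroup t f s =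
    \int[Pi]_s evolve 0 t f s + \int[mu]_(u in `[0%R, t]) A u.
  rewrite -(tonelli_in Pi mu (K := fun s u => TJG u (t - u)%R s))//.
  rewrite -ge0_integralD//; last 4 first.
  - by move=> s _; exact: (nnm_evolve C pol_adm 0 t0 nf).2.
  - exact: (nnm_evolve C pol_adm 0 t0 nf).1.
  - by move=> s _; apply: integral_ge0.
  - exact: (nnm_integral_in mu (measurable_itv `[0%R, t]) (K := fun s u => TJG u (t - u)%R s) nT).1.
  apply: eq_integral => s _; rewrite (semigroupS s t0 nf); apply: (congr1 (fun z => _ + z)).
  by apply: eq_integral => u; rewrite inE/= in_itv/= => ut; exact: stepE.
have GE : \int[mu]_(u in `[0%R, t]) \int[Pi]_s JG (t - u)%R s =
   \int[mu]_(s in `[0%R, t]) \int[Pi]_x arrival (evolve 0 s f) x +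
   \int[mu]_(u in `[0%R, t]) \int[mu]_(v in `[0%R, u]) F v (t - u)%R.
  rewrite -integral_triangle//.
  rewrite (integral_reflect_itv t nPJG).
  have nJT0 : measurable_fun [set: R] (fun s : R => \int[Pi]_x arrival (evolve 0 (Num.max s 0)%R f) x).
    apply: (nnm_integral Pi (K := fun (s : R) x => arrival (evolve 0 (Num.max s 0)%R f) x) _).1.
    split; last first.
      move=> z; apply: arrival_op_ge0 => // x; apply: (nnm_evolve C pol_adm 0 _ nf).2.
      by rewrite le_max lexx orbT.
    apply: (measurable_arrival_op (f := fun z : R * st => evolve 0 (Num.max z.1 0)%R f) C pol_adm) => //.
    apply: (measurableT_comp (g := fun z : (R * st) * st => (z.1.1, z.2)) (measurable_evolve C pol_adm 0 nf)).
    by apply: measurable_fun_pair => //; exact: (measurableT_comp _ (@measurable_fst _ _ _ _)).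
  transitivity (\int[mu]_(s in `[0%R, t]) (\int[Pi]_x arrival (evolve 0 (Num.max s 0)%R f) x +
      \int[mu]_(v in `[0%R, s]) F v (s - v)%R)).
    apply: eq_integral => s; rewrite inE/= in_itv/= => /andP[s0 st'].
    rewrite (max_l s0) /F -(tonelli_in Pi mu (K := fun x v => arrival (TJG v (s - v)%R) x))//; last first.
      split; last by move=> z; exact: JTJG_ge0.
      apply: (measurableT_comp (g := fun z : st * R => ((z.2, (s - z.2)%R), z.1)) mJTJG).
      apply: measurable_fun_pair => //; apply: measurable_fun_pair => //; exact: measurable_funB.
    have nA : nnm (arrival (evolve 0 s f)).
      split; last by move=> x; apply: arrival_op_ge0 => // y; exact: (nnm_evolve C pol_adm 0 s0 nf).2.
      apply: (measurable_arrival_op (f := fun _ : st => evolve 0 s f) C pol_adm) => //.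
      exact: (measurableT_comp (nnm_evolve C pol_adm 0 s0 nf).1).
    have nJK : nnm (fun z : st * R => arrival (TJG z.2 (s - z.2)%R) z.1).
      split; last by move=> z; exact: JTJG_ge0.
      apply: (measurableT_comp (g := fun z : st * R => ((z.2, (s - z.2)%R), z.1)) mJTJG).
      apply: measurable_fun_pair => //; apply: measurable_fun_pair => //; exact: measurable_funB.
    rewrite -ge0_integralD//; last 4 first.
    - by move=> x _; exact: nA.2.
    - exact: nA.1.
    - by move=> x _; apply: integral_ge0.
    - exact: (nnm_integral_in mu (measurable_itv `[0%R, s]) (K := fun x v => arrival (TJG v (s - v)%R) x) nJK).1.
    by apply: eq_integral => x _; rewrite JGE.
  rewrite ge0_integralD; last 5 first.
  - exact: measurable_itv.
  - by move=> s _; apply: integral_ge0 => x _; apply: arrival_op_ge0 => // y;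
      apply: (nnm_evolve C pol_adm 0 _ nf).2; rewrite le_max lexx orbT.
  - exact: measurable_funTS.
  - by move=> s _; apply: integral_ge0 => v _; apply: integral_ge0.
  - have [h _] := nnm_integral_itv (K := fun r v => F v (r - v)%R) nFs.
    by apply: measurable_funTS; exact: h.
  apply: (congr1 (fun z => z + _)); apply: eq_integral => s; rewrite inE/= in_itv/= => /andP[s0 _].
  by rewrite max_l.
have GE' : \int[mu]_(u in `[0%R, t]) \int[Pi]_s JG (t - u)%R s =
   \int[mu]_(u in `[0%R, t]) A u +
   \int[mu]_(u in `[0%R, t]) \int[mu]_(v in `[0%R, u]) F v (t - u)%R.
  have nA := nnm_integral Pi (K := fun u s => TJG u (t - u)%R s).
  rewrite -ge0_integralD//; last 4 first.
  - by move=> u _; apply: integral_ge0.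
  - apply: measurable_funTS; apply: (nA _).1; split; last by move=> z; exact: TJG_ge0.
    by apply: (mTJG (u := fst) (r := fun z => t - z.1)%R) => //; exact: measurable_funB.
  - by move=> u _; apply: integral_ge0 => v _; apply: integral_ge0.
  - have [h _] := nnm_integral_itv (K := fun u v => F v (t - u)%R) nFt.
    by apply: measurable_funTS; exact: h.
  apply: eq_integral => u; rewrite inE/= in_itv/= => /andP[u0 ut].
  rewrite (balanced u0 (nJG _) (JG_le _)) /A /TJG (max_l u0).
  apply: (congr1 (fun z => _ + z)).
  apply: eq_integral => v; rewrite inE/= in_itv/= => /andP[v0 _].
  by rewrite /F /TJG (max_l v0).
have Gfin : \int[mu]_(u in `[0%R, t]) \int[Pi]_s JG (t - u)%R s < +oo.
  apply: (@le_lt_trans _ _ (\int[mu]_(u in `[0%R, t]) (L * c)%:E)).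
    apply: le_integral_ge0 => u _; first by apply: integral_ge0.
    rewrite -(integral_probability_cst Pi (L * c)%:E).
    by apply: le_integral_ge0 => s _.
  by rewrite integral_cst//= lebesgue_measure_itv/= lte_fin; case: ifP; rewrite ?mule0 -?EFinM ?ltry.
rewrite phiE (balanced t0 nf fc); congr (_ + _).
set B := \int[mu]_(u in `[0%R, t]) \int[mu]_(v in `[0%R, u]) F v (t - u)%R in GE GE'.
have Bfin : B \is a fin_num.
  rewrite ge0_fin_numE; last by apply: integral_ge0 => u _; apply: integral_ge0 => v _; apply: integral_ge0.
  apply: le_lt_trans Gfin; rewrite GE' leeDr//.
  by apply: integral_ge0 => u _; apply: integral_ge0.
by rewrite -[LHS](addeK _ Bfin) -GE' GE addeK.
Qed.
End fixed_function.

Lemma balanced_stationary : Pi (@state_space R C M) = 1 -> stationary C I pol Pi.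
Proof.
move=> PS; split => // t B t0 mB.
rewrite (eq_integral (semigroup t (fun s => (\1_B s)%:E))); last by move=> s _; rewrite transitionE.
rewrite (@balanced_semigroup _ 1%R)//; last 2 first.
- exact: nnm_indic.
- by move=> s; rewrite lee_fin indicE; case: (s \in B).
by rewrite integral_indic// setIT.
Qed.

End balance.

(** * Measures as functionals *)

Section sigma_functionals.
Context d (T : measurableType d) (R : realType).
Local Open Scope ereal_scope.
Implicit Types (Phi : (T -> \bar R) -> \bar R) (f g : T -> \bar R).

(** Integration against a measure, axiomatised as a functional on nonnegative measurable functions.
    Laws are assembled by composing functionals, and [functional_probability] converts the result
    into a measure. *)
Record sigma_functional Phi : Prop := SigmaFunctional {
  sf_ge0 : forall f, nnm f -> 0 <= Phi f;
  sf_scale : forall (c : R) f, (0 <= c)%R -> nnm f -> Phi (fun x => c%:E * f x) = c%:E * Phi f;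
  sf_le : forall f g, nnm f -> nnm g -> (forall x, f x <= g x) -> Phi f <= Phi g;
  sf_series : forall F : nat -> T -> \bar R, (forall n, nnm (F n)) ->
    Phi (fun x => \sum_(0 <= n <oo) F n x) = \sum_(0 <= n <oo) Phi (F n) }.

Lemma nnm0 : nnm (fun _ : T => 0 : \bar R).
Proof. by split => //; exact: measurable_cst. Qed.

Lemma sf0 Phi : sigma_functional Phi -> Phi (fun=> 0) = 0.
Proof.
move=> sf; transitivity (0%R%:E * Phi (fun=> 0)); last exact: mul0e.
rewrite -(sf_scale sf (lexx 0%R) nnm0); congr Phi.
by apply/funext => x; rewrite mule0.
Qed.

Lemma sf_add Phi f g : sigma_functional Phi -> nnm f -> nnm g ->
  Phi (fun x => f x + g x) = Phi f + Phi g.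
Proof.
move=> sf nf ng; pose F (n : nat) := if n is 0 then f else if n is 1 then g else fun=> 0.
have nF n : nnm (F n) by case: n => [|[|n]] //=; exact: nnm0.
have series2 (a : nat -> \bar R) : (forall n, 0 <= a n) -> (forall n, a n.+2 = 0) ->
    \sum_(0 <= n <oo) a n = a 0%N + a 1%N.
  move=> a0 a2; rewrite (nneseries_split 0 2)// add0n eseries0 ?adde0.
    by rewrite big_nat_recl// big_nat1.
  by move=> [|[|n]].
rewrite -[Phi f + _](series2 (fun n => Phi (F n))).
- rewrite -(sf_series sf nF); congr Phi; apply/funext => x.
  by rewrite (series2 (F^~ x))// => n; exact: (nF n).2.
- by move=> n; exact: sf_ge0.
- by move=> n; exact: sf0.
Qed.

Lemma functional_probability Phi : sigma_functional Phi -> Phi (fun=> 1) = 1 ->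
  exists P : probability T R, (forall A, measurable A -> P A = Phi (fun x => (\1_A x)%:E)) /\
    forall f (c : R), nnm f -> (forall x, f x <= c%:E) -> Phi f = \int[P]_x f x.
Proof.
move=> sf Phi1.
(* A measure is a function of all sets, hence the arbitrary value 0 on the nonmeasurable ones. *)
pose m (A : set T) : \bar R := if pselect (measurable A) then Phi (fun x => (\1_A x)%:E) else 0.
have mE A : measurable A -> m A = Phi (fun x => (\1_A x)%:E) by rewrite /m; case: pselect.
have m0 : m set0 = 0.
  by rewrite mE// -(sf0 sf); congr Phi; apply/funext => x; rewrite indic0.
have m_ge0 A : 0 <= m A.
  by rewrite /m; case: pselect => // mA; apply: (sf_ge0 sf); exact: nnm_indic.
have m_sigma : semi_sigma_additive m.
  move=> F mF tF mUF; rewrite mE// (_ : (fun x => _) = fun x => \sum_(0 <= n <oo) (\1_(F n) x)%:E); last first.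
    (* The indicator of a disjoint union is the series of the indicators, by sigma-additivity of the
       Dirac mass at [x]. *)
    by apply/funext => x; exact: (@measure_semi_bigcup _ _ _ (@dirac _ T x R) F mF tF mUF).
  rewrite (sf_series sf); last by move=> n; exact: nnm_indic.
  rewrite (_ : (fun n => _) = fun n => \sum_(0 <= i < n) Phi (fun x => (\1_(F i) x)%:E)); last first.
    by apply/funext => n; apply: eq_bigr => i _; rewrite mE.
  by apply: is_cvg_nneseries => n _ _; apply: (sf_ge0 sf); exact: nnm_indic.
pose mu_mixin := isMeasure.Build _ _ _ m m0 m_ge0 m_sigma.
pose mu_measure : {measure set T -> \bar R} := HB.pack m mu_mixin.
have mT : mu_measure setT = 1.
  by rewrite /= mE// -Phi1; congr Phi; apply/funext => x; rewrite indicT.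
pose P_mixin := Measure_isProbability.Build _ _ _ mu_measure mT.
pose P : probability T R := HB.pack m mu_mixin P_mixin.
exists P; split => [A mA|f c nf fc]; first exact: mE.
apply: (@functional_integral _ _ _ P Phi f c) => //.
- by move=> g h ng nh; exact: sf_add.
- by move=> a g a0 ng; exact: (sf_scale sf).
- exact: (sf_le sf).
- by move=> A mA; rewrite [RHS]mE.
Qed.

End sigma_functionals.

(** * The policy that rejects everyone *)

Section zero_policy.
Context (R : realType) (C M : nat) (I : 'I_M -> customer_class R).
Hypothesis M0 : (0 < M)%N.
Notation st := (state R M).
Local Open Scope ereal_scope.

Let e0 : st := [ffun=> [::]].
Let pol0 : policy R M := fun _ _ => 0%R.

Lemma age_op_empty u (f : st -> \bar R) (s : st) : (forall j, s j = [::]) ->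
  age_op C I u f s = f e0.
Proof.
move=> s0; have p0 : present C s = finset.set0.
  by apply/setP => k; rewrite !inE s0.
rewrite /age_op p0 powerset0 big_set1 big_set0 mul1e; congr f.
apply/ffunP => j; rewrite !ffunE; rewrite (@eq_filter _ _ pred0) ?filter_pred0// => k.
by rewrite !inE.
Qed.

Lemma zero_admissible : admissible I pol0.
Proof. by split => [j|s j]; [exact: measurable_cst|rewrite lexx ltW// cl_rate_gt0]. Qed.

Lemma zero_stationary : stationary C I pol0 \d_(e0 : st).
Proof.
have ss : state_space C e0.
  split; first by rewrite /in_service big1// => j _; rewrite ffunE.
  by move=> j; split; rewrite ?ffunE.
apply: (balanced_stationary zero_admissible M0); last first.
  rewrite /= diracE mem_set//.
move=> t f c t0 nf fc.
rewrite !integral_dirac//; last 2 first.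
- exact: (nnm_evolve C zero_admissible 0 t0 nf).1.
- exact: nf.1.
rewrite !diracT !mul1e.
have f_fin : f e0 = (fine (f e0))%:E.
  by rewrite fineK// ge0_fin_numE ?nf.2// (le_lt_trans (fc _))// ltry.
transitivity (evolve C I pol0 0 t f e0 + \int[lebesgue_measure]_(v in `[0%R, t])
    ((fine (f e0))%:E * (expR (- total_rate I * v) * total_rate I)%:E)); last first.
  apply: (congr1 (fun z => _ + z)); apply: eq_integral => v; rewrite inE/= in_itv/= => /andP[v0 _]; apply/esym.
  have nv := nnm_evolve C zero_admissible 0 v0 nf.
  rewrite integral_dirac//; last first.
    apply: (measurable_arrival_op (f := fun _ : st => evolve C I pol0 0 v f) C zero_admissible) => //.
    exact: (measurableT_comp nv.1).
  rewrite diracT mul1e.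
  transitivity (arrival_op C I pol0 (fun=> ((expR (- total_rate I * v)) * fine (f e0))%:E) e0).
    rewrite /arrival_op; apply: eq_bigr => j _.
    rewrite mul0r !mul0e !add0e subr0 /=.
    rewrite age_op_empty; last by move=> i; rewrite ffunE.
    by move: f_fin; set r := fine (f e0) => ->; rewrite -EFinM.
  rewrite arrival_op_cst -EFinM; congr EFin; ring.
have f0 : (0 <= fine (f e0))%R by rewrite fine_ge0// nf.2.
rewrite ge0_integralZl_EFin//; last 2 first.
- by move=> v _; rewrite lee_fin mulr_ge0 ?expR_ge0 ?total_rate_ge0.
- apply/measurable_EFinP; apply: measurable_funTS; apply: measurable_funM => //.
  by apply: measurableT_comp => //; exact: measurable_funM.
rewrite (integral_expR I t0) /= age_op_empty; last by move=> i; rewrite ffunE.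
by move: f_fin; set r := fine (f e0) => ->; rewrite -!EFinM -EFinD; congr EFin; ring.
Qed.

(** With the empty system as its stationary law, the zero policy shows that the supremum is not
    taken over an empty set. *)
Lemma dynamic_opt_ge0 : 0 <= dynamic_opt C I.
Proof.
apply: (@le_trans _ _ (dynamic_revenue C I pol0 \d_(e0 : st))).
  apply: sume_ge0 => i _; apply: sume_ge0 => x _; apply: integral_ge0 => s _.
  by rewrite lee_fin sumr_ge0// => j _; apply: revbar_ge0; rewrite lexx ltW// cl_rate_gt0.
apply: ereal_sup_ubound; exists pol0, \d_(e0 : st); split => //.
- exact: zero_admissible.
- exact: zero_stationary.
Qed.

End zero_policy.

Lemma integral_is_derive (R : realType) (F F' : R -> R) (c a b : R) : c < a -> a <= b ->
  (forall v, c < v -> is_derive v 1 F (F' v)) -> (forall v, c < v -> {for v, continuous F'}) ->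
  (\int[lebesgue_measure]_(v in `[a, b]) (F' v)%:E = (F b - F a)%:E)%E.
Proof.
move=> ca; rewrite le_eqVlt => /predU1P[<- _ _|ab dF cF].
  by rewrite set_itv1 integral_set1 subrr.
have cF0 v : c < v -> {for v, continuous F}.
  move=> cv; apply/differentiable_continuous/derivable1_diffP.
  by have [] := dF v cv.
rewrite (continuous_FTC2 ab (F := F)) ?EFinB//.
- apply: continuous_in_subspaceT => v; rewrite inE/= in_itv/= => /andP[av _].
  by apply: cF; exact: lt_le_trans av.
- split.
  + by move=> v; rewrite in_itv/= => /andP[av _]; have [] := dF v (lt_trans ca av).
  + exact/cvg_at_right_filter/cF0.
  + exact/cvg_at_left_filter/cF0/(lt_trans ca).
- move=> v; rewrite in_itv/= => /andP[av _]; rewrite derive1E.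
  by have [_ ->] := dF v (lt_trans ca av).
Qed.

Arguments evolve : simpl never.

Section sigma_operators.
Context d (T : measurableType d) (R : realType).
Local Open Scope ereal_scope.
Implicit Types (Phi : (T -> \bar R) -> \bar R) (f g : T -> \bar R).

(** The kernel version of [sigma_functional], closed under composition. *)
Definition sigma_op (Op : (T -> \bar R) -> T -> \bar R) : Prop :=
  (forall f, nnm f -> nnm (Op f)) /\ forall x, sigma_functional (fun f => Op f x).

Lemma sigma_functional_comp Phi Op : sigma_functional Phi -> sigma_op Op ->
  sigma_functional (fun f => Phi (Op f)).
Proof.
move=> sf [nOp sOp]; split => [f nf|c f c0 nf|f g nf ng fg|F nF].
- exact/(sf_ge0 sf)/nOp.
- rewrite -(sf_scale sf)//; last exact: nOp.
  by congr Phi; apply/funext => x; rewrite (sf_scale (sOp x)).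
- by apply: (sf_le sf); [exact: nOp|exact: nOp|move=> x; exact: (sf_le (sOp x))].
- rewrite -(sf_series sf); last by move=> n; exact: nOp.
  by congr Phi; apply/funext => x; rewrite (sf_series (sOp x)).
Qed.

Lemma sigma_op_comp Op1 Op2 : sigma_op Op1 -> sigma_op Op2 -> sigma_op (fun f => Op1 (Op2 f)).
Proof.
move=> [n1 s1] h2; split => [f nf|x]; first exact/n1/h2.1.
exact: (sigma_functional_comp (s1 x) h2).
Qed.

Lemma sigma_op_id : sigma_op id.
Proof.
split => // x; split => //; first by move=> f nf; exact: nf.2.
Qed.

Lemma sigma_op_iter Op n : sigma_op Op -> sigma_op (iter n Op).
Proof. by move=> h; elim: n => [|n IH]; [exact: sigma_op_id|exact: (sigma_op_comp h IH)]. Qed.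

Lemma sigma_op_scale (c : R) Op : (0 <= c)%R -> sigma_op Op -> sigma_op (fun f x => c%:E * Op f x).
Proof.
move=> c0 [nOp sOp]; split => [f nf|x]; first exact/nnmZ/nOp.
split => [f nf|a f a0 nf|f g nf ng fg|F nF].
- by rewrite mule_ge0 ?lee_fin//; exact: (nOp f nf).2.
- by rewrite (sf_scale (sOp x))// muleCA.
- by rewrite lee_wpmul2l ?lee_fin//; exact: (sf_le (sOp x)).
- by rewrite (sf_series (sOp x))// nneseriesZl// => n _; exact: (nOp _ (nF n)).2.
Qed.

Lemma sigma_functional_sum (Phi : nat -> (T -> \bar R) -> \bar R) (c : R) : (0 <= c)%R ->
  (forall n, sigma_functional (Phi n)) ->
  sigma_functional (fun f => c%:E * \sum_(0 <= n <oo) Phi n f).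
Proof.
move=> c0 sf; split => [f nf|a f a0 nf|f g nf ng fg|F nF].
- by rewrite mule_ge0 ?lee_fin//; apply: nneseries_ge0 => n _ _; exact: (sf_ge0 (sf n)).
- rewrite muleCA; congr (_ * _); rewrite -nneseriesZl; last by move=> n _; exact: (sf_ge0 (sf n)).
  by apply: eq_eseriesr => n _; rewrite (sf_scale (sf n)).
- rewrite lee_wpmul2l ?lee_fin//; apply: lee_nneseries => n _; last exact: (sf_le (sf n)).
  by move=> _; exact: (sf_ge0 (sf n)).
- rewrite nneseriesZl; last by move=> n _; apply: nneseries_ge0 => k _ _; exact: (sf_ge0 (sf k)).
  congr (_ * _); under eq_eseriesr do rewrite (sf_series (sf _) nF).
  by apply: nneseries_interchange => i j; exact: (sf_ge0 (sf i)).
Qed.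

End sigma_operators.

(** * Unit service times: the stationary law of the threshold policy *)

Section unit_service.
Context (R : realType) (K : nat) (I : 'I_1 -> customer_class R).
Notation st := (state R 1).
Local Notation C := K.+1.
Hypothesis unit_serv : forall A, cl_serv (I ord0) A = \d_(1 : R) A.
Local Open Scope ereal_scope.
Implicit Types (f g : st -> \bar R).
Local Notation L := (cl_rate (I ord0)).
Local Notation mu := (@lebesgue_measure R).

Lemma unit_survival j (t : R) : survival (cl_serv (I j)) t = ((t < 1)%R%:R : R).
Proof.
rewrite (ord1 j) /survival unit_serv diracE/=; congr (nat_of_bool _)%:R.
by rewrite mem_setE in_itv/= andbT.
Qed.

Lemma unit_stay_prob (s : st) (k : 'I_1 * 'I_C) (u : R) : (0 <= u)%R ->
  stay_prob I s k u = ((nth 0%R (s k.1) k.2 + u < 1)%R%:R : R).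
Proof.
move=> u0; rewrite /stay_prob /residual !unit_survival.
have [h|h] := ltP (nth 0%R (s k.1) k.2 + u)%R 1%R; last by rewrite mul0r.
by rewrite (_ : (_ < 1)%R = true) ?divr1//; lra.
Qed.

Definition age_by (u : R) (s : st) : st :=
  [ffun j => [seq (a + u)%R | a <- take C (s j) & (a + u < 1)%R]].

Lemma filter_iota_lt m n : [seq i <- iota 0 m | (i < n)%N] = iota 0 (minn m n).
Proof.
have [mn|nm] := leqP m n.
  by apply/all_filterP/allP => i; rewrite mem_iota => /andP[_]; rewrite add0n => /leq_trans; exact.
rewrite -{1}(subnKC (ltnW nm)) iotaD filter_cat (all_filterP _); last first.
  by apply/allP => i; rewrite mem_iota.
rewrite (eq_in_filter (a2 := pred0)) ?filter_pred0 ?cats0// => i.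
by rewrite mem_iota add0n => /andP[ni _]; rewrite ltnNge ni.
Qed.

Lemma take_nth (T : Type) (x0 : T) m (l : seq T) :
  take m l = [seq nth x0 l i | i <- iota 0 (minn m (size l))].
Proof.
rewrite map_nth_iota0 ?geq_minr//; have [mn//|nm] := leqP m (size l).
by rewrite take_size take_oversize// ltnW.
Qed.

(** Deterministic service leaves a single subset of nonzero weight, that of the customers whose age
    stays below 1. *)
Lemma age_op_unit u f (s : st) : (0 <= u)%R -> age_op C I u f s = f (age_by u s).
Proof.
move=> u0; pose k1 (k : 'I_1 * 'I_C) := (nth 0%R (s k.1) k.2 + u < 1)%R.
pose K0 := [set k in present C s | k1 k]%SET.
have K0p : K0 \in powerset (present C s).
  by rewrite powersetE; apply/fintype.subsetP => k; rewrite inE => /andP[].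
rewrite /age_op (bigD1 K0)//= [X in _ + X]big1 ?adde0; last first.
  move=> Q /andP[]; rewrite powersetE => /fintype.subsetP Qp QK0.
  suff [k kp kQ] : exists2 k, k \in present C s & (k \in Q) != k1 k.
    rewrite (bigD1 k)//= unit_stay_prob//.
    by move: kQ; rewrite /k1; case: ifP => _; case: ltP => // _ _; rewrite ?subrr mul0r mul0e.
  apply/exists_inP; apply: contraNT QK0; rewrite negb_exists_in => /forall_inP h.
  apply/eqP/setP => k; rewrite [RHS]inE; have [kp|kp] := boolP (k \in present C s).
    by have := h k kp; rewrite negbK => /eqP.
  by apply/negbTE; apply: contra kp; exact: Qp.
rewrite big1 ?mul1e; last first.
  by move=> k kp; rewrite unit_stay_prob// inE kp/= /k1; case: ltP => //; rewrite subr0.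
congr f; apply/ffunP => j; rewrite !ffunE (take_nth 0%R).
rewrite filter_map -map_comp -filter_iota_lt -val_enum_ord !filter_map -!map_comp.
rewrite -filter_predI.
apply: (congr1 (map (fun k : 'I_C => ((s j)`_k + u)%R))); apply: eq_filter => k.
by rewrite /= !inE/= andbC.
Qed.

Lemma age_by_age_by (u v : R) (s : st) : (0 <= u)%R -> (0 <= v)%R ->
  age_by v (age_by u s) = age_by (u + v) s.
Proof.
move=> u0 v0; apply/ffunP => j; rewrite !ffunE [take C (map _ _)]take_oversize; last first.
  by rewrite size_map size_filter (leq_trans (count_size _ _))// size_take_min geq_minl.
rewrite filter_map -map_comp -filter_predI.
have E : predI (preim (fun a : R => a + u)%R (fun a => a + v < 1)%R) (fun a => a + u < 1)%R =1
    (fun a => a + (u + v) < 1)%R.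
  by move=> a /=; rewrite -addrA; apply/andP/idP => [[]//|h]; split => //; lra.
by rewrite (eq_filter E); apply: eq_map => a /=; rewrite addrA.
Qed.

(** Ageing and arrivals under the threshold policy preserve these states, so functionals started
    from [one] see no others; at most [K] of the [K.+1] units are then busy. *)
Definition good (s : st) : Prop := (size (s ord0) <= K)%N /\ all (fun a => 0 <= a)%R (s ord0).

Lemma good_age_by u s : (0 <= u)%R -> good s -> good (age_by u s).
Proof.
move=> u0 [sK s0]; split; rewrite !ffunE.
  rewrite size_map size_filter (leq_trans (count_size _ _))//.
  by rewrite size_take_min (leq_trans (geq_minr _ _)).
apply/allP => _ /mapP[a + ->]; rewrite mem_filter => /andP[_ /mem_take al].
by rewrite addr_ge0//; exact: (allP s0).
Qed.

Lemma age_by_good u s : good s ->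
  age_by u s ord0 = [seq (a + u)%R | a <- s ord0 & (a + u < 1)%R].
Proof. by move=> [sK _]; rewrite ffunE take_oversize// ltnW. Qed.

Let emp : st := [ffun=> [::]].
Let one : st := [ffun=> [:: 0%R]].

Lemma age_by_ge1 u s : (1 <= u)%R -> good s -> age_by u s = emp.
Proof.
move=> u1 [_ s0]; apply/ffunP => j; rewrite !ffunE (ord1 j).
rewrite (_ : [seq a <- _ | _] = [::])//; apply/eqP; rewrite -[_ == _]negbK -has_filter; apply/hasPn => a.
by move=> /mem_take/(allP s0) a0; rewrite -leNgt; lra.
Qed.

Definition unit_policy : policy R 1 := fun s j => if (size (s ord0) < K)%N then cl_rate (I j) else 0%R.

Lemma unit_admissible : admissible I unit_policy.
Proof.
split => [j|s j]; last by rewrite /unit_policy; case: ifP => _; rewrite lexx ltW// cl_rate_gt0.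
apply: measurable_fun_ifT => //.
rewrite (_ : (fun s : st => _) = (fun n : nat => (n < K)%N) \o (fun s : st => size (s ord0)))//.
by apply: measurableT_comp => //; exact: measurable_size.
Qed.

Definition accept (s : st) : st := if (size (s ord0) < K)%N then add_customer ord0 s else s.

Local Notation J := (arrival_op C I unit_policy).

Lemma unit_arrival_op f s : J f s = L%:E * f (accept s).
Proof.
rewrite /arrival_op big_ord1 unit_survival ltr01 mulr1 /in_service big_ord1 /unit_policy /accept.
have [sK|sK] := ltnP (size (s ord0)) K; first by rewrite ltnW ?ltnS// subrr mul0e adde0.
by case: ifP => _ //; rewrite mul0e subr0 add0e.
Qed.

Lemma good_accept s : good s -> good (accept s).
Proof.
move=> [sK s0]; rewrite /accept; case: ifP => // sK'.
by split; rewrite ffunE eqxx ?size_rcons// all_rcons lexx.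
Qed.

Lemma total_rate1 : total_rate I = L.
Proof. by rewrite /total_rate big_ord1. Qed.

Local Notation T_ v := (evolve C I unit_policy 0 v).

Lemma unit_evolve0 v f s : (0 <= v)%R -> T_ v f s = (expR (- L * v))%:E * f (age_by v s).
Proof. by move=> v0; rewrite /evolve total_rate1 age_op_unit. Qed.

Definition clock (D : set R) f s : \bar R := \int[mu]_(v in D) T_ (Num.max v 0)%R f s.

Lemma nnm_evolve0_joint f : nnm f -> nnm (fun z : st * R => T_ (Num.max z.2 0)%R f z.1).
Proof.
move=> nf; split; last first.
  by move=> z; apply: (nnm_evolve C unit_admissible 0 _ nf).2; rewrite le_max lexx orbT.
apply: (measurable_evolve0 C I unit_policy (f := fun=> f)) => //.
  exact: measurable_maxr.
exact: (measurableT_comp nf.1).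
Qed.

Lemma sigma_op_clock D : measurable D -> sigma_op (clock D).
Proof.
move=> mD; have n1 f s : nnm f -> nnm (fun v : R => T_ (Num.max v 0)%R f s).
  move=> nf; have nj := nnm_evolve0_joint nf.
  have h := nnm_section (K := fun (s : st) (v : R) => T_ (Num.max v 0)%R f s) s nj.
  exact: h.
have v0 (v : R) : (0 <= Num.max v 0)%R by rewrite le_max lexx orbT.
have e0 (v : R) : 0 <= (expR (- L * v))%:E by rewrite lee_fin expR_ge0.
split => [f nf|s].
  have nj := nnm_evolve0_joint nf.
  exact: (nnm_integral_in mu mD (K := fun (s : st) (v : R) => T_ (Num.max v 0)%R f s) nj).
split => [f nf|c f c0 nf|f g nf ng fg|F nF].
- by apply: integral_ge0 => v _; exact: (n1 f s nf).2.
- rewrite -ge0_integralZl_EFin//.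
  + by apply: eq_integral => v _; rewrite !unit_evolve0// muleCA.
  + by move=> v _; exact: (n1 f s nf).2.
  + by apply: measurable_funTS; exact: (n1 f s nf).1.
- by apply: le_integral_ge0 => v _; [exact: (n1 f s nf).2|rewrite !unit_evolve0// lee_wpmul2l].
- rewrite /clock -integral_nneseries//.
  + apply: eq_integral => v _; rewrite unit_evolve0// -nneseriesZl; last by move=> n _; exact: (nF n).2.
    by apply: eq_eseriesr => n _; rewrite unit_evolve0.
  + by move=> n; apply: measurable_funTS; exact: (n1 _ s (nF n)).1.
  + by move=> n v _; exact: (n1 _ s (nF n)).2.
Qed.

Lemma sigma_op_arrival : sigma_op J.
Proof.
have r0 : (0 <= L)%R by rewrite ltW// cl_rate_gt0.
split => [f nf|s].
  split; last by move=> s; apply: arrival_op_ge0; [exact: unit_admissible|exact: nf.2].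
  apply: (measurable_arrival_op (f := fun _ : st => f) C unit_admissible) => //.
  exact: (measurableT_comp nf.1).
split => [f nf|c f c0 nf|f g nf ng fg|F nF]; rewrite !unit_arrival_op.
- by rewrite mule_ge0 ?lee_fin// nf.2.
- by rewrite muleCA.
- by rewrite lee_wpmul2l ?lee_fin.
- rewrite -nneseriesZl; last by move=> n _; exact: (nF n).2.
  by apply: eq_eseriesr => n _; rewrite unit_arrival_op.
Qed.

Lemma eq_clock_good D f g s : (forall v, D v -> 0 <= v)%R -> good s ->
  (forall s', good s' -> f s' = g s') -> clock D f s = clock D g s.
Proof.
move=> D0 gs fg; apply: eq_integral => v; rewrite inE => /D0 v0.
by rewrite (max_l v0) !unit_evolve0// fg//; exact: good_age_by.
Qed.

Lemma eq_arrival_good f g s : good s ->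
  (forall s', good s' -> f s' = g s') -> J f s = J g s.
Proof. by move=> gs fg; rewrite !unit_arrival_op fg//; exact: good_accept. Qed.

Local Notation early := [set` Interval (BLeft (0%R : R)) (BLeft 1%R)].
Local Notation late := [set` Interval (BLeft (1%R : R)) +oo%O].
Local Notation always := [set` Interval (BLeft (0%R : R)) +oo%O].

(** [relay] leads from one arrival to the next when the gap is shorter than 1; a longer gap empties
    the system, and the next arrival then regenerates it at [one]. [sojourn] is the normalised
    occupation during the exponential gap that follows a state. *)
Definition relay f : st -> \bar R := clock early (J f).
Definition sojourn f : st -> \bar R := fun s => L%:E * clock always f s.

Let early_ge0 v : early v -> (0 <= v)%R.
Proof. by rewrite /= in_itv/= => /andP[]. Qed.

Let always_ge0 v : always v -> (0 <= v)%R.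
Proof. by rewrite /= in_itv/= andbT. Qed.

Lemma sigma_op_relay : sigma_op relay.
Proof. exact: (sigma_op_comp (sigma_op_clock (measurable_itv _)) sigma_op_arrival). Qed.

Lemma sigma_op_sojourn : sigma_op sojourn.
Proof.
apply: (sigma_op_scale (ltW (cl_rate_gt0 (I ord0)))).
exact: (sigma_op_clock (measurable_itv _)).
Qed.

Lemma eq_relay_good f g s : good s -> (forall s', good s' -> f s' = g s') -> relay f s = relay g s.
Proof.
move=> gs fg; apply: (eq_clock_good early_ge0 gs) => s' gs'.
exact: eq_arrival_good.
Qed.

Lemma eq_iter_relay_good n f g s : good s -> (forall s', good s' -> f s' = g s') ->
  iter n relay f s = iter n relay g s.
Proof.
move=> + fg; elim: n s => [|n IH] s gs; first exact: fg.
by apply: eq_relay_good => // s' gs'; exact: IH.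
Qed.

(** The law of the state just after an arrival: the number of short gaps since the last regeneration
    is geometric with parameter [expR (- L)]. *)
Definition entrance f : \bar R :=
  (expR (- L))%:E * \sum_(0 <= n <oo) iter n relay f one.

Lemma sigma_functional_entrance : sigma_functional entrance.
Proof.
apply: sigma_functional_sum; first exact: expR_ge0.
by move=> n; exact: ((sigma_op_iter n sigma_op_relay).2 one).
Qed.

Hypothesis K0 : (0 < K)%N.

Let good_one : good one.
Proof. by split; rewrite ffunE/= ?lexx. Qed.

Lemma eq_entrance f g : (forall s', good s' -> f s' = g s') -> entrance f = entrance g.
Proof.
by move=> fg; congr (_ * _); apply: eq_eseriesr => n _; exact: eq_iter_relay_good.
Qed.

Local Notation dens v := (expR (- L * v) * L)%R%:E.

Let mdens D : measurable_fun D (fun v : R => dens v).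
Proof.
apply/measurable_EFinP; apply: measurable_funTS; apply: measurable_funM => //.
by apply: measurableT_comp => //; exact: measurable_funM.
Qed.

Let dens_ge0 v : 0 <= dens v.
Proof. by rewrite lee_fin mulr_ge0 ?expR_ge0// ltW// cl_rate_gt0. Qed.

Lemma integral_dens_early : \int[mu]_(v in early) dens v = (1 - expR (- L))%:E.
Proof.
rewrite integral_itv_bndo_bndc//.
by have := integral_expR I (@ler01 R); rewrite total_rate1 mulr1.
Qed.

Lemma integral_dens_always : \int[mu]_(v in always) dens v = 1.
Proof.
rewrite -(integral_exponential_pdf (cl_rate_gt0 (I ord0))) integral_mkcond.
apply: eq_integral => v _; rewrite /exponential_pdf !patchE.
by case: ifP => _ //; rewrite mulrC.
Qed.

Let alwaysE : always = early `|` late.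
Proof.
apply/seteqP; split => v /=; rewrite !in_itv/= ?andbT => h.
  by have [v1|v1] := ltP v 1%R; [left; rewrite h|right].
by case: h => [/andP[]//|]; apply: le_trans.
Qed.

Let early_late : [disjoint early & late].
Proof.
apply/disj_setPS => v [] /=; rewrite !in_itv/= andbT => /andP[_ v1] v2.
by have := lt_le_trans v1 v2; rewrite ltxx.
Qed.

Lemma integral_dens_late : \int[mu]_(v in late) dens v = (expR (- L))%:E.
Proof.
have split : \int[mu]_(v in always) dens v =
    \int[mu]_(v in early) dens v + \int[mu]_(v in late) dens v.
  rewrite alwaysE; apply: ge0_integral_setU.
  - exact: measurable_itv.
  - exact: measurable_itv.
  - exact: mdens.
  - by move=> v _; exact: dens_ge0.
  - exact: early_late.
move: split; rewrite integral_dens_always integral_dens_early.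
have : 0 <= \int[mu]_(v in late) dens v by apply: integral_ge0.
case: (\int[mu]_(v in late) dens v) => [r|//|//] _.
by rewrite -EFinD => -[] h; congr EFin; lra.
Qed.

(** Split the gap at 1: a shorter one gives [relay], a longer one has probability [expR (- L)] and
    leads from the empty system to [one]. *)
Lemma clock_always_arrival f s : nnm f -> good s ->
  clock always (J f) s = relay f s + (expR (- L))%:E * f one.
Proof.
move=> nf gs; have nJ := sigma_op_arrival.1 f nf.
have nT : nnm (fun v : R => T_ (Num.max v 0)%R (J f) s).
  exact: (nnm_section (K := fun (s : st) (v : R) => T_ (Num.max v 0)%R (J f) s) s (nnm_evolve0_joint nJ)).
transitivity (clock early (J f) s + clock late (J f) s).
  rewrite /clock alwaysE; apply: ge0_integral_setU.
  - exact: measurable_itv.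
  - exact: measurable_itv.
  - by apply: measurable_funTS; exact: nT.1.
  - by move=> v _; exact: nT.2.
  - exact: early_late.
apply: (congr1 (fun z => _ + z)); rewrite -integral_dens_late.
transitivity (\int[mu]_(v in late) (dens v * f one)); last first.
  by apply: ge0_integralZr => //; [exact: mdens|exact: nf.2].
apply: eq_integral => v; rewrite inE/= in_itv/= andbT => v1.
have v0 : (0 <= v)%R by lra.
rewrite (max_l v0) unit_evolve0// unit_arrival_op age_by_ge1// EFinM muleA.
congr (_ * f _); apply/ffunP => j; rewrite /accept !ffunE/= K0 (ord1 j) !ffunE.
by [].
Qed.

Lemma iter_relay1 n s : iter n relay (fun=> 1) s = ((1 - expR (- L)) ^+ n)%:E.
Proof.
elim: n s => [|n IH] s; first by rewrite expr0.
rewrite iterS (_ : iter n _ _ = fun=> ((1 - expR (- L)) ^+ n)%:E); last exact/funext.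
rewrite exprSr EFinM -integral_dens_early /relay /clock.
rewrite -ge0_integralZl_EFin//; last 2 first.
- exact: mdens.
- by rewrite exprn_ge0// subr_ge0 expR_le1 oppr_le0 ltW// cl_rate_gt0.
apply: eq_integral => v; rewrite inE => /early_ge0 v0.
rewrite (max_l v0) unit_evolve0// unit_arrival_op -!EFinM; congr EFin; ring.
Qed.

Lemma entrance1 : entrance (fun=> 1) = 1.
Proof.
rewrite /entrance; set z := expR (- L).
have z0 : (0 < z)%R by exact: expR_gt0.
have z1 : (z < 1)%R by rewrite /z expR_lt1 oppr_lt0 cl_rate_gt0.
suff -> : \sum_(0 <= n <oo) iter n relay (fun=> 1) one = (z^-1)%:E.
  by rewrite -EFinM divff// gt_eqF.
apply: cvg_lim => //.
rewrite (_ : (fun n => _) = EFin \o series (geometric 1 (1 - z)%R)); last first.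
  apply/funext => n; rewrite /= /series/= -sumEFin; apply: eq_bigr => k _.
  by rewrite iter_relay1 mul1r.
apply: cvg_EFin; first exact: nearW.
have := @cvg_geometric_series R 1%R (1 - z)%R; rewrite subKr mul1r; apply.
by rewrite ger0_norm; lra.
Qed.

(** Invariance of the law at arrivals: one more gap either prolongs the run of short gaps, which
    shifts the series, or regenerates, which restores its first term. *)
Lemma entrance_step f : nnm f -> f one \is a fin_num ->
  entrance (clock always (J f)) = entrance f.
Proof.
move=> nf ffin; have sfe := sigma_functional_entrance.
have nR := sigma_op_relay.1 f nf.
pose c := (expR (- L) * fine (f one))%R.
have c0 : (0 <= c)%R by rewrite mulr_ge0 ?expR_ge0// fine_ge0// nf.2.
transitivity (entrance (fun s => relay f s + c%:E * 1)).
  by apply: eq_entrance => s gs; rewrite clock_always_arrival// mule1 /c EFinM fineK.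
have n1 : nnm (fun _ : st => 1 : \bar R) by exact: nnm_cst.
rewrite (sf_add sfe)//; last exact: nnmZ.
rewrite (sf_scale sfe c0 n1) entrance1 mule1 addeC {2}/entrance.
have ni n : 0 <= iter n relay f one by exact: ((sigma_op_iter n sigma_op_relay).1 f nf).2.
rewrite (nneseries_split 0 1)// add0n big_nat1 ge0_muleDr ?nneseries_ge0//.
rewrite /c EFinM fineK//; congr (_ + _); rewrite /entrance; congr (_ * _).
rewrite -[RHS]nneseries_addn//; apply: eq_eseriesr => n _.
by rewrite addn1 iterSr.
Qed.

(** Split the gap at [t]: what follows is a fresh gap from the state aged by [t], by the lack of
    memory of the exponential law and the additivity of [age_by]. *)
Lemma sojourn_evolve0 t f s : (0 <= t)%R -> nnm f ->
  sojourn f s = sojourn (T_ t f) s + \int[mu]_(v in `[0%R, t]) (L%:E * T_ v f s).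
Proof.
move=> t0 nf; have nTt := nnm_evolve C unit_admissible 0 t0 nf.
have nT : nnm (fun v : R => T_ (Num.max v 0)%R f s).
  exact: (nnm_section (K := fun (s : st) (v : R) => T_ (Num.max v 0)%R f s) s (nnm_evolve0_joint nf)).
have L0 : (0 <= L)%R by rewrite ltW// cl_rate_gt0.
pose before : set R := [set` Interval (BLeft (0%R : R)) (BLeft t)].
pose after : set R := [set` Interval (BLeft t) +oo%O].
have E : clock always f s = clock before f s + clock after f s.
  rewrite /clock (_ : always = before `|` after); last first.
    apply/seteqP; split => v; rewrite /before /after /= !in_itv/= ?andbT => h.
      by have [vt|vt] := ltP v t; [left; rewrite h|right].
    by case: h => [/andP[]//|]; apply: le_trans.
  apply: ge0_integral_setU.
  - exact: measurable_itv.
  - exact: measurable_itv.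
  - by apply: measurable_funTS; exact: nT.1.
  - by move=> v _; exact: nT.2.
  - apply/disj_setPS => v []; rewrite /before /after /= !in_itv/= andbT => /andP[_ v1] v2.
    by have := lt_le_trans v1 v2; rewrite ltxx.
rewrite /sojourn E ge0_muleDr; last 2 first.
- by apply: integral_ge0 => v _; exact: nT.2.
- by apply: integral_ge0 => v _; exact: nT.2.
rewrite addeC; congr (_ + _).
  congr (_ * _); rewrite /clock integral_mul_indic [RHS]integral_mul_indic.
  have nh : nnm (fun v : R => T_ (Num.max v 0)%R f s * (\1_after v)%:E).
    split; last by move=> v; rewrite mule_ge0 ?lee_fin//; exact: nT.2.
    apply: emeasurable_funM; first exact: nT.1.
    by apply/measurable_EFinP; apply: measurable_indic; exact: measurable_itv.
  rewrite (integral_shift (- t) nh); apply: eq_integral => v _; rewrite opprK.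
  have -> : \1_after (v + t)%R = \1_always v :> R.
    by rewrite /after !indicE !mem_setE !in_itv/= !andbT lerDr.
  rewrite indicE mem_setE in_itv/= andbT; case: leP => [v0|_]; last by rewrite !mule0.
  have vt0 : (0 <= v + t)%R by exact: addr_ge0.
  rewrite !mule1 (max_l vt0) !unit_evolve0// age_by_age_by// muleA -EFinM -expRD.
  by rewrite mulrDr.
rewrite /clock integral_itv_bndo_bndc; last by apply: measurable_funTS; exact: nT.1.
transitivity (\int[mu]_(v in `[0%R, t]) (L%:E * T_ (Num.max v 0)%R f s)).
  apply/esym; apply: ge0_integralZl_EFin; [exact: measurable_itv| | |exact: L0].
  - by move=> v _; exact: nT.2.
  - by apply: measurable_funTS; exact: nT.1.
by apply: eq_integral => v; rewrite inE/= in_itv/= => /andP[v0 _]; rewrite (max_l v0).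
Qed.

(** The stationary law in continuous time, as a functional: the occupation of a gap started from the
    law at arrivals. *)
Definition load f : \bar R := entrance (sojourn f).

Lemma sigma_functional_load : sigma_functional load.
Proof. exact: (sigma_functional_comp sigma_functional_entrance sigma_op_sojourn). Qed.

Lemma eq_load f g : (forall s', good s' -> f s' = g s') -> load f = load g.
Proof.
move=> fg; apply: eq_entrance => s gs; congr (_ * _).
exact: (eq_clock_good always_ge0).
Qed.

Lemma load1 : load (fun=> 1) = 1.
Proof.
rewrite -[RHS]entrance1; congr entrance; apply/funext => s.
transitivity (\int[mu]_(v in always) dens v); last exact: integral_dens_always.
rewrite /sojourn /clock -ge0_integralZl_EFin//; last 3 first.
- by move=> v _; rewrite unit_evolve0 ?le_max ?lexx ?orbT// mule1 lee_fin expR_ge0.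
- have n1 : nnm (fun _ : st => 1 : \bar R) by exact: nnm_cst.
  have h := nnm_section (K := fun (s : st) (v : R) => T_ (Num.max v 0)%R (fun=> 1) s) s (nnm_evolve0_joint n1).
  by apply: measurable_funTS; exact: h.1.
- by rewrite ltW// cl_rate_gt0.
apply: eq_integral => v; rewrite inE => /always_ge0 v0.
by rewrite (max_l v0) unit_evolve0// mule1 -EFinM mulrC.
Qed.

Lemma load_arrival f : nnm f -> f one \is a fin_num -> load (J f) = L%:E * entrance f.
Proof.
move=> nf ffin; rewrite /load /sojourn (sf_scale sigma_functional_entrance) ?entrance_step//.
  by rewrite ltW// cl_rate_gt0.
exact: ((sigma_op_clock (measurable_itv _)).1 _ (sigma_op_arrival.1 f nf)).
Qed.

(** The two terms of the last-arrival identity come from [sojourn_evolve0]; [load_arrival]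
    recognises the second as an arrival under [load]. *)
Lemma unit_stationary : exists Pi : probability st R, stationary C I unit_policy Pi /\
  forall A, measurable A -> Pi A = load (fun s => (\1_A s)%:E).
Proof.
have [Pi [PiE PiI]] := functional_probability sigma_functional_load load1.
have [Pw [_ PwI]] := functional_probability sigma_functional_entrance entrance1.
exists Pi; split => //.
have mss : measurable (@state_space R C 1) by exact: measurable_state_space.
have PS : Pi (@state_space R C 1) = 1.
  rewrite PiE// -load1; apply: eq_load => s [sK s0]; rewrite indicE mem_set//.
  split; first by rewrite /= /in_service big_ord1 ltnW.
  by move=> j; rewrite (ord1 j).
apply: (balanced_stationary unit_admissible _ _ PS) => // t f c t0 nf fc.
have nTt := nnm_evolve C unit_admissible 0 t0 nf.
have L0 : (0 <= L)%R by rewrite ltW// cl_rate_gt0.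
have c0 : (0 <= c)%R by rewrite -lee_fin; apply: le_trans (fc one); exact: nf.2.
have Tc v s : (0 <= v)%R -> T_ v f s <= c%:E.
  move=> v0; rewrite unit_evolve0// (le_trans _ (fc (age_by v s)))// gee_pMl ?nf.2//.
  by rewrite lee_fin expR_le1 mulNr oppr_le0 mulr_ge0.
have nK : nnm (fun z : st * R => L%:E * T_ (Num.max z.2 0)%R f z.1).
  by apply: nnmZ => //; exact: nnm_evolve0_joint.
pose H s := \int[mu]_(v in `[0%R, t]) (L%:E * T_ (Num.max v 0)%R f s).
have nH : nnm H.
  exact: (nnm_integral_in mu (measurable_itv _) (K := fun (s : st) v => L%:E * T_ (Num.max v 0)%R f s) nK).
have HE s : H s = \int[mu]_(v in `[0%R, t]) (L%:E * T_ v f s).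
  by apply: eq_integral => v; rewrite inE/= in_itv/= => /andP[v0 _]; rewrite (max_l v0).
rewrite -(PiI f c nf fc) -(PiI _ c nTt (fun s => Tc t s t0)).
transitivity (load (T_ t f) + entrance H).
  rewrite /load -(sf_add sigma_functional_entrance)//; last exact: (sigma_op_sojourn.1 _ nTt).
  by congr entrance; apply/funext => s; rewrite (sojourn_evolve0 _ t0 nf) HE.
congr (_ + _).
have Hc s : H s <= (L * c * t)%:E.
  apply: (@le_trans _ _ (\int[mu]_(v in `[0%R, t]) (L * c)%:E)).
    apply: le_integral_ge0 => v _; first exact: (nK.2 (s, v)).
    by rewrite EFinM lee_wpmul2l ?lee_fin// Tc// le_max lexx orbT.
  rewrite integral_cst//= lebesgue_measure_itv/= lte_fin.
  case: ltP => [_|_]; first by rewrite -EFinD subr0 -EFinM.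
  by rewrite mule0 lee_fin !mulr_ge0.
rewrite (PwI H _ nH Hc).
rewrite (tonelli_in Pw mu (measurable_itv _) (K := fun (s : st) v => L%:E * T_ (Num.max v 0)%R f s) nK).
apply: eq_integral => v; rewrite inE/= in_itv/= => /andP[v0 _]; rewrite (max_l v0).
have nv := nnm_evolve C unit_admissible 0 v0 nf.
rewrite ge0_integralZl_EFin//; last 2 first.
- by move=> s _; exact: nv.2.
- exact: nv.1.
rewrite -(PwI _ c nv (fun s => Tc v s v0)) -load_arrival//; last first.
  by rewrite ge0_fin_numE ?nv.2// (le_lt_trans (Tc _ _ v0))// ltry.
apply: (PiI _ (L * c)%R); first exact: (sigma_op_arrival.1 _ nv).
by move=> s; rewrite unit_arrival_op EFinM lee_wpmul2l ?lee_fin// Tc.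
Qed.

Lemma nnm_list_sum (h : R -> R) : measurable_fun [set: R] h -> (forall a, 0 <= h a)%R ->
  nnm (fun s : st => (\sum_(a <- take K (s ord0)) h a)%R%:E : \bar R).
Proof.
move=> mh h0; split; last by move=> s; rewrite lee_fin sumr_ge0.
apply/measurable_EFinP.
rewrite (_ : (fun s : st => _) = fun s : st => \sum_(k < K)
    (if (k < size (s ord0))%N then h (nth 0 (s ord0) k) else 0))%R; last first.
  by apply/funext => s; rewrite sum_take big_mkcond.
apply: measurable_sum => k; apply: measurable_fun_ifT => //.
  apply: (measurableT_comp (f := fun n : nat => (k < n)%N)) => //; exact: measurable_size.
by apply: measurableT_comp => //; exact: measurable_age.
Qed.

(** The remaining service time at age [a], clipped so as to be bounded and nonnegative at every real
    age. *)
Let h (a : R) : R := Num.min (Num.max (1 - a) 0)%R 1%R.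

Let h_ge0 a : (0 <= h a)%R.
Proof. by rewrite le_min le_max lexx orbT ler01. Qed.

Let mh : measurable_fun [set: R] h.
Proof. by apply: measurable_minr => //; apply: measurable_maxr => //; exact: measurable_funB. Qed.

Definition workload (s : st) : \bar R := (\sum_(a <- take K (s ord0)) h a)%R%:E.
Definition headcount (s : st) : \bar R := (\sum_(a <- take K (s ord0)) 1)%R%:E.

Let nW : nnm workload. Proof. exact: nnm_list_sum. Qed.
Let nN : nnm headcount. Proof. by apply: nnm_list_sum => // a; rewrite ler01. Qed.

(** What a customer of age [a] contributes, at time [v], to the integrand of [sojourn] for
    [workload + headcount / L]. Before departure it is the derivative in [v] of
    [- (1 - a - v) * expR (- L * v)]. *)
Let kernel (a v : R) : R := if (a + v < 1)%R then (expR (- L * v) * (L * (1 - (a + v)) + 1))%R else 0%R.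

Lemma integral_kernel a : (0 <= a)%R -> \int[mu]_(v in always) (kernel a v)%:E = (h a)%:E.
Proof.
move=> a0; have L0 : (0 < L)%R by exact: cl_rate_gt0.
have hE : h a = Num.max (1 - a)%R 0%R by rewrite /h min_l// ge_max ler01 andbT; lra.
have [b0|b0] := leP (1 - a)%R 0%R.
  rewrite hE max_r// (eq_integral (fun=> 0)) ?integral0// => v; rewrite inE => /always_ge0 v0.
  by rewrite /kernel ltNge (_ : (1 <= a + v)%R)//; lra.
pose b := (1 - a)%R; rewrite hE max_l ?ltW// -/b.
pose F (v : R) : R := (- (b - v) * expR (- L * v))%R.
pose F' (v : R) : R := (expR (- L * v) * (L * (b - v) + 1))%R.
have dF (v : R) : is_derive v 1%R F (F' v).
  have h1 : is_derive v 1%R (fun v => expR (- L * v))%R (expR (- L * v) * - L)%R.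
    have h2 : is_derive v 1%R (fun v : R => - L * v)%R (- L)%R.
      by apply: (is_derive_eq (is_deriveZ (- L)%R (is_derive_id v 1%R))); rewrite /GRing.scale/= mulr1.
    exact: (is_derive1_comp (is_derive_expR (- L * v)%R) h2).
  have h3 : is_derive v 1%R (fun v : R => - (b - v))%R 1%R.
    apply: (is_derive_eq (is_deriveN (is_deriveB (is_derive_cst b v 1%R) (is_derive_id v 1%R)))).
    by rewrite sub0r opprK.
  apply: (is_derive_eq (is_deriveM h3 h1)).
  by rewrite /GRing.scale/= /F'; ring.
have cF' : continuous F'.
  move=> v; apply: cvgM; last first.
    by apply: cvgD; [apply: cvgM; [exact: cvg_cst|apply: cvgB; [exact: cvg_cst|exact: cvg_id]]|exact: cvg_cst].
  apply: (@continuous_comp _ _ _ (fun v : R => (- L * v)%R) expR); last exact: continuous_expR.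
  by apply: cvgM; [exact: cvg_cst|exact: cvg_id].
have ftc : \int[mu]_(v in `[0%R, b]) (F' v)%:E = b%:E.
  rewrite (integral_is_derive (ltrN10 R) (ltW b0) (fun v _ => dF v) (fun v _ => cF' v)).
  by rewrite -/b /F mulr0 expR0; congr EFin; ring.
rewrite -ftc -integral_itv_bndo_bndc; last first.
  by apply/measurable_EFinP; apply: measurable_funTS; exact: continuous_measurable_fun.
rewrite [RHS]integral_mul_indic [LHS]integral_mul_indic; apply: eq_integral => v _.
rewrite /kernel !indicE !mem_setE !in_itv/= andbT.
rewrite (_ : (a + v < 1)%R = (v < b)%R); last by rewrite /b; apply/idP/idP; lra.
rewrite /F' /b; have [v0|v0] := leP 0%R v; last by rewrite !mule0.
by case: ltP => _; rewrite ?mule1 ?mule0 ?mul0e//= opprD addrA.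
Qed.

(** Work falls at unit rate per customer, so the initial work is its average over the gap plus the
    mean loss, which is the average headcount divided by [L]. *)
Lemma sojourn_workload s : good s ->
  sojourn (fun s => workload s + (L^-1)%:E * headcount s) s = workload s.
Proof.
move=> gs; have [sK s0] := gs; have L0 : (0 < L)%R by exact: cl_rate_gt0.
have nsum : nnm (fun s => workload s + (L^-1)%:E * headcount s).
  by apply: nnmD => //; apply: nnmZ => //; rewrite invr_ge0 ltW.
have mk a : measurable_fun [set: R] (fun v => (kernel a v)%:E : \bar R).
  apply/measurable_EFinP; apply: measurable_fun_ifT => //.
    by apply: measurable_fun_ltr => //; exact: measurable_funD.
  apply: measurable_funM.
    by apply: measurableT_comp => //; exact: measurable_funM.
  by apply: measurable_funD => //; apply: measurable_funM => //; apply: measurable_funB => //; exact: measurable_funD.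
have k0 a v : 0 <= (kernel a v)%:E.
  rewrite lee_fin /kernel; case: ifP => // h1; rewrite mulr_ge0 ?expR_ge0// addr_ge0// mulr_ge0 ?ltW//.
  by rewrite subr_gt0.
rewrite [RHS]/workload (take_oversize sK) -sumEFin.
transitivity (\sum_(a <- s ord0) \int[mu]_(v in always) (kernel a v)%:E); last first.
  by apply: eq_big_seq => a al; rewrite integral_kernel//; exact: (allP s0).
rewrite -ge0_integral_sum//; last by move=> a; apply: measurable_funTS; exact: mk.
rewrite /sojourn /clock.
have nT := nnm_section (K := fun (s : st) (v : R) => T_ (Num.max v 0)%R (fun s => workload s + (L^-1)%:E * headcount s) s) s (nnm_evolve0_joint nsum).
transitivity (\int[mu]_(v in always) (L%:E * T_ (Num.max v 0)%R (fun s => workload s + (L^-1)%:E * headcount s) s)).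
  apply/esym; apply: ge0_integralZl_EFin; [exact: measurable_itv| | |exact: ltW].
  - by move=> v _; exact: nT.2.
  - by apply: measurable_funTS; exact: nT.1.
apply: eq_integral => v; rewrite inE => /always_ge0 v0.
have [sK' _] := good_age_by v0 gs.
rewrite (max_l v0) unit_evolve0// /workload /headcount (take_oversize sK') age_by_good//.
rewrite !big_map !big_filter sumEFin -!EFinM; congr EFin.
rewrite mulr_sumr -big_split/= !mulr_sumr big_mkcond/=; apply: eq_big_seq => a al.
have a0 : (0 <= a)%R by exact: (allP s0).
rewrite /kernel; case: ifP => // av1.
rewrite /h max_l ?min_l ?subr_ge0 ?(ltW av1)//; last by lra.
by field; rewrite gt_eqF.
Qed.

Let nf := [set s : st | (size (s ord0) < K)%N].

Let nfE s : (\1_nf s : R) = ((size (s ord0) < K)%N%:R : R).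
Proof.
by rewrite indicE; have [sK|sK] := boolP (_ < _)%N; [rewrite mem_set|rewrite memNset//; exact/negP].
Qed.

Let mnf : measurable nf.
Proof.
rewrite -[nf]setTI.
exact: (@measurable_size R 1 ord0 measurableT [set n | (n < K)%N]).
Qed.

(** Little's law with equality. Evaluate [load] after an arrival on the workload in two ways:
    through the law at arrivals and [sojourn_workload], or directly, an accepted customer bringing
    one unit of work. The mean workload is finite and cancels. *)
Lemma unit_rate_conservation :
  load headcount = L%:E * load (fun s => (\1_[set s : st | (size (s ord0) < K)%N] s)%:E).
Proof.
have L0 : (0 < L)%R by exact: cl_rate_gt0.
have n1 : nnm (fun s => (\1_nf s)%:E : \bar R) by exact: nnm_indic.
have sfl := sigma_functional_load.
have W1 : workload one \is a fin_num by [].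
have e1 : load (J workload) = L%:E * entrance workload by exact: load_arrival.
have e2 : load (J workload) = L%:E * (load workload + load (fun s => (\1_nf s)%:E)).
  rewrite -(sf_add sfl nW n1) -(sf_scale sfl (ltW L0) (nnmD nW n1)).
  apply: eq_load => s [sK s0]; rewrite unit_arrival_op; congr (_ * _).
  rewrite /accept nfE; case: ifP => sK'; last by rewrite adde0.
  rewrite /workload (take_oversize sK) take_oversize ffunE eqxx ?size_rcons//.
  by rewrite big_rcons/= -EFinD /h subr0 max_l// min_l// addrC.
have e3 : entrance workload = load workload + (L^-1)%:E * load headcount.
  rewrite -(sf_scale sfl)//; last by rewrite invr_ge0 ltW.
  rewrite -(sf_add sfl)//; last by apply: nnmZ => //; rewrite invr_ge0 ltW.
  by apply: eq_entrance => s gs; rewrite sojourn_workload.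
have Wfin : load workload \is a fin_num.
  rewrite ge0_fin_numE; last exact: (sf_ge0 sfl).
  have nK : nnm (fun _ : st => K%:R%:E * 1 : \bar R).
    by split => [|s]; [exact: measurable_cst|rewrite mule1 lee_fin].
  apply: (@le_lt_trans _ _ (load (fun s => K%:R%:E * 1))).
    apply: (sf_le sfl nW nK) => s; rewrite mule1 lee_fin (@le_trans _ _ (\sum_(a <- take K (s ord0)) 1)%R)//.
      by apply: ler_sum => a _; rewrite ge_min lexx orbT.
    by rewrite big_const_seq count_predT iter_addr_0 ler_nat size_take_min geq_minl.
  by rewrite (sf_scale sfl)// load1 mule1 ltry.
have qfin : load (fun s => (\1_nf s)%:E) \is a fin_num.
  rewrite ge0_fin_numE; last exact: (sf_ge0 sfl).
  apply: (@le_lt_trans _ _ (load (fun=> 1))); last by rewrite load1 ltry.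
  have nn1 : nnm (fun _ : st => 1 : \bar R) by split.
  apply: (sf_le sfl n1 nn1) => s.
  by rewrite lee_fin indicE; case: (s \in nf).
move: e2; rewrite e1 e3.
move: (sf_ge0 sfl nN) Wfin qfin.
case: (load workload) => // w; case: (load (fun s => (\1_nf s)%:E)) => // q.
case: (load headcount) => // [N|] N0 _ _.
  rewrite -!EFinM => -[] E; congr EFin.
  have : (L * (L^-1 * N) = L * q)%R by rewrite !mulrDr in E; lra.
  by rewrite mulrA divff ?mul1r// gt_eqF.
by rewrite gt0_muley ?lte_fin ?invr_gt0// addey// gt0_muley ?lte_fin.
Qed.

(** A rejecting state has at least [K] customers, so [K (1 - q)] is at most the mean headcount
    [L q]; hence [q >= K / (K + L)]. *)
Lemma unit_accept_prob : exists q : R, [/\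
  load (fun s => (\1_[set s : st | (size (s ord0) < K)%N] s)%:E) = q%:E, (0 <= q <= 1)%R &
  (K%:R * (1 - q) <= L * q)%R].
Proof.
have sfl := sigma_functional_load.
have n1 : nnm (fun s => (\1_nf s)%:E : \bar R) by exact: nnm_indic.
have n2 : nnm (fun s => (\1_(~` nf) s)%:E : \bar R) by apply: nnm_indic; exact: measurableC.
have split : load (fun s => (\1_nf s)%:E) + load (fun s => (\1_(~` nf) s)%:E) = 1.
  rewrite -(sf_add sfl)// -load1; congr load; apply/funext => s.
  by rewrite -EFinD !indicE in_setC; case: (s \in nf); rewrite ?addr0 ?add0r.
have full : K%:R%:E * load (fun s => (\1_(~` nf) s)%:E) <= load headcount.
  rewrite -(sf_scale sfl)//; apply: (sf_le sfl) => //; first exact: nnmZ.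
  move=> s; rewrite -EFinM lee_fin big_const_seq count_predT iter_addr_0 size_take_min.
  have -> : (\1_(~` nf) s : R) = (1 - (size (s ord0) < K)%N%:R)%R.
    by rewrite -nfE !indicE in_setC; case: (s \in nf); rewrite ?subr0 ?subrr.
  have [sK|sK] := leqP K (size (s ord0)); first by rewrite subr0 mulr1.
  by rewrite subrr mulr0.
move: full; rewrite unit_rate_conservation -/nf.
move: (sf_ge0 sfl n1) (sf_ge0 sfl n2) split.
case: (load (fun s => (\1_nf s)%:E)) => [q| |]; case: (load (fun s => (\1_(~` nf) s)%:E)) => [q'| |] //.
rewrite !lee_fin => q0 q'0; rewrite -EFinD => -[] E full.
exists q; split => //; first by apply/andP; split; lra.
by rewrite (_ : 1 - q = q')%R//; lra.
Qed.

End unit_service.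

(** * The valuation law and its revenue rate *)

Section pareto_mixture.
Context (R : realType) (w : R) (m : nat).
Hypotheses (w0 : 0 < w) (w1 : w < 1) (m0 : (0 < m)%N).
Local Notation mu := (@lebesgue_measure R).

Let tail (x : R) : R := w * x^-1 + (1 - w) * x^-1 ^+ m.+1.
Let slope (x : R) : R := x^-1 ^+ 2 * (w + (1 - w) * m.+1%:R * x^-1 ^+ m).
Let dens (x : R) : R := if 1 <= x then slope x else 0.

Let tail1 : tail 1 = 1.
Proof. by rewrite /tail invr1 expr1n; ring. Qed.

Let slope_gt0 (x : R) : 0 < x -> 0 < slope x.
Proof.
move=> x0; have y0 : 0 < x^-1 by rewrite invr_gt0.
have h : 0 <= (1 - w) * m.+1%:R * x^-1 ^+ m.
  by rewrite !mulr_ge0 ?exprn_ge0 ?(ltW y0)// subr_ge0 ltW.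
by rewrite /slope mulr_gt0 ?exprn_gt0// ltr_pwDl.
Qed.

Let is_derive_tail (x : R) : 0 < x -> is_derive x (1 : R) (fun x : R => - tail x) (slope x).
Proof.
move=> x0; have xN0 : x != 0 by rewrite gt_eqF.
have dV : is_derive x (1 : R) (fun x : R => x^-1) (- (x^-1 ^+ 2)).
  apply: (is_derive_eq (is_deriveV xN0 (is_derive_id x (1 : R)))).
  by rewrite /GRing.scale/= mulr1 exprVn.
have dX : is_derive x (1 : R) (fun v : R => v^-1 ^+ m.+1) ((m.+1%:R * x^-1 ^+ m) *: - (x^-1 ^+ 2)).
  have -> : (fun v : R => v^-1 ^+ m.+1) = (fun v : R => v^-1) ^+ m.+1 by apply/funext => v; rewrite exprfctE.
  exact: (is_deriveX m.+1 dV).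
apply: (is_derive_eq (is_deriveN (is_deriveD (is_deriveZ w dV) (is_deriveZ (1 - w) dX)))).
by rewrite /GRing.scale/= /slope; ring.
Qed.

Let slope_continuous (x : R) : 0 < x -> {for x, continuous slope}.
Proof.
move=> x0; have xN0 : x != 0 by rewrite gt_eqF.
have cV : {for x, continuous (fun x : R => x^-1)} by exact: inv_continuous.
have cX k : {for x, continuous (fun x : R => x^-1 ^+ k)}.
  by apply: (@continuous_comp _ _ _ (fun x : R => x^-1) (fun y : R => y ^+ k)) => //; exact: exprn_continuous.
apply: cvgM; first exact: cX.
by apply: cvgD; [exact: cvg_cst|apply: cvgM; [exact: cvg_cst|exact: cX]].
Qed.

Let tail_cvg0 : - tail x @[x --> +oo] --> 0.
Proof.
apply/cvgrPdist_lt => e e0; near=> x.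
have x1 : 1 <= x by near: x; apply: nbhs_pinfty_ge; exact: num_real.
have x0 : 0 < x by lra.
have xe : e^-1 < x by near: x; apply: nbhs_pinfty_gt; exact: num_real.
have y0 : 0 < x^-1 by rewrite invr_gt0.
have y1 : x^-1 <= 1 by rewrite invf_le1.
have ye : x^-1 < e by rewrite invf_plt ?posrE.
have yX : x^-1 ^+ m.+1 <= x^-1 by rewrite exprS ler_piMr ?exprn_ile1 ?(ltW y0).
have yX0 : 0 <= x^-1 ^+ m.+1 by rewrite exprn_ge0 ?ltW.
have t0 : 0 <= tail x.
  by apply: addr_ge0; apply: mulr_ge0; rewrite ?(ltW w0) ?(ltW y0) ?subr_ge0 ?(ltW w1).
rewrite sub0r opprK ger0_norm//.
apply: le_lt_trans ye; rewrite -[leRHS](_ : w * x^-1 + (1 - w) * x^-1 = x^-1); last by ring.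
by rewrite lerD2l ler_wpM2l// subr_ge0 ltW.
Unshelve. all: by end_near.
Qed.

Let dens_ge0 x : 0 <= dens x.
Proof. by rewrite /dens; case: ifP => // x1; rewrite ltW// slope_gt0//; lra. Qed.

Let measurable_dens : measurable_fun [set: R] dens.
Proof.
(* Composing [slope] with the maximum of [x] and 1 avoids its singularity at 0 and makes it
   continuous on the whole line. *)
have -> : dens = (fun x => if 1 <= x then slope (Num.max x 1) else 0).
  by apply/funext => x; rewrite /dens; case: ifP => // x1; rewrite max_l.
apply: measurable_fun_ifT => //; first exact: measurable_fun_ler.
apply: continuous_measurable_fun => x.
have h : 0 < Num.max x 1 by rewrite lt_max ltr01 orbT.
apply: (@continuous_comp _ _ _ (fun x : R => Num.max x 1) slope); last exact: slope_continuous.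
by apply: continuous_max; [exact: cvg_id|exact: cvg_cst].
Qed.

Let integral_dens (x : R) : 1 <= x ->
  (\int[mu]_(v in [set` `]-oo, x]]) (dens v)%:E = (1 - tail x)%:E)%E.
Proof.
move=> x1; transitivity (\int[mu]_(v in [set` `[1%R, x]]) (slope v)%:E)%E.
  rewrite integral_mul_indic [RHS]integral_mul_indic; apply: eq_integral => v _.
  rewrite /dens !indicE !mem_setE !in_itv/=; case: ifP => _; first by [].
  by rewrite mul0e mule0.
rewrite (integral_is_derive (c := 0) ltr01 x1 (fun v v0 => is_derive_tail v0) (fun v v0 => slope_continuous v0)).
by congr EFin; rewrite tail1; ring.
Qed.

Let integral_dens_total : (\int[mu]_v (dens v)%:E = 1)%E.
Proof.
transitivity (\int[mu]_(v in [set` `[1%R, +oo[]) (slope v)%:E)%E.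
  rewrite [RHS]integral_mul_indic; apply: eq_integral => v _.
  by rewrite /dens indicE mem_setE in_itv/= andbT; case: ifP => _; rewrite ?mule1 ?mule0.
rewrite (@ge0_continuous_FTC2y _ slope (fun x => - tail x) 1 0)//.
- by rewrite tail1 -EFinB sub0r opprK.
- by move=> x x1; rewrite ltW// slope_gt0//; lra.
- by apply: continuous_in_subspaceT => v; rewrite inE/= in_itv/= andbT => v1; apply: slope_continuous; lra.
- by move=> x x1; have [] := is_derive_tail (lt_trans ltr01 x1).
- have cF : {for (1 : R), continuous (fun x : R => - tail x)}.
    apply/differentiable_continuous/derivable1_diffP.
    by have [] := is_derive_tail ltr01.
  exact: cvg_at_right_filter cF.
- move=> v; rewrite in_itv/= andbT => v1; rewrite derive1E.
  by have [_ ->] := is_derive_tail (lt_trans ltr01 v1).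
Qed.

Lemma pareto_mixture : exists V : valuation R, [/\ val_lo V = 1, val_hi V = +oo%E,
  (forall x, 1 <= x -> 1 - val_cdf V x = w * x^-1 + (1 - w) * x^-1 ^+ m.+1) &
  (forall x, 1 <= x -> val_dens V x = x^-1 ^+ 2 * (w + (1 - w) * m.+1%:R * x^-1 ^+ m))].
Proof.
have nd : nnm (fun x : R => (dens x)%:E : \bar R).
  by split; [exact/measurable_EFinP|move=> x; rewrite lee_fin].
pose Phi (f : R -> \bar R) := (\int[mu]_x (f x * (dens x)%:E))%E.
have nPhi f : nnm f -> nnm (fun x : R => f x * (dens x)%:E)%E.
  by move=> nf; split; [apply: emeasurable_funM; [exact: nf.1|exact: nd.1]|move=> x; rewrite mule_ge0 ?nf.2 ?nd.2].
have sPhi : sigma_functional Phi.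
  split => [f nf|c f c0 nf|f g nf ng fg|F nF].
  - by apply: integral_ge0 => x _; exact: (nPhi f nf).2.
  - rewrite /Phi -ge0_integralZl_EFin//.
    + by apply: eq_integral => x _; rewrite muleA.
    + by move=> x _; exact: (nPhi f nf).2.
    + exact: (nPhi f nf).1.
  - apply: le_integral_ge0 => x _; first exact: (nPhi f nf).2.
    by rewrite lee_wpmul2r ?lee_fin.
  - rewrite /Phi -integral_nneseries//.
    + apply: eq_integral => x _; rewrite muleC -nneseriesZl; last by move=> n _; exact: (nF n).2.
      by apply: eq_eseriesr => n _; rewrite muleC.
    + by move=> n; exact: (nPhi _ (nF n)).1.
    + by move=> n x _; exact: (nPhi _ (nF n)).2.
have Phi1 : Phi (fun=> 1%E) = 1%E.
  transitivity (\int[mu]_v (dens v)%:E)%E; last exact: integral_dens_total.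
  by apply: eq_integral => x _; rewrite mul1e.
have [P [PE _]] := functional_probability sPhi Phi1.
have PdE (A : set R) : measurable A -> P A = (\int[mu]_(x in A) (dens x)%:E)%E.
  by move=> mA; rewrite PE// [RHS]integral_mul_indic; apply: eq_integral => x _; rewrite muleC.
have cdfE x : 1 <= x -> law_cdf P x = 1 - tail x.
  by move=> x1; rewrite /law_cdf PdE// integral_dens.
have support : P [set x | (1%:E <= x%:E <= +oo)%E] = 1%E.
  rewrite PdE; last first.
    rewrite (_ : [set x | _] = [set` `[1%R, +oo[ : interval R]); first exact: measurable_itv.
    by apply/seteqP; split => x /=; rewrite in_itv/= andbT lee_fin leey andbT.
  transitivity (\int[mu]_v (dens v)%:E)%E; last exact: integral_dens_total.
  rewrite [LHS]integral_mul_indic; apply: eq_integral => x _.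
  rewrite /dens indicE; case: ifPn => x1; last by rewrite mul0e.
  by rewrite mem_set ?mule1//= lee_fin x1 leey.
have smooth (x : R) : (1%:E < x%:E < +oo)%E ->
    [/\ is_derive x 1 (law_cdf P) (dens x), {for x, continuous dens} & 0 < dens x].
  rewrite lte_fin ltry andbT => x1; have x0 : 0 < x by lra.
  have nx : \forall v \near x, 1 <= v.
    by near=> v; rewrite ltW//; near: v; exact: lt_nbhsr.
  have dx : dens x = slope x by rewrite /dens ltW.
  split; rewrite ?dx ?slope_gt0//.
  - apply: (@near_eq_is_derive _ _ _ (fun v => 1 + - tail v)); last first.
      have dt := is_derive_tail x0.
      have -> : (fun v : R => 1 + - tail v) = cst (1 : R) + (fun v : R => - tail v) by [].
      by apply: is_derive_eq; rewrite add0r.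
    by near=> v; rewrite cdfE//; near: v.
  - have := slope_continuous x0; rewrite /prop_for /continuous_at dx; apply: cvg_trans.
    apply: near_eq_cvg; near=> v; rewrite /dens ifT//; near: v; exact: nx.
exists (@Valuation R P dens 1 +oo%E ler01 (ltry 1) support measurable_dens dens_ge0 PdE smooth).
split => //= x x1; last by rewrite /dens x1.
by rewrite /val_cdf/= cdfE// opprB addrCA subrr addr0.
Unshelve. all: by end_near.
Qed.
End pareto_mixture.

Section unit_service_revenue.
Context (R : realType) (K : nat) (I : 'I_1 -> customer_class R).
Hypothesis unit_serv : forall A, cl_serv (I ord0) A = \d_(1 : R) A.
Hypothesis K0 : (0 < K)%N.
Local Notation L := (cl_rate (I ord0)).
Local Notation st := (state R 1).

(** The threshold policy always has a free unit, so the envelope is earned at all times: at least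
    [a] when rejecting, at least [b] when accepting, which happens with probability at least
    [K / (K + L)]. *)
Lemma dynamic_opt_unit_ge (a b : R) : 0 <= a <= b -> a <= revbar I ord0 0 -> b <= revbar I ord0 L ->
  ((a + (b - a) * (K%:R / (K%:R + L)))%:E <= dynamic_opt K.+1 I)%E.
Proof.
move=> /andP[a0 ab] ra rb; have L0 : 0 < L by exact: cl_rate_gt0.
have [Pi [PiS PiE]] := unit_stationary unit_serv K0.
have [q [qE q01 Lq]] := unit_accept_prob unit_serv K0.
set nf := [set s : st | (size (s ord0) < K)%N] in qE.
have adm := unit_admissible K I.
have mnf : measurable nf.
  by rewrite -[nf]setTI; exact: (@measurable_size R 1 ord0 measurableT [set n | (n < K)%N]).
pose D := @nonfull R K.+1 1 `&` [set s : st | forall j, all (fun a => 0 <= a) (s j)].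
have mD : measurable D by exact: nonfull_ages_measurable.
have goodD (s : st) : good K s -> D s.
  move=> [sK s0]; split; first by rewrite /nonfull /= /in_service big_ord1 ltnS.
  by move=> j; rewrite (ord1 j).
have PD : Pi D = 1%E.
  have l1 : load K I (fun=> 1%E) = 1%E by exact: load1.
  rewrite PiE// -l1; apply: eq_load => // s gs.
  by rewrite indicE mem_set//; exact: goodD.
have PDnf : Pi (nf `&` D) = q%:E.
  rewrite PiE; last exact: measurableI.
  rewrite -qE; apply: eq_load => // s gs.
  by rewrite !indicE in_setI (mem_set (goodD _ gs)) andbT.
apply: (@le_trans _ _ (dynamic_revenue K.+1 I (unit_policy K I) Pi)); last first.
  by apply: ereal_sup_ubound; exists (unit_policy K I), Pi.
have rev0 x : 0 <= x <= L -> 0 <= revbar I ord0 x by exact: revbar_ge0.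
pose g (s : st) : \bar R := (revbar I ord0 0 + (revbar I ord0 L - revbar I ord0 0) * \1_nf s)%:E.
have gE s : g s = (\sum_(j < 1) revbar I j (unit_policy K I s j))%:E.
  rewrite /g big_ord1 /unit_policy indicE; congr EFin.
  have [sK|sK] := boolP (size (s ord0) < K)%N; first by rewrite mem_set// mulr1 addrC subrK.
  by rewrite memNset ?mulr0 ?addr0//; exact/negP.
have ng : nnm g.
  split; last first.
    by move=> s; rewrite gE lee_fin big_ord1; apply: rev0; exact: adm.2.
  apply/measurable_EFinP; apply: measurable_funD => //; apply: measurable_funM => //.
rewrite /dynamic_revenue.
have -> : (\sum_(i < K.+1) \sum_(x : {ffun 'I_1 -> 'I_K.+2} | (\sum_(j < 1) x j)%N == i)
     \int[Pi]_(s in states_with (fun j => x j)) (\sum_(j < 1) revbar I j (unit_policy K I s j))%:E)%E =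
   (\int[Pi]_(s in D) g s)%E.
  rewrite -(integral_states_with K.+1 Pi ng); apply: eq_bigr => i _; apply: eq_bigr => x _.
  by apply: eq_integral => s _; rewrite gE.
have b_a : 0 <= b - a by rewrite subr_ge0.
apply: (@le_trans _ _ (\int[Pi]_(s in D) (a%:E + (b - a)%:E * (\1_nf s)%:E))%E); last first.
  apply: le_integral_ge0 => s _; first by rewrite adde_ge0 ?mule_ge0 ?lee_fin.
  rewrite -EFinM -EFinD lee_fin indicE; case: (s \in nf); rewrite ?mulr1 ?mulr0 ?addr0//.
  by rewrite addrC subrK addrC subrK.
have mi : measurable_fun [set: st] (fun s : st => (\1_nf s)%:E : \bar R).
  by apply/measurable_EFinP; exact: measurable_indic.
have mz : measurable_fun [set: st] (fun s : st => ((b - a)%:E * (\1_nf s)%:E)%E : \bar R).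
  by apply: emeasurable_funM.
rewrite ge0_integralD; last 5 first.
- exact: mD.
- by move=> s _; rewrite lee_fin.
- exact: measurable_cst.
- by move=> s _; rewrite mule_ge0 ?lee_fin.
- by apply: measurable_funTS; exact: mz.
rewrite ge0_integralZl_EFin; last 4 first.
- exact: mD.
- by move=> s _; rewrite lee_fin.
- by apply: measurable_funTS; exact: mi.
- exact: b_a.
rewrite integral_cst// integral_indic//.
have [q0 q1] := andP q01.
apply: (@le_trans _ _ (a%:E * 1 + (b - a)%:E * q%:E)%E); last first.
  rewrite le_eqVlt; apply/orP; left; apply/eqP.
  by congr (_ * _ + _ * _)%E; apply/esym; [exact: PD|exact: PDnf].
rewrite mule1 -EFinM -EFinD lee_fin lerD2l ler_wpM2l//.
rewrite ler_pdivrMr; last by rewrite addr_gt0// ltr0n.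
by rewrite mulrBr mulr1 in Lq; lra.
Qed.

End unit_service_revenue.

Lemma service_mean_dirac (R : realType) (G : probability R R) :
  (forall A, G A = \d_(1 : R) A) -> service_mean G = 1%E.
Proof.
move=> GE; rewrite /service_mean.
transitivity (\int[@dirac _ _ (1%R : R) R]_x x%:E)%E.
  by apply: eq_measure_integral => A _ _; exact: GE.
by rewrite integral_dirac ?diracT ?mul1e//; exact: EFin_measurable.
Qed.

Section pareto_instance.
Context (R : realType) (w A : R) (m : nat).
Hypotheses (w0 : 0 < w) (w1 : w < 1) (m2 : (1 < m)%N) (A0 : 0 < A).

Variable V : valuation R.
Hypotheses (lo1 : val_lo V = 1) (hiy : val_hi V = +oo%E)
  (tailE : forall x, 1 <= x -> 1 - val_cdf V x = w * x^-1 + (1 - w) * x^-1 ^+ m.+1)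
  (densE : forall x, 1 <= x ->
     val_dens V x = x^-1 ^+ 2 * (w + (1 - w) * m.+1%:R * x^-1 ^+ m)).

(** The virtual value is positive at 2 but at most [B / x] at [x], hence smaller than that further
    out; the decay uses [m > 1]. *)
Lemma pareto_irregular : irregular V.
Proof.
move=> reg.
pose vv (x : R) := x * ((1 - w) * m%:R * x^-1 ^+ m) / (w + (1 - w) * m.+1%:R * x^-1 ^+ m).
have w1' : 0 < 1 - w by rewrite subr_gt0.
have den0 (x : R) : 0 < x -> 0 < w + (1 - w) * m.+1%:R * x^-1 ^+ m.
  by move=> x0; rewrite ltr_pwDl// !mulr_ge0 ?exprn_ge0 ?invr_ge0 ?ltW.
have vvE x : 1 <= x -> virtual_value V x = vv x.
  move=> x1; have x0 : 0 < x by lra.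
  rewrite /virtual_value tailE// densE// /vv exprS.
  have := den0 x x0; set z := x^-1 ^+ m; rewrite -natr1 => d0.
  by field; rewrite !gt_eqF.
have vv2 : 0 < vv 2.
  rewrite /vv divr_gt0 ?den0// !mulr_gt0 ?exprn_gt0 ?invr_gt0 ?ltr0n//.
  by rewrite (ltn_trans _ m2).
pose B := (1 - w) * m%:R / w.
have B0 : 0 <= B by exact: divr_ge0 (mulr_ge0 (ltW w1') (ler0n _ _)) (ltW w0).
pose x := 2 + B / vv 2 + 1.
have Bv : 0 <= B / vv 2 by exact: divr_ge0 B0 (ltW vv2).
have x2 : 2 <= x by rewrite /x; lra.
have x0 : 0 < x by lra.
have y0 : 0 < x^-1 by rewrite invr_gt0.
have y1 : x^-1 <= 1 by rewrite invf_le1//; lra.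
have vvx : vv x <= B * x^-1.
  rewrite /vv ler_pdivrMr ?den0//.
  have -> : x * ((1 - w) * m%:R * x^-1 ^+ m) = (1 - w) * m%:R * x^-1 ^+ m.-1.
    have -> : x^-1 ^+ m = x^-1 * x^-1 ^+ m.-1 by rewrite -exprS (prednK (ltnW m2)).
    by rewrite mulrCA mulVKf// gt_eqF.
  have h : x^-1 ^+ m.-1 <= x^-1.
    case: m m2 => [//|[//|k]] _ /=; rewrite exprS ler_piMr ?(ltW y0)// exprn_ile1 ?(ltW y0)//.
  apply: (@le_trans _ _ (B * x^-1 * w)).
    have Bw : B * w = (1 - w) * m%:R by rewrite /B mulfVK// gt_eqF.
    rewrite [leRHS]mulrAC Bw; apply: ler_wpM2l => //.
    exact: mulr_ge0 (ltW w1') (ler0n _ _).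
  rewrite ler_wpM2l//; first exact: mulr_ge0 B0 (ltW y0).
  rewrite lerDl; apply: mulr_ge0; last by rewrite exprn_ge0// ltW.
  exact: mulr_ge0 (ltW w1') (ler0n _ _).
have lt2 : B * x^-1 < vv 2.
  rewrite ltr_pdivrMr// mulrC -ltr_pdivrMr// /x -addrA addrC -addrA ltrDl; lra.
have := reg 2 x; rewrite lo1 hiy ltry => /(_ _ x2 isT); rewrite !vvE; [|lra|lra].
have lt12 : 1 < 2 :> R by lra.
by move=> /(_ lt12) h; have := lt_le_trans (le_lt_trans vvx lt2) h; rewrite ltxx.
Qed.

(** [y] is the inverse of the price. A price inducing [l] exists on [[1, A / l]] by the intermediate
    value theorem, as the tail at [x] is at most [1 / x]. *)
Lemma pareto_price (l : R) : 0 < l <= A -> exists y, [/\ 0 < y, y <= 1,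
  l = A * (w * y + (1 - w) * y ^+ m.+1) &
  l * price V A l = A * (w + (1 - w) * y ^+ m)].
Proof.
move=> /andP[l0 lA]; pose tl (x : R) := w * x^-1 + (1 - w) * x^-1 ^+ m.+1.
have X1 : 1 <= A / l by rewrite ler_pdivlMr// mul1r.
have ctl : {within `[1, (A / l)], continuous tl}.
  apply: continuous_in_subspaceT => x; rewrite inE/= in_itv/= => /andP[x1 _].
  have xN0 : x != 0 by rewrite gt_eqF//; lra.
  have cV : {for x, continuous (fun x : R => x^-1)} by exact: inv_continuous.
  have cX : {for x, continuous (fun x : R => x^-1 ^+ m.+1)}.
    by apply: (@continuous_comp _ _ _ (fun x : R => x^-1) (fun y : R => y ^+ m.+1)) => //; exact: exprn_continuous.
  by apply: cvgD; apply: cvgM; [exact: cvg_cst|exact: cV|exact: cvg_cst|exact: cX].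
have tl1 : tl 1 = 1 by rewrite /tl invr1 expr1n; ring.
have tlX : tl (A / l) <= l / A.
  rewrite /tl invf_div; set y := l / A.
  have y0 : 0 <= y by rewrite divr_ge0 ?ltW.
  have y1 : y <= 1 by rewrite ler_pdivrMr// mul1r.
  have yX : y ^+ m.+1 <= y by rewrite exprS ler_piMr ?exprn_ile1.
  have E : y = w * y + (1 - w) * y by ring.
  by rewrite [leRHS]E lerD2l ler_wpM2l// subr_ge0 ltW.
have [x] : exists2 x, x \in `[1, (A / l)] & tl x = l / A.
  apply: IVT => //; rewrite tl1 min_r; last by rewrite (le_trans tlX)// ler_pdivrMr// mul1r.
  by rewrite tlX/= max_l ?ler_pdivrMr ?mul1r// (le_trans tlX)// ler_pdivrMr// mul1r.
rewrite in_itv/= => /andP[x1 _] xE.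
have ex : exists x : R, ((val_lo V)%:E <= x%:E <= val_hi V)%E /\ A * (1 - val_cdf V x) = l.
  exists x; rewrite lo1 hiy lee_fin x1 leey; split => //.
  by rewrite tailE// -/(tl x) xE mulrC divfK ?gt_eqF.
have := xgetPex (val_lo V) ex; rewrite -/(price V A l) lo1 lee_fin => -[/andP[p1 _]].
rewrite tailE// => pE; set p := price V A l in p1 pE *.
have p0 : 0 < p by lra.
exists p^-1; split; rewrite ?invr_gt0 ?invf_le1//.
by rewrite -[in LHS]pE exprS; set z := p^-1 ^+ m; field; rewrite gt_eqF.
Qed.

Lemma pareto_revenue_cvg : l * price V A l @[l --> 0^'+] --> A * w.
Proof.
apply/cvgrPdist_le => e e0; near=> l.
have l0 : 0 < l by near: l; exact: nbhs_right_gt.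
have lA : l < A by near: l; exact: nbhs_right_lt.
have le : l < e * w by near: l; apply: nbhs_right_lt; rewrite mulr_gt0.
have [|y [y0 y1 lE ->]] := pareto_price (l := l); first by rewrite l0 ltW.
have yX : y ^+ m <= y by rewrite -(prednK (ltnW m2)) exprS ler_piMr ?exprn_ile1 ?(ltW y0).
have yX0 : 0 <= y ^+ m by rewrite exprn_ge0 ?(ltW y0).
have yX1 : 0 <= y ^+ m.+1 by rewrite exprn_ge0 ?(ltW y0).
have w1' : 0 <= 1 - w by rewrite subr_ge0 ltW.
have -> : A * w - A * (w + (1 - w) * y ^+ m) = - (A * ((1 - w) * y ^+ m)) by ring.
rewrite normrN ger0_norm; last by rewrite !mulr_ge0 ?(ltW A0).
have h1 : A * (w * y) <= l by rewrite lE ler_pM2l// lerDl mulr_ge0.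
have h2 : A * ((1 - w) * y ^+ m) <= A * y by rewrite ler_pM2l// (le_trans _ yX)// ler_piMl// gerBl ltW.
apply: (le_trans h2); rewrite -(ler_pM2r w0) -mulrA (mulrC y).
by apply: (le_trans h1); exact: ltW.
Unshelve. all: by end_near.
Qed.

End pareto_instance.

(** * Tight instances *)

Lemma pareto_class (R : realType) (w A : R) (m : nat) : 0 < w -> w < 1 -> (1 < m)%N -> 0 < A ->
  exists I : 'I_1 -> customer_class R, [/\ Omega_irreg I, cl_rate (I ord0) = A,
    (forall B, cl_serv (I ord0) B = \d_(1 : R) B), Defs.rev I ord0 0 = A * w &
    forall l, 0 < l <= A -> exists y, [/\ 0 < y, y <= 1,
      l = A * (w * y + (1 - w) * y ^+ m.+1) & Defs.rev I ord0 l = A * (w + (1 - w) * y ^+ m)]].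
Proof.
move=> w0 w1 m2 A0; have [V [lo1 hiy tailE densE]] := pareto_mixture m w0 w1.
have price_ l : 0 < l <= A -> exists y, [/\ 0 < y, y <= 1,
    l = A * (w * y + (1 - w) * y ^+ m.+1) & l * price V A l = A * (w + (1 - w) * y ^+ m)].
  by move=> lA; apply: pareto_price.
have cvg_ : l * price V A l @[l --> 0^'+] --> A * w by apply: (@pareto_revenue_cvg _ w A m).
have rev0 : val_hi V = +oo%E -> cvg (l * price V A l @[l --> 0^'+]).
  by move=> _; apply/cvg_ex; exists (A * w).
pose G : probability R R := @dirac _ _ (1 : R) R.
have G0 : G [set` `[0, +oo[] = 1%E.
  have h : (1 : R) \in [set` `[0, +oo[] by rewrite mem_set//= in_itv/= ler01.
  by transitivity ((\1_([set` `[0%R, +oo[]) (1 : R) : R)%:E); [by [] | rewrite indicE h].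
have Gm : (0 < service_mean G < +oo)%E by rewrite service_mean_dirac// lte01 ltry.
exists (fun=> @CustomerClass R A V G A0 rev0 G0 Gm); split => //=.
- by move=> j; apply: (@pareto_irregular _ w m).
- by rewrite /Defs.rev /revenue/= eqxx hiy eqxx/=; exact: cvg_lim cvg_.
- move=> l lA; have [y [y0 y1 lE rE]] := price_ l lA; exists y; split => //.
  by rewrite /Defs.rev /revenue/= gt_eqF//; case/andP: lA.
Qed.

(** The difference [1 - y^(k+1)] is [1 - y] times a sum of [k + 1] powers of [y], each at least
    [y^k]. *)
Lemma bernoulli_one_sub (R : realType) (y : R) k : 0 <= y <= 1 ->
  k.+1%:R * y ^+ k * (1 - y) <= 1 - y ^+ k.+1.
Proof.
move=> /andP[y0 y1]; elim: k => [|k IH]; first by rewrite expr0 expr1 !mul1r.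
have yk0 : 0 <= y ^+ k.+1 by rewrite exprn_ge0.
have yk1 : y ^+ k.+1 <= 1 by rewrite exprn_ile1.
have h1 : y * (k.+1%:R * y ^+ k * (1 - y)) <= y * (1 - y ^+ k.+1) by rewrite ler_wpM2l.
have -> : k.+2%:R * y ^+ k.+1 * (1 - y) = y * (k.+1%:R * y ^+ k * (1 - y)) + y ^+ k.+1 * (1 - y).
  by rewrite -[k.+2%:R]natr1 exprS; ring.
have h2 : 0 <= (1 - y) * (1 - y ^+ k.+1) by rewrite mulr_ge0 ?subr_ge0.
rewrite [y ^+ k.+2]exprS; nra.
Qed.

Lemma expn_lower (R : realType) (e : R) k : 0 <= e -> 1 + k%:R * e <= (1 + e) ^+ k.
Proof.
move=> e0; elim: k => [|k IH]; first by rewrite mul0r addr0 expr0.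
have : (1 + k%:R * e) * (1 + e) <= (1 + e) ^+ k.+1 by rewrite exprSr ler_wpM2r// addr_ge0.
have : 0 <= k%:R * e * e by rewrite !mulr_ge0.
rewrite -natr1; nra.
Qed.

Lemma static_opt_le (R : realType) (C : nat) (I : 'I_1 -> customer_class R) q (S : R) :
  (forall B, cl_serv (I ord0) B = \d_(1 : R) B) ->
  (forall l, 0 <= l <= cl_rate (I ord0) ->
     q ord0 l * (partial_exp C l / partial_exp C.+1 l) <= S) ->
  (static_opt C I q <= S%:E)%E.
Proof.
move=> serv h; apply: ge_ereal_sup => _ [lam lamL <-].
rewrite lee_fin /static_revenue !big_ord1 -!/(partial_exp _ _).
by rewrite /mean_service service_mean_dirac//= mulr1; exact: h.
Qed.

Lemma ratio_le (R : realType) (S D : R) (s d : \bar R) : 0 <= S -> 0 < D ->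
  (s <= S%:E)%E -> (D%:E <= d)%E -> (s / d <= (S / D)%:E)%E.
Proof.
move=> S0 D0 sS Dd.
have dpos : (0 < d)%E by apply: lt_le_trans Dd; rewrite lte_fin.
have dV0 : (0 <= d^-1)%E by rewrite inve_ge0 ltW.
apply: (@le_trans _ _ (S%:E * d^-1)%E); first by rewrite lee_wpmul2r.
rewrite EFinM lee_wpmul2l ?lee_fin//.
case: d Dd dpos {dV0} => [d| |]// Dd d0; last by rewrite invey lee_fin invr_ge0 ltW.
rewrite lte_fin in d0; rewrite lee_fin in Dd.
by rewrite inver gt_eqF// lee_fin lef_pV2 ?posrE.
Qed.

Lemma inf_irreg_le (R : realType) (ratio : forall C M : nat, ('I_M -> customer_class R) -> \bar R)
    C (I : 'I_1 -> customer_class R) : (0 < C)%N -> Omega_irreg I ->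
  (inf_irreg ratio <= ratio C 1%N I)%E.
Proof.
move=> C0 II; apply: (@le_trans _ _ (ereal_inf [set ratio C 1%N I | I in @Omega_irreg R 1])).
  by apply: ereal_inf_lbound; exists (C, 1%N).
by apply: ereal_inf_lbound; exists I.
Qed.

Lemma inf_irreg_ge (R : realType) (ratio : forall C M : nat, ('I_M -> customer_class R) -> \bar R)
    (b : nat -> R) :
  (forall C M (I : 'I_M -> customer_class R), (0 < C)%N -> (0 < M)%N -> ((b C)%:E <= ratio C M I)%E) ->
  (ereal_inf [set (b C)%:E | C in [set C : nat | (0 < C)%N]] <= inf_irreg ratio)%E.
Proof.
move=> h; apply: le_ereal_inf_tmp => _ [[C M] [/= C0 M0] <-].
apply: le_ereal_inf_tmp => _ [I _ <-]; apply: le_trans (h C M I C0 M0).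
by apply: ereal_inf_lbound; exists C.
Qed.

(** The instances reach the bound only up to [e]; this lets [e] tend to 0. *)
Lemma le_perturbed_ratio (R : realType) (x : \bar R) (a a' b : R) : 0 <= a -> 0 <= a' -> 0 < b ->
  (forall e : R, 0 < e -> e < b -> (x <= ((a + a' * e) / (b - e))%:E)%E) -> (x <= (a / b)%:E)%E.
Proof.
move=> a0 a'0 b0 h; apply/lee_addgt0Pr => d d0.
have ab0 : 0 <= a / b by rewrite divr_ge0// ltW.
have c1 : 0 < a' + a / b + d + d by lra.
(* The claim reduces to [e (a' + a / b + d) <= d b]; the second [d] ensures [e < b] even when [a]
   and [a'] vanish. *)
pose e := d * b / (a' + a / b + d + d).
have e0 : 0 < e by rewrite divr_gt0// mulr_gt0.
have eE : e * (a' + a / b + d + d) = d * b by rewrite /e divfK// gt_eqF.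
have eb : e < b.
  by rewrite /e ltr_pdivrMr// mulrC ltr_pM2l//; lra.
apply: le_trans (h e e0 eb) _; rewrite -EFinD lee_fin ler_pdivrMr ?subr_gt0//.
have aE : a = a / b * b by rewrite divfK// gt_eqF.
have : 0 <= e * d by rewrite mulr_ge0 ?ltW.
set r := a / b in ab0 eE aE *; rewrite aE => ed.
rewrite -subr_ge0 (_ : _ - _ = d * b - e * (a' + r + d + d) + e * d); last by ring.
by rewrite eE subrr add0r.
Qed.

(** With [m = k + 1], this puts the revenue [A (w + (1 - w) y^m)] below the chord [A w + (1 - w) l],
    and the envelope with it. It is [bernoulli_one_sub] scaled by [w], using [w m >= 1]. *)
Lemma mixture_key (R : realType) (w y : R) k : 0 < w -> w < 1 -> 1 <= w * k.+1%:R ->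
  0 < y -> y <= 1 -> y ^+ k.+1 <= w * y + (1 - w) * y ^+ k.+2.
Proof.
move=> w0 w1 wk y0 y1; have := @bernoulli_one_sub R y k.
rewrite (ltW y0) y1 => /(_ isT); rewrite !exprS; set z := y ^+ k => h.
have z0 : 0 <= z by rewrite exprn_ge0// ltW.
have h1 : w * (k.+1%:R * z * (1 - y)) <= w * (1 - y * z) by rewrite ler_pM2l.
have h2 : 0 <= (w * k.+1%:R - 1) * (z * (1 - y)) by rewrite mulr_ge0 ?subr_ge0// mulr_ge0 ?subr_ge0.
have h3 : z <= w + (1 - w) * (y * z) by lra.
have -> : w * y + (1 - w) * (y * (y * z)) = y * (w + (1 - w) * (y * z)) by ring.
by rewrite ler_pM2l.
Qed.

(** At full demand [y] times the revenue is [A], and [y <= 1]; the price itself need not be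
    identified. *)
Lemma mixture_top (R : realType) (A w y : R) k : 0 < A -> 0 < w -> w < 1 -> 0 < y -> y <= 1 ->
  A = A * (w * y + (1 - w) * y ^+ k.+1) -> A <= A * (w + (1 - w) * y ^+ k).
Proof.
move=> A0 w0 w1 y0 y1 E; rewrite -[leLHS]mulr1 ler_pM2l//.
have t0 : 0 <= w + (1 - w) * y ^+ k.
  by rewrite addr_ge0 ?mulr_ge0 ?exprn_ge0 ?subr_ge0 ?(ltW w0) ?(ltW w1) ?(ltW y0).
have yt : y * (w + (1 - w) * y ^+ k) = 1.
  apply: (mulfI (lt0r_neq0 A0)); rewrite mulr1 [RHS]E exprS; ring.
by rewrite -[leLHS]yt ler_piMl.
Qed.

(** The intercept 59/18 is the one for which the static revenue [(59/18 + l) S_3 / S_4], with [S_n]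
    the partial exponential at [l], peaks at [l = 2 = C - 1], with value 75/18; hence the double
    root at 2. *)
Lemma erlang3_bound (R : realType) (l : R) : 0 <= l ->
  (59 / 18 + l) * partial_exp 3 l <= 75 / 18 * partial_exp 4 l.
Proof.
move=> l0; have E3 : partial_exp 3 l = 1 + l + l ^+ 2 / 2.
  by rewrite /partial_exp !big_nat_recl//= big_geq// !factS fact0 !muln1 expr0 expr1; field.
have E4 : partial_exp 4 l = 1 + l + l ^+ 2 / 2 + l ^+ 3 / 6.
  by rewrite partial_expS E3 !factS fact0.
rewrite E3 E4 -subr_ge0 (_ : _ - _ = (l - 2) ^+ 2 * (7 * l + 8) / 36); last by field.
by rewrite divr_ge0// mulr_ge0 ?sqr_ge0//; lra.
Qed.

(** With three units, all revenues are scaled by [be]: the static policy earns at most 75/18, while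
    the threshold policy earns the intercept 59/18 plus a throughput close to 2, nearly 95/18 in
    all. *)
Lemma randomized_tight (R : realType) :
  (inf_irreg (fun C M (I : 'I_M -> customer_class R) =>
      static_opt_randomized C I / dynamic_opt C I) <= (15 / 19)%:E)%E.
Proof.
have -> : 15 / 19 = (75 / 18) / (95 / 18) :> R by field.
apply: (@le_perturbed_ratio _ _ (75 / 18) 0 (95 / 18)) => // e e0 eb.
(* This [A] brings the throughput [2 A / (2 + A)] within [e] of 2; [w] is then chosen to make the
   chord from [A w] at rate 0 to [A] at rate [A] proportional to [59/18 + l]. *)
pose A := 4 / e; have A0 : 0 < A by rewrite divr_gt0.
pose c : R := A + 59 / 18; have c0 : 0 < c by rewrite /c; lra.
pose w := 59 / 18 / c; have w0 : 0 < w by rewrite divr_gt0//; lra.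
have wE : 1 - w = A / c by rewrite /w /c; field; rewrite gt_eqF//; lra.
have w1 : w < 1 by rewrite -subr_gt0 wE divr_gt0.
pose m := (Num.truncn w^-1).+2.
have mw : 1 <= w * m%:R.
  rewrite mulrC -ler_pdivrMr// mul1r ltW// (lt_le_trans (truncnS_gt _))//.
  by rewrite ler_nat /m ltnW.
have [I [II LE serv r0 rl]] := @pareto_class R w A m w0 w1 isT A0.
pose be := A / c; have be0 : 0 < be by rewrite divr_gt0.
have wA : A * w = be * (59 / 18) by rewrite /w /be; ring.
have rub l : 0 <= l <= A -> Defs.rev I ord0 l <= be * (59 / 18) + be * l.
  rewrite le_eqVlt => /andP[/predU1P[<- _|l0 lA]]; first by rewrite r0 wA mulr0 addr0.
  have [|y [y0 y1 lE ->]] := rl l; first by rewrite l0.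
  have key := mixture_key w0 w1 mw y0 y1.
  rewrite mulrDr wA lerD2l -/be (_ : be * l = (1 - w) * l); last by rewrite wE.
  by rewrite mulrCA ler_wpM2l ?subr_ge0 ?(ltW w1)// lE ler_pM2l.
apply: (le_trans (inf_irreg_le (C := 3) _ isT II)).
apply: (@le_trans _ _ ((be * (75 / 18)) / (be * (95 / 18 - e)))%:E); last first.
  by rewrite lee_fin mul0r addr0 -mulf_div divff ?gt_eqF// mul1r.
apply: ratio_le.
- by rewrite mulr_ge0 ?(ltW be0)//; lra.
- by rewrite mulr_gt0// subr_gt0.
- apply: static_opt_le => // l; rewrite LE => lA; have [l0 _] := andP lA.
  have rb : revbar I ord0 l <= be * (59 / 18) + be * l.
    by apply: revbar_le_affine; rewrite LE.
  have S4 : 0 < partial_exp 4 l by exact: partial_exp_gt0.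
  have S3 : 0 < partial_exp 3 l by exact: partial_exp_gt0.
  rewrite mulrA ler_pdivrMr//.
  apply: (@le_trans _ _ ((be * (59 / 18) + be * l) * partial_exp 3 l)); first by rewrite ler_pM2r.
  have h := erlang3_bound l0; rewrite -(ler_pM2l be0) in h.
  have -> : (be * (59 / 18) + be * l) * partial_exp 3 l = be * ((59 / 18 + l) * partial_exp 3 l) by ring.
  have -> : be * (75 / 18) * partial_exp 4 l = be * (75 / 18 * partial_exp 4 l) by ring.
  exact: h.
- have ge0 : 0 <= A * w by rewrite mulr_ge0 ?ltW.
  have L0 : 0 <= A by exact: ltW.
  have rA : A <= Defs.rev I ord0 A.
    have [|y [y0 y1 AE ->]] := rl A; first by rewrite A0 lexx.
    exact: (mixture_top A0 w0 w1 y0 y1 AE).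
  apply: le_trans (dynamic_opt_unit_ge (K := 2) serv isT (a := A * w) (b := A) _ _ _).
  + rewrite lee_fin LE (_ : A - A * w = be * A); last by rewrite /be -wE; ring.
    have -> : A * w + be * A * (2 / (2 + A)) = be * (59 / 18 + A * (2 / (2 + A))) by rewrite wA; ring.
    rewrite ler_pM2l//.
    have eA : e * A = 4 by rewrite /A mulrC divfK// gt_eqF.
    suff : 2 - e <= A * (2 / (2 + A)) by lra.
    by rewrite mulrA ler_pdivlMr; [nra|lra].
  + by rewrite ge0/= ger_pMr// ltW.
  + by rewrite -r0; apply: rev_le_revbar; rewrite LE lexx.
  + by rewrite LE (le_trans rA)//; apply: rev_le_revbar; rewrite LE lexx andbT.
Qed.

(* Carried load at most the capacity bounds the revenue by [C x]; at prices [x]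
   away from 1 the second Pareto component is negligible for large [m]. *)
Lemma deterministic_tight (R : realType) (C : nat) : (1 < C)%N ->
  (inf_irreg (fun C M (I : 'I_M -> customer_class R) =>
      static_opt_deterministic C I / dynamic_opt C I) <= (C%:R / (2 * C%:R - 1))%:E)%E.
Proof.
case: C => [//|K] K0; set C : R := K.+1%:R.
have KC : K%:R = C - 1 by rewrite /C -natr1 addrK.
have C2 : 2 <= C by rewrite ler_nat.
have K1 : 1 <= K%:R :> R by rewrite KC; lra.
have C_ge0 : 0 <= C by lra.
have D_gt0 : 0 < 2 * C - 1 by lra.
apply: (le_perturbed_ratio C_ge0 C_ge0 D_gt0) => e e0 eb.
(* Rate 0 earns [A w = C] and full demand at least [A], so the threshold policy earns at least
   [C + (A - C) K / (K + A)]; this [A] brings that within [e] of [C + K = 2 C - 1]. *)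
pose A := C + K%:R * (C + K%:R) / e.
have A1 : C < A by rewrite ltrDl divr_gt0// mulr_gt0; lra.
have A0 : 0 < A by lra.
pose w := C / A; have w0 : 0 < w by rewrite divr_gt0//; lra.
have w1 : w < 1 by rewrite ltr_pdivrMr// mul1r.
have wA : A * w = C by rewrite /w mulrC divfK// gt_eqF.
(* Large enough that [A y^m <= C e] whenever [y (1 + e) < 1], by Bernoulli's inequality for
   [(1 + e)^m]. *)
pose m := (Num.truncn (A / (C * e * e))).+2.
have Cee : 0 < C * e * e by rewrite !mulr_gt0//; lra.
have me : A <= m%:R * e * (C * e).
  have -> : m%:R * e * (C * e) = m%:R * (C * e * e) by ring.
  rewrite -ler_pdivrMr// ltW// (lt_le_trans (truncnS_gt _))//.
  by rewrite ler_nat /m ltnW.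
have [I [II LE serv r0 rl]] := @pareto_class R w A m w0 w1 isT A0.
apply: (le_trans (inf_irreg_le (C := K.+1) _ isT II)).
apply: ratio_le.
- by rewrite addr_ge0 ?mulr_ge0 ?(ltW e0)//; lra.
- by rewrite subr_gt0.
- apply: static_opt_le => // l; rewrite LE => /andP[]; rewrite le_eqVlt => /predU1P[<- _|l0 lA].
    have p0 : partial_exp K.+1 (0 : R) = partial_exp K.+2 0.
      by rewrite [RHS]partial_expS expr0n mul0r addr0.
    rewrite r0 wA -p0 divff ?mulr1; last by rewrite gt_eqF// partial_exp_gt0.
    by rewrite lerDl mulr_ge0 ?(ltW e0)//; lra.
  have [|y [y0 y1 lE rE]] := rl l; first by rewrite l0.
  have S2 : 0 < partial_exp K.+2 l by apply: partial_exp_gt0 => //; exact: ltW.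
  have S1 : 0 < partial_exp K.+1 l by apply: partial_exp_gt0 => //; exact: ltW.
  have S12 : partial_exp K.+1 l <= partial_exp K.+2 l.
    by rewrite [leRHS]partial_expS lerDl divr_ge0 ?exprn_ge0 ?ltW.
  have carried : l * partial_exp K.+1 l <= C * partial_exp K.+2 l.
    rewrite /partial_exp [X in C * X]big_nat_recl// mulrDr ler_wpDl//; first by rewrite expr0 fact0 divr1 mulr1; lra.
    rewrite !mulr_sumr !big_mkord; apply: ler_sum => i _.
    have iF : 0 < (i`!)%:R :> R by exact: fact_gt0R.
    have -> : C * (l ^+ i.+1 / (i.+1)`!%:R) = l ^+ i.+1 / i`!%:R * (C / i.+1%:R).
      by rewrite factS natrM invfM; ring.
    have -> : l * (l ^+ i / i`!%:R) = l ^+ i.+1 / i`!%:R by rewrite exprS mulrA.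
    rewrite ler_peMr ?divr_ge0 ?exprn_ge0 ?(ltW l0) ?(ltW iF)//.
    by rewrite ler_pdivlMr ?ltr0n// mul1r ler_nat.
  have rl1 : Defs.rev I ord0 l = C + A * (1 - w) * y ^+ m by rewrite rE mulrDr wA mulrA.
  have rly : Defs.rev I ord0 l * y = l by rewrite rE [RHS]lE exprS; ring.
  have r_ge0 : 0 <= Defs.rev I ord0 l.
    by rewrite -(pmulr_lge0 _ y0) rly ltW.
  rewrite mulrA ler_pdivrMr//.
  have [ye|ye] := leP 1 (y * (1 + e)).
    rewrite -(ler_pM2l y0) [leLHS]mulrA (mulrC y) rly.
    apply: (le_trans carried); have -> : y * ((C + C * e) * partial_exp K.+2 l) =
      y * (1 + e) * (C * partial_exp K.+2 l) by ring.
    by rewrite ler_peMl// mulr_ge0 ?(ltW S2)//; lra.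
  apply: ler_pM => //; first exact: ltW.
  rewrite rl1 lerD2l.
  have ym0 : 0 <= y ^+ m by rewrite exprn_ge0// ltW.
  have b1 : (1 + m%:R * e) * y ^+ m <= 1.
    apply: (@le_trans _ _ ((1 + e) ^+ m * y ^+ m)).
      by rewrite ler_wpM2r//; apply: expn_lower; exact: ltW.
    rewrite -exprMn exprn_ile1//; first by rewrite mulr_ge0 ?(ltW y0)//; lra.
    by rewrite mulrC ltW.
  apply: (@le_trans _ _ (A * y ^+ m)).
    by rewrite ler_wpM2r// ler_piMr ?(ltW A0)// gerBl ltW.
  apply: (@le_trans _ _ (m%:R * e * (C * e) * y ^+ m)); first by rewrite ler_wpM2r.
  have Ce : 0 <= C * e by rewrite mulr_ge0// ltW.
  have b2 : m%:R * e * y ^+ m <= 1 by move: b1; rewrite mulrDl mul1r; apply: le_trans; rewrite -[leLHS]add0r lerD2r.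
  by rewrite mulrAC; apply: ler_piMl.
- have rA : A <= Defs.rev I ord0 A.
    have [|y [y0 y1 AE ->]] := rl A; first by rewrite A0 lexx.
    exact: (mixture_top A0 w0 w1 y0 y1 AE).
  have L0 : 0 <= A by exact: ltW.
  apply: le_trans (dynamic_opt_unit_ge (K := K) serv _ (a := C) (b := A) _ _ _) => //.
  + rewrite lee_fin LE.
    have eA : e * (A - C) = K%:R * (C + K%:R) by rewrite /A addrAC subrr add0r mulrC divfK// gt_eqF.
    suff : K%:R - e <= (A - C) * (K%:R / (K%:R + A)) by rewrite KC; lra.
    have KA : 0 < K%:R + A by lra.
    rewrite mulrA ler_pdivlMr// mulrBl.
    have : 0 <= e * (K%:R + C) by rewrite mulr_ge0 ?(ltW e0)//; lra.
    lra.
  + by rewrite (ltW A1) andbT; lra.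
  + by rewrite -wA -r0; apply: rev_le_revbar; rewrite LE lexx.
  + by rewrite LE (le_trans rA)//; apply: rev_le_revbar; rewrite LE lexx andbT.
Qed.

(** The tight family needs a threshold [K = C - 1] of at least 1; the case [C = 1] is covered by
    [C = 2], whose value is smaller. *)
Lemma two_units_le_one (R : realType) :
  2%:R / (2 * 2%:R - 1) <= 1%:R / (2 * 1%:R - 1) :> R.
Proof.
have -> : 2 * 1%:R - 1 = 1 :> R by ring.
by rewrite divr1 ler_pdivrMr; lra.
Qed.

Theorem theorem5 (R : realType) :
  (inf_irreg (fun C M (I : 'I_M -> customer_class R) =>
      static_opt_randomized C I / dynamic_opt C I)%E
     = ereal_inf [set (Gratio R C)%:E | C in [set C : nat | (0 < C)%N]] /\
   ((15 / 19)%:E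
     <= ereal_inf [set (Gratio R C)%:E | C in [set C : nat | (0 < C)%N]])%E) /\
  (inf_irreg (fun C M (I : 'I_M -> customer_class R) =>
      static_opt_deterministic C I / dynamic_opt C I)%E
     = ereal_inf [set (C%:R / (2 * C%:R - 1) : R)%:E
                 | C in [set C : nat | (0 < C)%N]] /\
   ((2^-1)%:E
     <= ereal_inf [set (C%:R / (2 * C%:R - 1) : R)%:E
                 | C in [set C : nat | (0 < C)%N]])%E).
Proof.
have G_ge : ((15 / 19)%:E
    <= ereal_inf [set (Gratio R C)%:E | C in [set C : nat | (0 < C)%N]])%E.
  by apply: le_ereal_inf_tmp => _ [C C0 <-]; rewrite lee_fin Gratio_ge.
split; split => //.
(* The chain closes: the infimum of the ratios is at most 15/19, which is at most the infimum of
   [Gratio], which is in turn a lower bound for every ratio. *)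
- apply/eqP; rewrite eq_le (le_trans (randomized_tight R) G_ge)/=.
  by apply: inf_irreg_ge => C M I C0 M0; apply: randomized_ratio_ge => //; exact: dynamic_opt_ge0.
- apply/eqP; rewrite eq_le; apply/andP; split.
    apply: le_ereal_inf_tmp => _ [C C0 <-]; have [->|C1] := eqVneq C 1%N.
      apply: le_trans (deterministic_tight R (ltnSn 1)) _; rewrite lee_fin.
      exact: two_units_le_one.
    by apply: deterministic_tight; rewrite ltn_neqAle eq_sym C1.
  apply: (inf_irreg_ge (b := fun C => C%:R / (2 * C%:R - 1))) => C M I C0 M0.
  by apply: deterministic_ratio_ge => //; exact: dynamic_opt_ge0.
- apply: le_ereal_inf_tmp => _ [C /= C0 <-]; rewrite lee_fin.
  have C1 : 1 <= C%:R :> R by rewrite ler1n.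
  by clear G_ge; rewrite ler_pdivlMr; lra.
Qed.
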